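(* Let $k\in\mathbb R$, $n\ge1$, and let $L=\sum_{r=0}^n a_rD^r$ with $a_n=1$ be a (monic) modular linear differential operator of order $n$ and type $(k,k+2n)$ on $\Gamma_1=SL_2(\mathbb Z)$. Put $K=2n$ and, for $0\le m\le n-2$, $$h_m=\sum_{s=0}^{n-m}\binom{m+s}{s}\frac{(k+m)_s}{(K-2m-s-1)_s}\,D^s(a_{m+s}).$$ Then $h_m$ is a modular form of weight $2n-2m$ on $\Gamma_1$ for $0\le m\le n-2$, and $$L(f)=\mathcal K_k^n(f)+\sum_{m=0}^{n-2}\binom{2n-m-1}{m}^{-1}[h_m,f]_m^{(K-2m,k)}.$$
   Context: $\mathfrak H$ upper half-plane; $(f|_k\gamma)(\tau)=(c\tau+d)^{-k}f(\gamma\tau)$; $D=\frac1{2\pi i}\frac d{d\tau}$; $q=e^{2\pi i\tau}$; $(x)_s=x(x+1)\cdots(x+s-1)$. A modular linear differential operator of type $(k,k+K)$ on $\Gamma_1$ is a linear differential operator of finite order with coefficients holomorphic on $\mathfrak H$ (and at the cusp) such that $L(f|_k\gamma)=L(f)|_{k+K}\gamma$ for all holomorphic $f$ and $\gamma\in\Gamma_1$. Rankin–Cohen bracket $[g,f]_m^{(\ell,k)}=\sum_{i=0}^m(-1)^i\binom{m+\ell-1}{m-i}\binom{m+k-1}{i}D^i(g)D^{m-i}(f)$. $E_2=1-24\sum\frac{nq^n}{1-q^n}$. Kaneko–Koike operator: $\mathcal K_k^n(f)=D^n(f)-\frac{k+n-1}{12}[f,E_2]^{(k,2)}_{n-1}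$.
   Formalization: The Kaneko–Koike operator is taken with [E_2,f]_{n-1}^{(2,k)} instead of [f,E_2]_{n-1}^{(k,2)}, which changes the sign of that term for even n; as written the formula fails, e.g. for n=2, k=0, L=D^2-(1/6)E_2 D. *)

(* Defs.v *)
From HB Require Import structures.
From mathcomp Require Import all_boot all_order all_algebra.
From mathcomp Require Import all_classical all_reals all_analysis.
From mathcomp Require Import complex.
Set Implicit Arguments.
Unset Strict Implicit.
Unset Printing Implicit Defensive.
Import Order.TTheory GRing.Theory Num.Theory.
Import numFieldNormedType.Exports.

Local Open Scope classical_set_scope.
Local Open Scope ring_scope.
Local Open Scope complex_scope.

(* The ascription to numClosedFieldType is what gives the complex numbers over
   R their norm topology: the library attaches the topology, and hence the
   complex derivative, to abstract numeric fields, not to the type R[i]. *)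
Definition CC (R : realType) : numClosedFieldType := R[i].

Section Complex.
Variable R : realType.
Implicit Types (x k : R) (z w : CC R).

Definition ofR x : CC R := x%:C.

Definition reC z : R := complex.Re (z : R[i]).
Definition imC z : R := complex.Im (z : R[i]).
Definition modC z : R := Normc.normc (z : R[i]).

Definition cexp z : CC R :=
  ofR (expR (reC z)) * ((cos (imC z) +i* sin (imC z))%C : CC R).

(* Principal argument, with values in ]-pi, pi]. *)
Definition carg z : R :=
  let t := acos (reC z / modC z) in if 0 <= imC z then t else - t.

Definition clog z : CC R := (ln (modC z) +i* carg z)%C.

(* z ^ k for z <> 0 and a real exponent k, principal branch. *)
Definition cpow z k : CC R := cexp (ofR k * clog z).

Definition halfplane : set (CC R) := [set z | 0 < imC z].

Definition holo_on_H (f : CC R -> CC R) : Prop :=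
  forall z, halfplane z -> derivable f z 1.

Definition qpar z : CC R := cexp (ofR (2 * pi) * 'i * z).

(* The derivative of f at a point of the half-plane only depends on the values
   of f on the half-plane, so functions on it are taken to be functions on CC R
   whose values elsewhere are irrelevant. *)
Definition D (f : CC R -> CC R) : CC R -> CC R :=
  fun z => (ofR (2 * pi) * 'i)^-1 * derive1 f z.

Definition Dn (n : nat) (f : CC R -> CC R) : CC R -> CC R := iter n D f.

(* Existence of an expansion sum_(i >= 0) c_i q^i on the whole half-plane;
   this includes invariance under z |-> z + 1. *)
Definition holo_at_cusp (f : CC R -> CC R) : Prop :=
  exists c : nat -> CC R, forall z, halfplane z ->
    series (fun i => c i * qpar z ^+ i) @ \oo --> f z.

Definition SL2Z (g : 'M[int]_2) : Prop := \det g = 1.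

Definition autj (g : 'M[int]_2) z : CC R := (g 1 0)%:~R * z + (g 1 1)%:~R.

Definition moebius (g : 'M[int]_2) z : CC R :=
  ((g 0 0)%:~R * z + (g 0 1)%:~R) / autj g z.

Definition slash k (f : CC R -> CC R) (g : 'M[int]_2) : CC R -> CC R :=
  fun z => cpow (autj g z) (- k) * f (moebius g z).

Definition modular_form (w : R) (f : CC R -> CC R) : Prop :=
  [/\ holo_on_H f,
      forall g, SL2Z g -> forall z, halfplane z -> slash w f g z = f z
    & holo_at_cusp f].

(* The operator sum_(r <= n) a_r D^r. *)
Definition diffop (n : nat) (a : nat -> CC R -> CC R) (f : CC R -> CC R)
    : CC R -> CC R :=
  fun z => \sum_(r < n.+1) a r z * Dn r f z.

(* diffop n a is a modular linear differential operator of type (k, l) on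
   SL_2(Z).  The branch chosen in cpow plays no role when l - k is an even
   integer: both sides of the last condition involve the same constant. *)
Definition MLDO (k l : R) (n : nat) (a : nat -> CC R -> CC R) : Prop :=
  [/\ forall r, (r <= n)%N -> holo_on_H (a r),
      forall r, (r <= n)%N -> holo_at_cusp (a r)
    & forall f, holo_on_H f -> forall g, SL2Z g -> forall z, halfplane z ->
        diffop n a (slash k f g) z = slash l (diffop n a f) g z].

Definition monic_diffop (n : nat) (a : nat -> CC R -> CC R) : Prop :=
  forall z, halfplane z -> a n z = 1.

Definition gbin x (i : nat) : R := (\prod_(j < i) (x - j%:R)) / i`!%:R.

Definition poch x (s : nat) : R := \prod_(j < s) (x + j%:R).

(* RC m l k g f is the Rankin-Cohen bracket [g, f]_m^(l, k). *)
Definition RC (m : nat) (l k : R) (g f : CC R -> CC R) : CC R -> CC R :=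
  fun z => \sum_(i < m.+1)
    ofR ((-1) ^+ i * gbin (m%:R + l - 1) (m - i) * gbin (m%:R + k - 1) i)
      * Dn i g z * Dn (m - i) f z.

Definition E2 : CC R -> CC R := fun z =>
  1 - 24%:R * limn (series (fun i : nat =>
        i.+1%:R * qpar z ^+ i.+1 / (1 - qpar z ^+ i.+1))).

(* The Kaneko-Koike operator, for n >= 1.  The order of the arguments matters:
   [f, E2]_(n-1)^(k, 2) = (-1)^(n-1) [E2, f]_(n-1)^(2, k) for the bracket above,
   and the operator is modular of type (k, k + 2n) only with the sign used here,
   which makes the coefficient of D^(n-1) equal to - n (k + n - 1) / 12 * E2;
   e.g. for n = 2 it is
   D^2 f - (k + 1) / 6 * E2 * D f + k (k + 1) / 12 * D E2 * f. *)
Definition KK (k : R) (n : nat) (f : CC R -> CC R) : CC R -> CC R :=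
  fun z => Dn n f z - ofR ((k + n%:R - 1) / 12%:R) * RC n.-1 2 k E2 f z.

Definition hcoef (k K : R) (n : nat) (a : nat -> CC R -> CC R) (m : nat)
    : CC R -> CC R :=
  fun z => \sum_(s < (n - m).+1)
    ofR ('C(m + s, s)%:R
         * (poch (k + m%:R) s / poch (K - 2 * m%:R - s%:R - 1) s))
      * Dn s (a (m + s)%N) z.

End Complex.

(* Main.v *)
(* The statement splits into three parts.

   (1) Put h_(n-1) := a_(n-1).  Comparing the coefficients of D^t(a_(r+t)) D^r(f),
   the identity D^n(f) + sum_(m < n) C(2n-m-1, m)^-1 [h_m, f]_m = L(f) becomes a
   telescoping sum of binomial coefficients.

   (2) Applying the equivariance of L to the test functions (w - gz)^j gives the
   transformation law of the a_j; differentiating it s times, the anomalies in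
   the combination defining h_m cancel, being finite differences of order g of
   polynomials of degree g - 1.

   (3) The term m = n - 1 is the bracket with E2: by (2), phi = a_(n-1) satisfies
   phi(gz) = J^2 phi(z) + lam c J with J = cz + d, and every such phi with a
   q-expansion is tau lam / 12 E2, where tau = 2 pi i.  For lam = 0, a primitive
   of phi is invariant under the modular group and bounded, and Cauchy's
   estimates for its q-expansion force it to be constant.  Consequently
   T_p phi = (p + 1) phi for the Hecke operators T_p, so that c_N = sigma(N) c_1
   for N > 0.  The constant term is found by comparing a primitive of phi at the
   elliptic points, and c_1 from the behaviour of phi(iy) - 4 phi(2iy) as y -> 0. *)
Require Import Defs.
From mathcomp Require Import all_boot all_order all_algebra.
From mathcomp Require Import all_classical all_reals all_analysis.
From mathcomp Require Import complex ring lra zify.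
Import Order.TTheory GRing.Theory Num.Theory.
Import numFieldNormedType.Exports.
Set Implicit Arguments.
Unset Strict Implicit.
Unset Printing Implicit Defensive.
Local Open Scope classical_set_scope.
Local Open Scope ring_scope.

(** Write J = cz + d and X = - c / (tau J). The weights in h_m are forced: in h_m(gz) the
    coefficient of X^(e - v) D^v(a_(m+e)) has to vanish for v < e. The symbols (K - 2m - s - 1)_s in
    the denominators are nonzero for m <= n - 2, but for m = n - 1 and s = 1 the value is 0. So
    a_(n-1) cannot be corrected in this way, and its bracket is the one to be recognised in the
    Kaneko-Koike operator. E2 enters only as a q-series; its transformation law is not established
    beforehand. L itself supplies a form with an anomaly, and that form is computed from its law:
    two forms with the same anomaly differ by a form of weight 2, which is zero, and the principle
    is applied to T_p phi and (p + 1) phi instead of phi and E2. In the asymptotics the factor 4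
    cancels the growth y^-2 of phi(iy) that weight 2 imposes, so that the anomaly becomes the
    leading term. The analysis rests on convergent series: the higher derivatives of the a_r come
    from their q-expansions, and Cauchy's estimates from averages over roots of unity. *)

(** * Complex numbers over a real type *)

Section ModC.
Variable R : realType.
Implicit Types z w : CC R.

Lemma CC_eqP z w : reC z = reC w -> imC z = imC w -> z = w.
Proof. by case: z w => a b [c d] /= -> ->. Qed.

Lemma reCD z w : reC (z + w) = reC z + reC w.
Proof. by case: z w => a b [c d]. Qed.
Lemma imCD z w : imC (z + w) = imC z + imC w.
Proof. by case: z w => a b [c d]. Qed.
Lemma reCN z : reC (- z) = - reC z. Proof. by case: z. Qed.
Lemma imCN z : imC (- z) = - imC z. Proof. by case: z. Qed.
Lemma reCM z w : reC (z * w) = reC z * reC w - imC z * imC w.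
Proof. by case: z w => a b [c d]. Qed.
Lemma imCM z w : imC (z * w) = reC z * imC w + imC z * reC w.
Proof. by case: z w => a b [c d]. Qed.
Lemma reC_ofR (x : R) : reC (ofR x) = x. Proof. by []. Qed.
Lemma imC_ofR (x : R) : imC (ofR x) = 0. Proof. by []. Qed.

Lemma normE z : `|z| = ofR (modC z).
Proof. by rewrite normc_def /modC /Normc.normc; case: z. Qed.

Lemma ofRD (x y : R) : ofR (x + y) = ofR x + ofR y.
Proof. exact: (rmorphD (real_complex R)). Qed.
Lemma ofRM (x y : R) : ofR (x * y) = ofR x * ofR y.
Proof. exact: (rmorphM (real_complex R)). Qed.
Lemma ofRN (x : R) : ofR (- x) = - ofR x.
Proof. exact: (rmorphN (real_complex R)). Qed.
Lemma ofR0 : ofR (0 : R) = 0. Proof. by []. Qed.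
Lemma ofR1 : ofR (1 : R) = 1. Proof. by []. Qed.
Lemma ofR_nat n : ofR (n%:R : R) = n%:R.
Proof. exact: (rmorph_nat (real_complex R)). Qed.
Lemma ofRV (x : R) : ofR x^-1 = (ofR x)^-1.
Proof. exact: (fmorphV (real_complex R)). Qed.
Lemma ofR_lt (x y : R) : (ofR x < ofR y) = (x < y).
Proof. exact: ltcR. Qed.
Lemma ofR_le (x y : R) : (ofR x <= ofR y) = (x <= y).
Proof. exact: lecR. Qed.
Lemma ofR_inj : injective (@ofR R). Proof. by move=> x y []. Qed.
Lemma ofR_eq0 (x : R) : (ofR x == 0) = (x == 0).
Proof. exact: (fmorph_eq0 (real_complex R)). Qed.
Lemma ofRX (x : R) n : ofR (x ^+ n) = ofR x ^+ n.
Proof. exact: (rmorphXn (real_complex R)). Qed.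

Lemma modC_ge0 z : 0 <= modC z.
Proof. by rewrite -ofR_le -normE ofR0 normr_ge0. Qed.
Lemma modCM z w : modC (z * w) = modC z * modC w.
Proof. by apply: ofR_inj; rewrite ofRM -!normE normrM. Qed.
Lemma modCD z w : modC (z + w) <= modC z + modC w.
Proof. by rewrite -ofR_le ofRD -!normE ler_normD. Qed.
Lemma modCN z : modC (- z) = modC z.
Proof. by apply: ofR_inj; rewrite -!normE normrN. Qed.
Lemma modCB z w : modC (z - w) <= modC z + modC w.
Proof. by rewrite (le_trans (modCD _ _)) ?modCN. Qed.
Lemma modC0 : modC (0 : CC R) = 0.
Proof. by apply: ofR_inj; rewrite -!normE normr0. Qed.
Lemma modC1 : modC (1 : CC R) = 1.
Proof. by apply: ofR_inj; rewrite -!normE normr1. Qed.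
Lemma modC_eq0 z : (modC z == 0) = (z == 0).
Proof. by rewrite -ofR_eq0 -normE normr_eq0. Qed.
Lemma modC_gt0 z : (0 < modC z) = (z != 0).
Proof. by rewrite -ofR_lt -normE ofR0 normr_gt0. Qed.
Lemma modCX z n : modC (z ^+ n) = modC z ^+ n.
Proof. by apply: ofR_inj; rewrite ofRX -!normE normrX. Qed.
Lemma modCV z : modC z^-1 = (modC z)^-1.
Proof. by apply: ofR_inj; rewrite ofRV -!normE normfV. Qed.
Lemma modC_ofR (x : R) : modC (ofR x) = `|x|.
Proof. by rewrite /modC /Normc.normc /= expr0n addr0 sqrtr_sqr. Qed.
Lemma modC_nat n : modC (n%:R : CC R) = n%:R.
Proof. by rewrite -ofR_nat modC_ofR normr_nat. Qed.
Lemma modC_sum I (r : seq I) (P : pred I) (F : I -> CC R) :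
  modC (\sum_(i <- r | P i) F i) <= \sum_(i <- r | P i) modC (F i).
Proof.
elim/big_ind2: _ => [|x a y b h1 h2|//]; first by rewrite modC0.
by rewrite (le_trans (modCD _ _)) ?lerD.
Qed.
Lemma modC_distC z w : modC (z - w) = modC (w - z).
Proof. by rewrite -modCN opprB. Qed.

Lemma modC_sqr z : modC z ^+ 2 = reC z ^+ 2 + imC z ^+ 2.
Proof. by case: z => a b; rewrite /modC /= sqr_sqrtr ?addr_ge0 ?sqr_ge0. Qed.
Lemma abs_reC_le z : `|reC z| <= modC z.
Proof.
by rewrite -(@ler_pXn2r _ 2) ?nnegrE ?modC_ge0// modC_sqr real_normK ?num_real// lerDl sqr_ge0.
Qed.
Lemma abs_imC_le z : `|imC z| <= modC z.
Proof.
by rewrite -(@ler_pXn2r _ 2) ?nnegrE ?modC_ge0// modC_sqr real_normK ?num_real// lerDr sqr_ge0.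
Qed.
Lemma CC_reim z : z = ofR (reC z) + 'i * ofR (imC z).
Proof. by rewrite -complexiE; exact: complexE. Qed.
Lemma modCi : modC ('i : CC R) = 1.
Proof. by apply: ofR_inj; rewrite -normE normCi. Qed.
Lemma reCi : reC ('i : CC R) = 0. Proof. by rewrite -complexiE. Qed.
Lemma imCi : imC ('i : CC R) = 1. Proof. by rewrite -complexiE. Qed.
Lemma modC_le_reim z : modC z <= `|reC z| + `|imC z|.
Proof. by rewrite {1}(CC_reim z) (le_trans (modCD _ _))// modCM modCi mul1r !modC_ofR. Qed.

(** In the partial order of the complex numbers a positive element is real, so every epsilon and
    delta of the norm topology may be taken in [R]. *)
Lemma pos_ofR (e : CC R) : 0 < e -> exists2 d : R, 0 < d & e = ofR d.
Proof.
move=> e0; have := RRe_real (gtr0_real e0) => er.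
by exists (reC e); rewrite -?ofR_lt ?ofR0 /reC /ofR er.
Qed.

Lemma cvg_modCP (u : nat -> CC R) l :
  u @ \oo --> l <->
  forall e : R, 0 < e -> exists N, forall n, (N <= n)%N -> modC (u n - l) < e.
Proof.
split=> [/cvgrPdist_lt h e e0|h].
  have /h [N _ hN] : 0 < ofR e by rewrite -ofR0 ofR_lt.
  exists N => n /hN /=; by rewrite normE ofR_lt modC_distC.
apply/cvgrPdist_lt => e /pos_ofR[d d0 ->]; have [N hN] := h _ d0.
by exists N => // n /hN; rewrite /= normE ofR_lt modC_distC.
Qed.

End ModC.

(** Free of division, hence meaningful at h = 0, and stated over any numeric field so as to serve
    both the complex derivative and the real functions [expR], [cos] and [sin]. *)
Lemma is_derive_normP (K : numFieldType) (f : K -> K) (z l : K) :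
  is_derive z (1 : K) f l <->
  forall e : K, 0 < e -> exists2 d : K, 0 < d & forall h,
    `|h| < d -> `|f (z + h) - f z - l * h| <= e * `|h|.
Proof.
split=> [[df dl] e e0|H].
  have : (fun h : K => h^-1 *: (f (h *: (1 : K) + z) - f z)) @ 0^' --> l.
    by rewrite -dl; exact: df.
  move/cvgrPdist_lt => /(_ e e0) /nbhs_ballP[d d0 hd].
  exists d => // h hhd; have [->|h0] := eqVneq h 0.
    by rewrite addr0 mulr0 !subrr normr0 mulr0.
  have := hd h; rewrite /ball /= sub0r normrN => /(_ hhd h0).
  rewrite [X in X < _]distrC => hlt.
  have -> : f (z + h) - f z - l * h =
     (h^-1 *: (f (h *: (1 : K) + z) - f z) - l) * h.
    rewrite mulrBl [_ *: (1 : K)]mulr1 [h + z]addrC /GRing.scale /= mulrAC.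
    by rewrite mulVf ?mul1r.
  by rewrite normrM ler_wpM2r // ltW.
have cv : (fun h : K => h^-1 *: (f (h *: (1 : K) + z) - f z)) @ 0^' --> l.
  apply/cvgrPdist_lt => e e0.
  have [d d0 hd] := H (e / 2) (divr_gt0 e0 (ltr0Sn _ 1)).
  apply/nbhs_ballP; exists d => //.
  move=> h; rewrite /ball /= sub0r normrN => hhd h0.
  rewrite distrC.
  have -> : h^-1 *: (f (h *: (1 : K) + z) - f z) - l
      = (f (z + h) - f z - l * h) / h.
    rewrite mulrBl -mulrA mulfV// mulr1 [_ *: (1 : K)]mulr1 [h + z]addrC.
    by rewrite /GRing.scale /= mulrC.
  rewrite normrM normfV ltr_pdivrMr ?normr_gt0//.
  rewrite (le_lt_trans (hd _ hhd))// ltr_pM2r ?normr_gt0//.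
  by rewrite ltr_pdivrMr// ltr_pMr// ltr1n.
apply: DeriveDef; first by apply/cvg_ex; exists l; exact: cv.
by apply: (@cvg_lim _ _ _ (0^')) => //; exact: norm_hausdorff.
Qed.

(** * Complex derivatives and the rules of calculus *)

Section CDeriv.
Variable R : realType.
Implicit Types (f g : CC R -> CC R) (z l : CC R).

Definition has_cderiv f z l : Prop := is_derive (z : CC R) (1 : CC R) f l.

Lemma has_cderivP f z l : has_cderiv f z l <->
  forall e : R, 0 < e -> exists2 d : R, 0 < d & forall h,
    modC h < d -> modC (f (z + h) - f z - l * h) <= e * modC h.
Proof.
split=> [/is_derive_normP H e e0|H].
  have /H[d' /pos_ofR[d d0 ->] hd] : 0 < ofR e by rewrite -ofR0 ofR_lt.
  exists d => // h; rewrite -ofR_lt -normE => /hd.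
  by rewrite !normE -ofRM ofR_le.
apply/is_derive_normP => e' /pos_ofR[e /H[d d0 hd] ->].
exists (ofR d); first by rewrite -ofR0 ofR_lt.
by move=> h; rewrite !normE ofR_lt -ofRM ofR_le; exact: hd.
Qed.

Lemma has_cderiv_derivable f z l : has_cderiv f z l -> derivable f z 1.
Proof. by case. Qed.

Lemma has_cderiv_derive1 f z l : has_cderiv f z l -> derive1 f z = l.
Proof. by move=> [_ <-]; rewrite derive1E. Qed.

Lemma derivable_has_cderiv f z : derivable f z 1 -> has_cderiv f z (derive1 f z).
Proof. by move=> h; rewrite derive1E; exact: derivableP. Qed.

Lemma has_cderiv_cst (c : CC R) z : has_cderiv (fun=> c) z 0.
Proof. exact: is_derive_cst. Qed.

Lemma has_cderiv_id z : has_cderiv (fun w => w) z 1.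
Proof. exact: is_derive_id. Qed.

Lemma has_cderivD f g z l m : has_cderiv f z l -> has_cderiv g z m ->
  has_cderiv (fun w => f w + g w) z (l + m).
Proof. by move=> h1 h2; exact: is_deriveD. Qed.

Lemma has_cderivN f z l : has_cderiv f z l -> has_cderiv (fun w => - f w) z (- l).
Proof. by move=> h1; exact: is_deriveN. Qed.

Lemma has_cderivB f g z l m : has_cderiv f z l -> has_cderiv g z m ->
  has_cderiv (fun w => f w - g w) z (l - m).
Proof. by move=> h1 h2; exact: is_deriveB. Qed.

Lemma has_cderivM f g z l m : has_cderiv f z l -> has_cderiv g z m ->
  has_cderiv (fun w => f w * g w) z (l * g z + f z * m).
Proof.
move=> h1 h2; have := is_deriveM h1 h2.
by rewrite addrC [g z *: l]mulrC.
Qed.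

Lemma has_cderivZ (c : CC R) f z l : has_cderiv f z l ->
  has_cderiv (fun w => c * f w) z (c * l).
Proof.
by move=> h; have := has_cderivM (has_cderiv_cst c z) h; rewrite mul0r add0r.
Qed.

Lemma has_cderiv_eq f z l m : has_cderiv f z l -> l = m -> has_cderiv f z m.
Proof. by move=> ? <-. Qed.

Lemma has_cderiv_unique f z l m : has_cderiv f z l -> has_cderiv f z m -> l = m.
Proof. by move=> /has_cderiv_derive1 <- /has_cderiv_derive1. Qed.

Lemma has_cderiv_near f g z l (d : R) : 0 < d ->
  (forall w, modC (w - z) < d -> f w = g w) ->
  has_cderiv f z l -> has_cderiv g z l.
Proof.
move=> d0 fg /has_cderivP fl; apply/has_cderivP => e /fl[d1 d10 h1].
exists (Num.min d d1); first by rewrite lt_min d0.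
move=> h; rewrite lt_min => /andP[hd hd1].
by rewrite -!fg ?h1// ?subrr ?modC0 // addrAC subrr add0r.
Qed.

Lemma has_cderiv_ext f g z l : f =1 g -> has_cderiv f z l -> has_cderiv g z l.
Proof. by move=> fg; apply: has_cderiv_near ltr01 _ => w _; exact: fg. Qed.

Lemma has_cderivX n f z l : has_cderiv f z l ->
  has_cderiv (fun w => f w ^+ n) z (n%:R * f z ^+ n.-1 * l).
Proof.
move=> h; elim: n => [|n IH].
  by rewrite mul0r mul0r; under eq_fun do rewrite expr0; exact: has_cderiv_cst.
under eq_fun do rewrite exprS.
apply: has_cderiv_eq (has_cderivM h IH) _ => /=.
case: n {IH} => [|n]; first by rewrite /= expr0 !mul0r mulr0 addr0 mulr1 !mul1r.
by rewrite /= [in RHS]mulrS mulrDl mul1r mulrDl exprS; congr (_ + _); ring.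
Qed.

Lemma has_cderiv_comp f g z l m : has_cderiv g z m -> has_cderiv f (g z) l ->
  has_cderiv (fun w => f (g w)) z (l * m).
Proof.
move=> /has_cderivP gm /has_cderivP fl; apply/has_cderivP => e e0.
have M0 : 0 < modC m + 1 by rewrite ltr_wpDl ?modC_ge0.
have L0 : 0 < modC l + 1 by rewrite ltr_wpDl ?modC_ge0.
have e1 : 0 < e / 2 / (modC m + 1) by rewrite !divr_gt0.
(* An error of at most |h| gives |k| <= (|m| + 1) |h|; the second bound is for the term l (k - m
   h). *)
have e2 : 0 < Num.min 1 (e / 2 / (modC l + 1)).
  by rewrite lt_min ltr01 !divr_gt0.
have [d1 d10 hd1] := fl _ e1; have [d2 d20 hd2] := gm _ e2.
exists (Num.min d2 (d1 / (modC m + 1))); first by rewrite lt_min d20 divr_gt0.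
move=> h; rewrite lt_min => /andP[hh2 hh1].
set k := g (z + h) - g z; have kE : g (z + h) = g z + k by rewrite /k; ring.
have hk := hd2 _ hh2; rewrite -/k in hk.
have hk1 : modC (k - m * h) <= modC h.
  by rewrite (le_trans hk)// ler_piMl ?modC_ge0// ge_min lexx.
have hk2 : modC (k - m * h) <= e / 2 / (modC l + 1) * modC h.
  by rewrite (le_trans hk)// ler_wpM2r ?modC_ge0// ge_min lexx orbT.
have kle : modC k <= (modC m + 1) * modC h.
  rewrite -[k](subrK (m * h)) (le_trans (modCD _ _))// modCM mulrDl mul1r addrC.
  by rewrite lerD2l.
have kd : modC k < d1.
  by rewrite (le_lt_trans kle)// mulrC -ltr_pdivlMr.
rewrite kE; have -> : f (g z + k) - f (g z) - l * m * h =
  (f (g z + k) - f (g z) - l * k) + l * (k - m * h) by ring.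
rewrite (le_trans (modCD _ _))// modCM [e]splitr mulrDl lerD//.
  rewrite (le_trans (hd1 _ kd))//.
  rewrite (le_trans (ler_wpM2l (ltW e1) kle))//.
  by rewrite mulrA mulfVK// gt_eqF.
rewrite (le_trans (ler_wpM2l (modC_ge0 _) hk2))//.
rewrite mulrA ler_wpM2r ?modC_ge0// mulrCA ger_pMr ?divr_gt0//.
by rewrite ler_pdivrMr// mul1r lerDl.
Qed.

Lemma has_cderiv_inv z : z != 0 -> has_cderiv (fun w => w^-1) z (- (z ^+ 2)^-1).
Proof.
move=> z0; apply: DeriveDef; first exact: (@derivableV _ _ id).
rewrite (@deriveV _ _ id)// derive_id /GRing.scale /= mulr1.
by rewrite -exprVn.
Qed.

Lemma has_cderivV f z l : f z != 0 -> has_cderiv f z l ->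
  has_cderiv (fun w => (f w)^-1) z (- l / f z ^+ 2).
Proof.
move=> fz0 h; apply: has_cderiv_eq (has_cderiv_comp h (has_cderiv_inv fz0)) _.
by ring.
Qed.

Lemma has_cderiv_sum (I : Type) (r : seq I) (F : I -> CC R -> CC R) (G : I -> CC R) z :
  (forall i, has_cderiv (F i) z (G i)) ->
  has_cderiv (fun w => \sum_(i <- r) F i w) z (\sum_(i <- r) G i).
Proof.
move=> h; elim: r => [|i r IH].
  rewrite big_nil; under eq_fun do rewrite big_nil; exact: has_cderiv_cst.
rewrite big_cons; under eq_fun do rewrite big_cons; exact: has_cderivD.
Qed.

End CDeriv.

(** * The complex exponential and its derivative *)

Section CExp.
Variable R : realType.
Implicit Types (z w : CC R).

Lemma reC_cexp z : reC (cexp z) = expR (reC z) * cos (imC z).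
Proof. by rewrite /cexp reCM /= mul0r subr0. Qed.
Lemma imC_cexp z : imC (cexp z) = expR (reC z) * sin (imC z).
Proof. by rewrite /cexp imCM /= mul0r addr0. Qed.

Lemma cexpD z w : cexp (z + w) = cexp z * cexp w.
Proof.
by apply: CC_eqP; rewrite !(reC_cexp, imC_cexp) ?reCD ?imCD ?expRD
  ?(cosD, sinD) [RHS](reCM, imCM) !(reC_cexp, imC_cexp); ring.
Qed.

Lemma cexp0 : cexp (0 : CC R) = 1.
Proof.
by apply: CC_eqP; rewrite ?reC_cexp ?imC_cexp /= expR0 ?cos0 ?sin0 mul1r.
Qed.

Lemma cexp_neq0 z : cexp z != 0.
Proof.
apply/eqP => h; have := cexpD z (- z); rewrite subrr cexp0 h mul0r => /eqP.
by rewrite oner_eq0.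
Qed.

Lemma cexpN z : cexp (- z) = (cexp z)^-1.
Proof.
apply: (mulfI (cexp_neq0 z)); rewrite -cexpD subrr cexp0 mulfV//.
exact: cexp_neq0.
Qed.

Lemma cexpMn n z : cexp (n%:R * z) = cexp z ^+ n.
Proof.
elim: n => [|n IH]; first by rewrite mul0r cexp0 expr0.
by rewrite mulrS mulrDl mul1r cexpD IH exprS.
Qed.

Lemma modC_cexp z : modC (cexp z) = expR (reC z).
Proof.
apply/eqP; rewrite -(@eqrXn2 _ 2) ?modC_ge0 ?expR_ge0//.
by rewrite modC_sqr reC_cexp imC_cexp !exprMn -mulrDr cos2Dsin2 mulr1.
Qed.

Lemma cexp_ofR (x : R) : cexp (ofR x) = ofR (expR x).
Proof.
by apply: CC_eqP; rewrite ?reC_cexp ?imC_cexp /= ?cos0 ?sin0 ?mulr1 ?mulr0.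
Qed.

Lemma cexp_i (t : R) : cexp ('i * ofR t) = ofR (cos t) + 'i * ofR (sin t).
Proof.
by apply: CC_eqP; rewrite !(reC_cexp, imC_cexp, reCM, imCM, reCD, imCD, reCi, imCi, reC_ofR, imC_ofR);
  rewrite !(mul0r, mul1r, mulr0, subrr, add0r, addr0, subr0, expR0).
Qed.

Lemma has_cderiv_cexp0 : has_cderiv (@cexp R) 0 1.
Proof.
apply/has_cderivP => e e0.
(* The real part of the error is at most 3 e' |h| and the imaginary part at most 5 e' |h|, whence
   the 8. *)
pose e' := Num.min 1 (e / 8).
have e'0 : 0 < e' by rewrite lt_min ltr01 divr_gt0.
have [d1 d10 h1] := (is_derive_normP _ _ _).1 (is_derive_expR (0 : R)) _ e'0.
have [d2 d20 h2] := (is_derive_normP _ _ _).1 (is_derive_cos (0 : R)) _ e'0.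
have [d3 d30 h3] := (is_derive_normP _ _ _).1 (is_derive_sin (0 : R)) _ e'0.
exists (Num.min e' (Num.min d1 (Num.min d2 d3))); first by rewrite lt_min e'0 lt_min d10 lt_min d20.
move=> h; rewrite lt_min => /andP[hhe].
rewrite lt_min => /andP[hh1]; rewrite lt_min => /andP[hh2 hh3].
rewrite add0r cexp0 mul1r.
set m := modC h in hhe hh1 hh2 hh3 *.
have hx := abs_reC_le h; have hy := abs_imC_le h; rewrite -/m in hx hy.
apply: (le_trans (modC_le_reim _)).
rewrite !(reCD, imCD, reCN, imCN) reC_cexp imC_cexp.
set x := reC h in hx *; set y := imC h in hy *.
have := h1 x (le_lt_trans hx hh1).
have := h2 y (le_lt_trans hy hh2).
have := h3 y (le_lt_trans hy hh3).
rewrite !add0r expR0 sin0 cos0 !(oppr0, subr0, mul0r, mul1r).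
set E := expR x; set S := sin y; set C := cos y => hS hC hE.
have cle1 : `|C| <= 1 by rewrite ler_norml cos_geN1 cos_le1.
have e1 : e' <= 1 by rewrite ge_min lexx.
have m0 : 0 <= m := modC_ge0 h.
have -> : E * C - reC (1 : CC R) - x = (E - 1 - x) * C + (1 + x) * (C - 1).
  by rewrite /=; ring.
have -> : E * S + 0 - y = (E - 1) * S + (S - y) by ring.
have hE1 : `|E - 1| <= 2 * m.
  rewrite -[E - 1](subrK x) (le_trans (ler_normD _ _))//.
  have : e' * `|x| <= m by rewrite (le_trans _ hx)// ler_piMl.
  lra.
have hS1 : `|S| <= 2 * m.
  rewrite -[S](subrK y) (le_trans (ler_normD _ _))//.
  have : e' * `|y| <= m by rewrite (le_trans _ hy)// ler_piMl.
  lra.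
have hx1 : `|1 + x| <= 2.
  rewrite (le_trans (ler_normD _ _))// normr1.
  by move: hhe e1 hx; lra.
have ex : e' * `|x| <= e' * m by rewrite ler_wpM2l// ltW.
have ey : e' * `|y| <= e' * m by rewrite ler_wpM2l// ltW.
have t1 : `|(E - 1 - x) * C + (1 + x) * (C - 1)| <= 3 * (e' * m).
  rewrite (le_trans (ler_normD _ _))// !normrM.
  have a1 : `|E - 1 - x| * `|C| <= e' * m * 1 by rewrite ler_pM// (le_trans hE).
  have a2 : `|1 + x| * `|C - 1| <= 2 * (e' * m) by rewrite ler_pM// (le_trans hC).
  lra.
have t2 : `|(E - 1) * S + (S - y)| <= 5 * (e' * m).
  rewrite (le_trans (ler_normD _ _))// !normrM.
  have a1 : `|E - 1| * `|S| <= (2 * m) * (2 * m) by rewrite ler_pM.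
  have a2 : m * m <= e' * m by rewrite ler_wpM2r // ltW.
  have a3 : `|S - y| <= e' * m by rewrite (le_trans hS).
  have -> : 5 * (e' * m) = 4 * (e' * m) + e' * m by ring.
  rewrite lerD// (le_trans a1)//.
  have -> : 2 * m * (2 * m) = 4 * (m * m) by ring.
  by rewrite ler_wpM2l.
rewrite (le_trans (lerD t1 t2))// -mulrDl mulrA ler_wpM2r//.
have : e' <= e / 8 by rewrite ge_min lexx orbT.
lra.
Qed.

Lemma has_cderiv_cexp z : has_cderiv (@cexp R) z (cexp z).
Proof.
have h0 : has_cderiv (fun w => w - z) z 1.
  apply: has_cderiv_eq (has_cderivB (has_cderiv_id z) (has_cderiv_cst z z)) _.
  by rewrite subr0.
have h1 : has_cderiv (@cexp R) (z - z) 1 by rewrite subrr; exact: has_cderiv_cexp0.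
have := has_cderivZ (cexp z) (has_cderiv_comp h0 h1).
rewrite !mulr1; apply: has_cderiv_ext => w.
by rewrite -cexpD addrC subrK.
Qed.

End CExp.

(** * The principal logarithm and real powers off the real axis *)

Section CLog.
Variable R : realType.
Implicit Types (z w : CC R).

Lemma cos_sin_carg z : z != 0 ->
  cos (carg z) = reC z / modC z /\ sin (carg z) = imC z / modC z.
Proof.
move=> z0; have m0 : 0 < modC z by rewrite modC_gt0.
have t1 : -1 <= reC z / modC z <= 1.
  by rewrite -ler_norml normrM normfV (gtr0_norm m0) ler_pdivrMr// mul1r abs_reC_le.
have hs : sin (acos (reC z / modC z)) = `|imC z| / modC z.
  rewrite sin_acos// -[RHS]ger0_norm ?divr_ge0 ?modC_ge0// -sqrtr_sqr.
  congr Num.sqrt; rewrite !exprMn !exprVn real_normK ?num_real//.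
  rewrite -[X in X - _](@mulfV _ (modC z ^+ 2)) ?expf_neq0 ?gt_eqF//.
  by rewrite -mulrBl [X in (X - _) / _]modC_sqr addrC addKr.
rewrite /carg; case: ifP => i0.
  by rewrite acosK ?in_itv//= hs ger0_norm.
have i0' : imC z < 0 by rewrite ltNge i0.
by rewrite cosN sinN acosK ?in_itv//= hs ltr0_norm// mulNr opprK.
Qed.

Lemma clogK z : z != 0 -> cexp (clog z) = z.
Proof.
move=> z0; have m0 : 0 < modC z by rewrite modC_gt0.
have [hc hs] := cos_sin_carg z0.
by apply: CC_eqP; rewrite !(reC_cexp, imC_cexp) /= lnK ?posrE// ?hc ?hs mulrCA mulfV ?mulr1// gt_eqF.
Qed.

Lemma lip1_cvg (f : CC R -> R) z : (forall w, `|f z - f w| <= modC (z - w)) ->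
  f w @[w --> z] --> f z.
Proof.
move=> fl; apply/(@cvgrPdist_lt _ _ _ (nbhs z)) => e e0; apply/nbhs_ballP.
exists (ofR e); first by rewrite /= -ofR0 ofR_lt.
by move=> w; rewrite /ball /= normE ofR_lt; apply: le_lt_trans.
Qed.

Lemma reC_cvg z : reC w @[w --> z] --> reC z.
Proof. by apply: lip1_cvg => w; rewrite -reCN -reCD abs_reC_le. Qed.

Lemma imC_cvg z : imC w @[w --> z] --> imC z.
Proof. by apply: lip1_cvg => w; rewrite -imCN -imCD abs_imC_le. Qed.

Lemma modC_cvg z : modC w @[w --> z] --> modC z.
Proof.
apply: lip1_cvg => w; have h (x y : CC R) : modC x - modC y <= modC (x - y).
  by rewrite lerBlDr (le_trans _ (modCD _ _))// subrK.
by rewrite ler_norml lerNl opprB h modC_distC h.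
Qed.

(** Off the real axis the sign of the imaginary part is locally constant, so [carg] is locally plus
    or minus an [acos], at an argument strictly between -1 and 1, where [acos] is continuous. *)
Lemma carg_cvg_filter (F : set_system (CC R)) (FF : Filter F) z : imC z != 0 ->
  @reC R @ F --> reC z -> @imC R @ F --> imC z -> @modC R @ F --> modC z ->
  @carg R @ F --> carg z.
Proof.
move=> i0 Fre Fim Fmod; have z0 : z != 0 by apply: contraNneq i0 => ->.
have m0 : 0 < modC z by rewrite modC_gt0.
have t1 : -1 < reC z / modC z < 1.
  rewrite -ltr_norml normrM normfV (gtr0_norm m0) ltr_pdivrMr// mul1r.
  rewrite -(@ltr_pXn2r _ 2) ?nnegrE ?modC_ge0// modC_sqr real_normK ?num_real//.
  by rewrite ltrDl exprn_even_gt0.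
have h1 : reC w / modC w @[w --> F] --> reC z / modC z.
  by apply: cvgM => //; apply: cvgV => //; rewrite gt_eqF.
have h2 : acos (reC w / modC w) @[w --> F] --> acos (reC z / modC z).
  by apply: continuous_cvg h1; exact: continuous_acos.
have [ip|im|/eqP] := ltgtP (imC z) 0; last by rewrite (negbTE i0).
  rewrite /carg leNgt ip /=.
  apply: cvg_trans (cvgN h2); apply: near_eq_cvg.
  have : \forall w \near F, imC w < 0.
    by apply: (cvgr_lt _ Fim).
  by apply: filterS => w wl; rewrite leNgt wl.
rewrite /carg (ltW im).
apply: cvg_trans h2; apply: near_eq_cvg.
have : \forall w \near F, imC w > 0.
  by apply: (cvgr_gt _ Fim).
by apply: filterS => w wl; rewrite ltW.
Qed.

Lemma ln_modC_cvg_filter (F : set_system (CC R)) (FF : Filter F) z : 0 < modC z ->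
  @modC R @ F --> modC z -> ln (modC w) @[w --> F] --> ln (modC z).
Proof.
by move=> m0 Fmod; apply: continuous_cvg Fmod; exact: continuous_ln.
Qed.

Lemma carg_cvg z : imC z != 0 -> carg w @[w --> z] --> carg z.
Proof.
by move=> i0; apply: carg_cvg_filter => //;
  [exact: nbhs_filter|exact: reC_cvg|exact: imC_cvg|exact: modC_cvg].
Qed.

Lemma cvg_modC_eps (f : CC R -> R) z l : f w @[w --> z] --> l ->
  forall e : R, 0 < e ->
  exists2 d : R, 0 < d & forall h, modC h < d -> `|l - f (z + h)| < e.
Proof.
move=> /(@cvgrPdist_lt _ _ _ (nbhs z)) H e /H /nbhs_ballP[d' /pos_ofR[d d0 ->] hd].
exists d => // h hh; apply: hd.
by rewrite /ball /= opprD addrA subrr add0r normrN normE ofR_lt.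
Qed.

Lemma clog_continuous z : imC z != 0 -> forall e : R, 0 < e ->
  exists2 d : R, 0 < d & forall h, modC h < d -> modC (clog (z + h) - clog z) < e.
Proof.
move=> i0 e e0; have z0 : z != 0 by apply: contraNneq i0 => ->.
have m0 : 0 < modC z by rewrite modC_gt0.
have h1 : ln (modC w) @[w --> z] --> ln (modC z).
  by apply: ln_modC_cvg_filter => //; [exact: nbhs_filter|exact: modC_cvg].
have e2 : 0 < e / 2 by rewrite divr_gt0.
have [r1 r10 hd1] := cvg_modC_eps h1 e2.
have [r2 r20 hd2] := cvg_modC_eps (carg_cvg i0) e2.
exists (Num.min r1 r2); first by rewrite lt_min r10.
move=> h; rewrite lt_min => /andP[/hd1 a1 /hd2 a2].
rewrite (le_lt_trans (modC_le_reim _))// reCD imCD reCN imCN /=.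
rewrite [X in X + _]distrC [X in _ + X]distrC.
by rewrite [e]splitr ltrD.
Qed.

(** Derivative of an inverse function: k = clog (z + h) - clog z satisfies cexp k - 1 = h / z and is
    small by continuity, so the derivative of [cexp] at 0 yields k = h / z + o(k). *)
Lemma has_cderiv_clog z : imC z != 0 -> has_cderiv (@clog R) z z^-1.
Proof.
move=> i0; have z0 : z != 0 by apply: contraNneq i0 => ->.
have m0 : 0 < modC z by rewrite modC_gt0.
apply/has_cderivP => e e0.
pose e' := Num.min (1 / 2) (e * modC z / 2).
have e'0 : 0 < e' by rewrite lt_min !divr_gt0 ?mulr_gt0.
have [d1 d10 h1] := (has_cderivP _ _ _).1 (has_cderiv_cexp0 R) _ e'0.
have [d2 d20 h2] := clog_continuous i0 d10.
exists (Num.min d2 `|imC z|); first by rewrite lt_min d20 normr_gt0.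
move=> h; rewrite lt_min => /andP[hh hi].
have zh0 : z + h != 0.
  have : imC (z + h) != 0.
    rewrite imCD; apply: contraTneq (le_lt_trans (abs_imC_le h) hi).
    by move=> /eqP; rewrite addrC addr_eq0 => /eqP ->; rewrite normrN ltxx.
  by apply: contraNneq => ->.
set k := clog (z + h) - clog z.
have hk : modC k < d1 := h2 _ hh.
have eqh : z^-1 * h = cexp k - 1.
  apply: (mulfI z0); rewrite mulrA mulfV// mul1r.
  rewrite mulrBr mulr1 /k cexpD cexpN !clogK//.
  by rewrite mulrCA mulfV// mulr1 addrC addKr.
have := h1 _ hk; rewrite add0r cexp0 mul1r -eqh modC_distC => b1.
rewrite /k in b1 *; rewrite -/k in b1 *.
have e'h : e' <= 1 / 2 by rewrite ge_min lexx.
(* As e' <= 1 / 2, the error e' |k| is absorbed by the left-hand side. *)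
have b2 : modC k <= 2 * modC (z^-1 * h).
  have : modC k <= modC (z^-1 * h) + e' * modC k.
    rewrite -[X in modC X <= _](subrK (z^-1 * h)) addrC.
    by rewrite (le_trans (modCD _ _))// lerD2l.
  have : e' * modC k <= 1 / 2 * modC k by rewrite ler_wpM2r ?modC_ge0.
  lra.
apply: (le_trans b1).
apply: (le_trans (ler_wpM2l (ltW e'0) b2)).
rewrite modCM modCV !mulrA ler_wpM2r ?modC_ge0// ler_pdivrMr//.
rewrite -ler_pdivlMr//.
by rewrite /e' ge_min lexx orbT.
Qed.

Lemma cpow_neq0 z (k : R) : cpow z k != 0. Proof. exact: cexp_neq0. Qed.

Lemma has_cderiv_cpow z (k : R) : imC z != 0 ->
  has_cderiv (fun w => cpow w k) z (ofR k * cpow z k / z).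
Proof.
move=> i0; have h := has_cderivZ (ofR k) (has_cderiv_clog i0).
apply: has_cderiv_eq (has_cderiv_comp h (has_cderiv_cexp _)) _.
by rewrite /cpow; ring.
Qed.

Lemma cpowD z (k l : R) : cpow z (k + l) = cpow z k * cpow z l.
Proof. by rewrite /cpow ofRD mulrDl cexpD. Qed.

Lemma cpow_nat z n : z != 0 -> cpow z n%:R = z ^+ n.
Proof. by move=> z0; rewrite /cpow ofR_nat cexpMn clogK. Qed.

Lemma cpowN z (k : R) : cpow z (- k) = (cpow z k)^-1.
Proof. by rewrite /cpow ofRN mulNr cexpN. Qed.

End CLog.

(** * Power series and q-expansions *)

Section PowerSeries.
Variable R : realType.
Implicit Types (z w q l : CC R) (c : nat -> CC R) (u v : nat -> CC R).

Definition tends u l := forall e : R, 0 < e ->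
  exists N, forall n, (N <= n)%N -> modC (u n - l) < e.

Lemma tends_le u l x (K : R) (N : nat) : tends u l ->
  (forall n, (N <= n)%N -> modC (u n - x) <= K) -> modC (l - x) <= K.
Proof.
move=> ul h; rewrite leNgt; apply/negP => lt.
have /ul[M hM] : 0 < modC (l - x) - K by rewrite subr_gt0.
have := hM _ (leq_maxr N M); have := h _ (leq_maxl N M).
have := modCD (l - u (maxn N M)) (u (maxn N M) - x).
rewrite addrA subrK (modC_distC l); lra.
Qed.

Lemma tends_unique u l l' : tends u l -> tends u l' -> l = l'.
Proof.
move=> h1 h2; apply/eqP; rewrite -subr_eq0 -modC_eq0 eq_le modC_ge0 andbT.
apply/ler_addgt0Pr => e e0; rewrite add0r.
have [N hN] := h2 _ e0.
by apply: (tends_le (N := N) h1) => n /hN /ltW.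
Qed.

Lemma tendsD u v l m : tends u l -> tends v m -> tends (fun n => u n + v n) (l + m).
Proof.
move=> hu hv e e0; have e2 : 0 < e / 2 by rewrite divr_gt0.
have [N hN] := hu _ e2; have [M hM] := hv _ e2.
exists (maxn N M) => n; rewrite geq_max => /andP[/hN h1 /hM h2].
rewrite opprD addrACA (le_lt_trans (modCD _ _))//; lra.
Qed.

Lemma tendsZ (a : CC R) u l : tends u l -> tends (fun n => a * u n) (a * l).
Proof.
move=> hu e e0; have a0 : 0 < modC a + 1 by rewrite ltr_wpDl ?modC_ge0.
have /hu[N hN] : 0 < e / (modC a + 1) by rewrite divr_gt0.
exists N => n /hN; rewrite -mulrBr modCM ltr_pdivlMr// => h.
by rewrite (le_lt_trans _ h)// mulrC ler_wpM2l ?modC_ge0// lerDl.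
Qed.

Lemma tendsB u v l m : tends u l -> tends v m -> tends (fun n => u n - v n) (l - m).
Proof.
move=> hu hv; rewrite -mulN1r; under eq_fun do rewrite -[- v _]mulN1r.
by apply: tendsD => //; exact: tendsZ.
Qed.

Lemma tends_cst l : tends (fun=> l) l.
Proof. by move=> e e0; exists 0%N => n _; rewrite subrr modC0. Qed.

Lemma tends_eq u v l (N : nat) : (forall n, (N <= n)%N -> u n = v n) -> tends u l -> tends v l.
Proof.
move=> uv ul e /ul[M hM]; exists (maxn N M) => n; rewrite geq_max => /andP[h1 h2].
by rewrite -uv// hM.
Qed.

Lemma tends_sub u l (f : nat -> nat) : (forall n, (n <= f n)%N) -> tends u l ->
  tends (fun n => u (f n)) l.
Proof. by move=> fn ul e /ul[M hM]; exists M => n h; apply: hM (leq_trans h (fn n)). Qed.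

Lemma tends_sum (I : Type) (r : seq I) (u : I -> nat -> CC R) (l : I -> CC R) :
  (forall i, tends (u i) (l i)) ->
  tends (fun n => \sum_(i <- r) u i n) (\sum_(i <- r) l i).
Proof.
move=> h; elim: r => [|i r IH].
  by rewrite big_nil; under eq_fun do rewrite big_nil; exact: tends_cst.
by rewrite big_cons; under eq_fun do rewrite big_cons; exact: tendsD.
Qed.

Lemma tends_bounded u l : tends u l -> exists B : R, forall n, modC (u n) <= B.
Proof.
move=> /(_ _ ltr01)[N hN]; exists (modC l + 1 + \sum_(i < N) modC (u i)) => n.
have s0 m : 0 <= \sum_(i < m) modC (u i) by apply: sumr_ge0 => *; exact: modC_ge0.
have [h|h] := leqP N n.
  have := hN _ h; have := modCD (u n - l) l; rewrite subrK; have := s0 N; lra.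
have -> : modC (u n) = modC (u (Ordinal h)) by [].
rewrite (bigD1 (Ordinal h))//=.
have : 0 <= \sum_(i < N | i != Ordinal h) modC (u i).
  by apply: sumr_ge0 => *; exact: modC_ge0.
have := modC_ge0 l; lra.
Qed.

(** Equivalent to a radius of convergence of at least 1 for the power series with coefficients
    [c]. *)
Definition subexp c := forall r : R, 0 < r < 1 -> exists B : R,
  forall i, modC (c i) * r ^+ i <= B.

Lemma subexp_geom c (rho : R) : subexp c -> 0 <= rho < 1 -> exists B theta : R,
  [/\ 0 <= B, 0 <= theta < 1 & forall i, modC (c i) * rho ^+ i <= B * theta ^+ i].
Proof.
(* A radius strictly between rho and 1 gains the ratio theta = rho / r. *)
move=> hc /andP[r0 r1]; pose r := (1 + rho) / 2.
have rr : rho < r by rewrite /r; lra.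
have r01 : 0 < r < 1 by rewrite /r; lra.
have [B hB] := hc _ r01; exists B, (rho / r).
have rp : 0 < r by case/andP: r01.
split; first by rewrite (le_trans _ (hB 0%N))// expr0 mulr1 modC_ge0.
  by rewrite ltr_pdivrMr// mul1r rr divr_ge0// ltW.
move=> i; rewrite expr_div_n mulrA ler_pdivlMr ?exprn_gt0// mulrAC.
by rewrite ler_wpM2r// exprn_ge0.
Qed.

(** The geometric sum 1 + s + ... + s^(i-1) has i terms, each of them at least s^i. *)
Lemma natM_expr_le (s : R) i : 0 <= s < 1 -> (1 - s) * (i%:R * s ^+ i) <= 1 - s ^+ i.
Proof.
move=> /andP[s0 s1]; elim: i => [|i IH]; first by rewrite mul0r mulr0 expr0 subrr.
have h : s * ((1 - s) * (i%:R * s ^+ i)) <= s * (1 - s ^+ i) by rewrite ler_wpM2l.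
rewrite mulrSr exprS.
have p1 : s ^+ i <= 1 by rewrite exprn_ile1 // ltW.
have p0 : 0 <= s ^+ i by rewrite exprn_ge0.
set t := s ^+ i in h p1 p0 *; set m := i%:R in h *.
have st1 : s * t <= 1 by rewrite (le_trans _ p1)// ler_piMl// ltW.
have : 0 <= (1 - s) * (1 - s * t) by rewrite mulr_ge0 ?subr_ge0 // ltW.
have -> : (1 - s) * ((m + 1) * (s * t)) = s * ((1 - s) * (m * t)) + (1 - s) * (s * t) by ring.
nra.
Qed.

Lemma subexp_natM c : subexp c -> subexp (fun i => i%:R * c i).
Proof.
(* In r^i = s^i s^i one factor controls c_i and the other one the new factor i. *)
move=> hc r /andP[r0 r1]; pose s := Num.sqrt r.
have ss : s * s = r by rewrite -expr2 sqr_sqrtr ?ltW.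
have s0 : 0 < s by rewrite sqrtr_gt0.
have s1 : s < 1 by rewrite -sqrtr1 ltr_sqrt.
have [|B hB] := hc s; first by rewrite s0.
have B0 : 0 <= B by rewrite (le_trans _ (hB 0%N))// expr0 mulr1 modC_ge0.
exists (B * (1 - s)^-1) => i.
rewrite modCM modC_nat -ss exprMn.
have -> : i%:R * modC (c i) * (s ^+ i * s ^+ i) = (modC (c i) * s ^+ i) * (i%:R * s ^+ i) by ring.
have p0 : 0 <= s ^+ i by rewrite exprn_ge0 ?ltW.
have s01 : 0 < 1 - s by rewrite subr_gt0.
rewrite ler_pM ?mulr_ge0 ?modC_ge0//.
rewrite -[X in _ <= X]mul1r ler_pdivlMr // mulrC (le_trans (natM_expr_le _ _))//.
  by rewrite ltW.
by rewrite gerBl.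
Qed.

Lemma subexp_le c c' (K : R) : (forall i, modC (c' i) <= K * modC (c i)) ->
  subexp c -> subexp c'.
Proof.
move=> le hc r r01; have [B hB] := hc r r01; exists (`|K| * B) => i.
have r0 : 0 <= r ^+ i by rewrite exprn_ge0// ltW//; case/andP: r01.
rewrite (le_trans (ler_wpM2r r0 (le i)))// -mulrA.
rewrite (le_trans (ler_wpM2r _ (ler_norm K)))// ?mulr_ge0 ?modC_ge0//.
by rewrite ler_wpM2l.
Qed.

Definition psum c q n := \sum_(i < n) c i * q ^+ i.

Lemma psum_series c q : series (fun i => c i * q ^+ i) = psum c q.
Proof. by apply/funext => n; rewrite /series /psum /= big_mkord. Qed.

Lemma sum_geom_le (B th : R) N n : 0 <= B -> 0 <= th < 1 ->
  \sum_(N <= i < N + n) B * th ^+ i <= B * th ^+ N / (1 - th).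
Proof.
move=> B0 /andP[t0 t1]; have t10 : 0 < 1 - th by rewrite subr_gt0.
have -> : \sum_(N <= i < N + n) B * th ^+ i = B * (th ^+ N - th ^+ (N + n)) / (1 - th).
  elim: n => [|n IH]; first by rewrite addn0 big_geq// subrr mulr0 mul0r.
  rewrite addnS big_nat_recr ?leq_addr//= IH exprS.
  by field; rewrite gt_eqF.
rewrite ler_pM2r ?invr_gt0// ler_wpM2l// gerBl exprn_ge0//.
Qed.

Lemma psum_tail c q (B th rho : R) N n : 0 <= B -> 0 <= th < 1 ->
  (forall i, modC (c i) * rho ^+ i <= B * th ^+ i) -> modC q <= rho ->
  (N <= n)%N -> modC (psum c q n - psum c q N) <= B * th ^+ N / (1 - th).
Proof.
move=> B0 t01 hB qr Nn; rewrite -(subnKC Nn).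
apply: le_trans (sum_geom_le N (n - N) B0 t01).
rewrite /psum -!(big_mkord xpredT (fun i => c i * q ^+ i)).
rewrite (@big_cat_nat _ _ _ N 0 (N + (n - N))) ?leq_addr//= [X in modC X]addrC addKr.
apply: (le_trans (modC_sum _ _ _)); apply: ler_sum => i _.
rewrite (le_trans _ (hB i))// modCM modCX ler_wpM2l ?modC_ge0//.
by rewrite lerXn2r ?nnegrE ?modC_ge0// (le_trans _ qr) ?modC_ge0.
Qed.

Lemma tends_reim u (x y : R) :
  (reC (u n)) @[n --> \oo] --> x -> (imC (u n)) @[n --> \oo] --> y ->
  tends u (ofR x + 'i * ofR y).
Proof.
move=> /cvgrPdist_lt hx /cvgrPdist_lt hy e e0.
have e2 : 0 < e / 2 by rewrite divr_gt0.
have [N _ hN] := hx _ e2; have [M _ hM] := hy _ e2.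
exists (maxn N M) => n; rewrite geq_max => /andP[/hN h1 /hM h2].
rewrite (le_lt_trans (modC_le_reim _))//.
rewrite !(reCD, imCD, reCN, imCN, reCM, imCM, reCi, imCi, reC_ofR, imC_ofR).
rewrite !(mul0r, mulr0, mul1r, add0r, addr0, subr0) [e]splitr.
by rewrite distrC [X in _ + X]distrC ltrD.
Qed.

Lemma psum_tends_ex c q : subexp c -> modC q < 1 -> exists l, tends (psum c q) l.
Proof.
move=> hc q1; have [|B [th [B0 t01 hB]]] := subexp_geom (rho := modC q) hc.
  by rewrite modC_ge0.
have gc : cvgn (series (geometric B th)).
  apply: is_cvg_geometric_series; case/andP: t01 => t0 t1.
  by rewrite ger0_norm.
(* Real and imaginary part are treated at once, through an additive [f] bounded by the modulus. *)
have key (f : CC R -> R) : (forall z w, f (z + w) = f z + f w) ->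
    (forall z, `|f z| <= modC z) -> cvgn (fun n => f (psum c q n)).
  move=> fD fle; have f0 : f 0 = 0 by have := fD 0 0; rewrite addr0; lra.
  have -> : (fun n => f (psum c q n)) = series (fun i => f (c i * q ^+ i)).
    apply/funext => n; rewrite /series /psum /= big_mkord.
    by rewrite (big_morph f fD f0).
  apply: normed_cvg; apply: series_le_cvg gc => n /=.
  - exact: normr_ge0.
  - by rewrite mulr_ge0// exprn_ge0//; case/andP: t01.
  - by rewrite (le_trans (fle _))// modCM modCX.
have /cvg_ex[/= x hx] := key (@reC R) (@reCD R) (@abs_reC_le R).
have /cvg_ex[/= y hy] := key (@imC R) (@imCD R) (@abs_imC_le R).
by exists (ofR x + 'i * ofR y); exact: tends_reim.
Qed.

Definition qs c q : CC R := limn (psum c q).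

Lemma tends_lim u l : tends u l -> limn u = l.
Proof. by move=> h; apply: cvg_lim; [exact: norm_hausdorff|apply/cvg_modCP]. Qed.

Lemma qsP c q : subexp c -> modC q < 1 -> tends (psum c q) (qs c q).
Proof. by move=> hc /(psum_tends_ex hc)[l hl]; rewrite /qs (tends_lim hl). Qed.

Lemma qs_tail c (rho : R) : subexp c -> 0 <= rho < 1 -> exists B th : R,
  [/\ 0 <= B, 0 <= th < 1 & forall q N, modC q <= rho ->
      modC (qs c q - psum c q N) <= B * th ^+ N].
Proof.
move=> hc r01; have [B [th [B0 t01 hB]]] := subexp_geom hc r01.
have t10 : 0 < 1 - th by case/andP: t01 => _ ?; rewrite subr_gt0.
exists (B / (1 - th)), th; split=> //; first by rewrite divr_ge0 // ltW.
move=> q N qr; rewrite mulrAC.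
have q1 : modC q < 1 by rewrite (le_lt_trans qr)//; case/andP: r01.
apply: (tends_le (N := N) (qsP hc q1)) => n Nn.
exact: psum_tail hB qr Nn.
Qed.

(** Second order Taylor estimate for the i-th power, cleared of q^(i-1) and rho^(i-2), whose
    exponents would be negative for small i. *)
Lemma expr_taylor1 q h (rho : R) i : modC q <= rho -> modC (q + h) <= rho ->
  rho ^+ 2 * modC (q * ((q + h) ^+ i - q ^+ i) - i%:R * h * q ^+ i)
    <= rho * modC h ^+ 2 * (i%:R ^+ 2 * rho ^+ i).
Proof.
move=> q1 q2; have r0 : 0 <= rho by rewrite (le_trans _ q1) ?modC_ge0.
elim: i => [|i IH].
  by rewrite !expr0 subrr mulr0 !mul0r subrr modC0 mulr0 expr0n /= !mul0r mulr0.
have -> : q * ((q + h) ^+ i.+1 - q ^+ i.+1) - i.+1%:R * h * q ^+ i.+1 =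
  (q + h) * (q * ((q + h) ^+ i - q ^+ i) - i%:R * h * q ^+ i) + i%:R * h ^+ 2 * q ^+ i.
  by rewrite !exprS mulrSr; ring.
set D := q * _ - _ in IH *.
have t1 : modC ((q + h) * D) <= rho * modC D by rewrite modCM ler_wpM2r ?modC_ge0.
have t2 : modC (i%:R * h ^+ 2 * q ^+ i) <= i%:R * modC h ^+ 2 * rho ^+ i.
  rewrite modCM [modC (q ^+ i)]modCX modCM [modC (h ^+ 2)]modCX modC_nat.
  rewrite ler_wpM2l ?mulr_ge0 ?modC_ge0//.
  by rewrite lerXn2r ?nnegrE ?modC_ge0.
have t3 := le_trans (modCD _ _) (lerD t1 t2).
have r20 : 0 <= rho ^+ 2 by rewrite sqr_ge0.
apply: (le_trans (ler_wpM2l r20 t3)).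
have t4 : rho * (rho ^+ 2 * modC D) <= rho * (rho * modC h ^+ 2 * (i%:R ^+ 2 * rho ^+ i)).
  by rewrite ler_wpM2l.
rewrite mulrDr [X in X + _](_ : _ = rho * (rho ^+ 2 * modC D)); last by ring.
apply: (le_trans (lerD t4 (lexx _))).
rewrite -subr_ge0 [rho ^+ i.+1]exprS mulrSr.
have p0 : 0 <= rho ^+ i by rewrite exprn_ge0.
set m : R := i%:R; have m0 : 0 <= m by rewrite /m.
have -> : rho * modC h ^+ 2 * ((m + 1) ^+ 2 * (rho * rho ^+ i)) -
   (rho * (rho * modC h ^+ 2 * (m ^+ 2 * rho ^+ i)) +
   rho ^+ 2 * (m * modC h ^+ 2 * rho ^+ i)) = rho ^+ 2 * rho ^+ i * modC h ^+ 2 * (m + 1) by ring.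
have m1 : 0 <= m + 1 by rewrite addr_ge0.
by rewrite mulr_ge0// mulr_ge0 ?sqr_ge0// mulr_ge0.
Qed.

(** Term by term: the second order errors are summable because the coefficients i^2 c_i are again
    subexponential. Dividing by q instead of shifting the index prepares for D, which multiplies the
    i-th coefficient of a q-expansion by i. *)
Lemma has_cderiv_qs c q : subexp c -> 0 < modC q < 1 ->
  has_cderiv (qs c) q (qs (fun i => i%:R * c i) q / q).
Proof.
move=> hc /andP[q0 q1]; have q_neq0 : q != 0 by rewrite -modC_gt0.
pose rho := (1 + modC q) / 2.
have rp : 0 < rho by rewrite /rho; lra.
have r1 : rho < 1 by rewrite /rho; lra.
have r01 : 0 <= rho < 1 by rewrite ltW.
have hc1 := subexp_natM hc; have hc2 := subexp_natM hc1.
have [B [th [B0 t01 hB]]] := subexp_geom hc2 r01.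
have t10 : 0 < 1 - th by case/andP: t01 => _ ?; rewrite subr_gt0.
pose K := B / (1 - th) / rho.
have K0 : 0 <= K by rewrite divr_ge0 ?(ltW rp)// divr_ge0 // ltW.
apply/has_cderivP => e e0.
pose d := Num.min (rho - modC q) (e * modC q / (K + 1)).
have K1 : 0 < K + 1 by rewrite ltr_wpDl.
have rr : modC q < rho by rewrite /rho; lra.
have d0 : 0 < d by rewrite lt_min subr_gt0 rr (divr_gt0 (mulr_gt0 e0 q0) K1).
exists d => // h; rewrite lt_min => /andP[h1 h2].
have qhr : modC (q + h) <= rho by have := modCD q h; lra.
have qr : modC q <= rho by rewrite /rho; lra.
have main : modC (q * (qs c (q + h) - qs c q) - h * qs (fun i => i%:R * c i) q)
    <= K * modC h ^+ 2.
  rewrite -[X in modC X]subr0.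
  have tu : tends (fun n => q * (psum c (q + h) n - psum c q n) -
      h * psum (fun i => i%:R * c i) q n)
     (q * (qs c (q + h) - qs c q) - h * qs (fun i => i%:R * c i) q).
    apply: tendsB; apply: tendsZ; last exact: qsP.
    by apply: tendsB; apply: qsP => //; exact: le_lt_trans qhr r1.
  apply: (tends_le (N := 0) tu) => n _; rewrite subr0.
  have -> : q * (psum c (q + h) n - psum c q n) - h * psum (fun i => i%:R * c i) q n
    = \sum_(i < n) c i * (q * ((q + h) ^+ i - q ^+ i) - i%:R * h * q ^+ i).
    rewrite /psum -sumrB !mulr_sumr -sumrB; apply: eq_bigr => i _; ring.
  apply: (le_trans (modC_sum _ _ _)).
  have st i : modC (c i * (q * ((q + h) ^+ i - q ^+ i) - i%:R * h * q ^+ i)) <=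
     (modC h ^+ 2 / rho) * (B * th ^+ i).
    have := hB i; rewrite !modCM modC_nat => hBi.
    have ex := expr_taylor1 i qr qhr.
    rewrite [X in _ <= X]mulrAC ler_pdivlMr//.
    set D := modC (_ - _) in ex *.
    have ex' : rho * D <= modC h ^+ 2 * (i%:R ^+ 2 * rho ^+ i).
      by rewrite -(ler_pM2l rp); move: ex; rewrite expr2 -!mulrA.
    rewrite -mulrA [D * _]mulrC.
    apply: (le_trans (ler_wpM2l (modC_ge0 _) ex')).
    rewrite [X in X <= _](_ : _ = modC h ^+ 2 * (i%:R * (i%:R * modC (c i)) * rho ^+ i)); last by ring.
    by rewrite ler_wpM2l ?sqr_ge0.
  apply: (le_trans (ler_sum _ (fun (i : 'I_n) _ => st i))).
  rewrite -mulr_sumr -(big_mkord xpredT (fun i => B * th ^+ i)).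
  have := sum_geom_le 0 n B0 t01; rewrite add0n expr0 mulr1 => sg.
  have hr0 : 0 <= modC h ^+ 2 / rho by rewrite divr_ge0 ?sqr_ge0 // ltW.
  apply: (le_trans (ler_wpM2l hr0 sg)).
  by rewrite [leRHS](_ : _ = modC h ^+ 2 / rho * (B / (1 - th)))// /K; ring.
have -> : qs c (q + h) - qs c q - qs (fun i => i%:R * c i) q / q * h =
   (q * (qs c (q + h) - qs c q) - h * qs (fun i => i%:R * c i) q) / q.
  by field.
rewrite modCM modCV ler_pdivrMr//.
apply: (le_trans main).
move: h2; rewrite ltr_pdivlMr// => h2.
rewrite expr2 mulrA [leRHS]mulrAC ler_wpM2r ?modC_ge0//.
have h0 := modC_ge0 h; by rewrite mulrC (le_trans _ (ltW h2))// ler_wpM2l// lerDl ler01.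
Qed.

End PowerSeries.

(** * Iterated derivatives and q-expansions on the half-plane *)

Section HalfPlane.
Variable R : realType.
Implicit Types (f g : CC R -> CC R) (z w q l : CC R) (c : nat -> CC R).

Definition tau : CC R := ofR (2 * pi) * 'i.

Lemma tau_neq0 : tau != 0.
Proof. by rewrite mulf_neq0 ?neq0Ci// ofR_eq0 mulf_neq0// gt_eqF// pi_gt0. Qed.

Lemma halfplaneE z : halfplane z = (0 < imC z). Proof. by []. Qed.

Lemma halfplane_near z w : halfplane z -> modC (w - z) < imC z -> halfplane w.
Proof.
rewrite /halfplane /= => z0 h; have := abs_imC_le (w - z).
rewrite imCD imCN ler_norml => /andP[h1 _]; lra.
Qed.

Lemma has_cderiv_extH f g z l : (forall w, halfplane w -> f w = g w) ->
  halfplane z -> has_cderiv f z l -> has_cderiv g z l.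
Proof.
move=> fg z0; apply: has_cderiv_near (z0) _ => w hw; apply: fg.
exact: halfplane_near hw.
Qed.

Lemma has_cderiv_D f z l : has_cderiv f z (tau * l) -> D f z = l.
Proof.
by move=> /has_cderiv_derive1; rewrite /D => ->; rewrite mulKf// tau_neq0.
Qed.

Lemma derive1_extH f g z : (forall w, halfplane w -> f w = g w) ->
  halfplane z -> derive1 f z = derive1 g z.
Proof.
move=> fg zH; rewrite !derive1E; apply: near_eq_derive.
apply/nbhs_ballP; exists (ofR (imC z)); first by rewrite /= -ofR0 ofR_lt.
move=> w; rewrite /ball /= normE ofR_lt modC_distC => h.
exact/fg/(halfplane_near zH h).
Qed.

Lemma DnS s f : Dn s.+1 f = D (Dn s f). Proof. by []. Qed.

Lemma Dn_extH f g s z : (forall w, halfplane w -> f w = g w) ->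
  halfplane z -> Dn s f z = Dn s g z.
Proof.
move=> fg; elim: s z => [|s IH] z zH; first exact: fg.
by rewrite !DnS /D (derive1_extH IH zH).
Qed.

(** Differentiability at all orders. It is derived from q-expansions or explicit towers of
    derivatives, so that the general regularity theorem for holomorphic functions does not enter. *)
Definition smoothH f := forall s z, halfplane z -> derivable (Dn s f) z 1.

Lemma smoothH_deriv f s z : smoothH f -> halfplane z ->
  has_cderiv (Dn s f) z (tau * Dn s.+1 f z).
Proof.
move=> fs zH; apply: has_cderiv_eq (derivable_has_cderiv (fs s z zH)) _.
by rewrite DnS /D mulVKf// tau_neq0.
Qed.

(** Exhibiting a candidate for each derivative reduces a claim on all iterates of D to a single
    differentiation per order. *)
Lemma tower_smoothH (F : nat -> CC R -> CC R) :
  (forall s z, halfplane z -> has_cderiv (F s) z (tau * F s.+1 z)) ->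
  smoothH (F 0%N) /\ forall s z, halfplane z -> Dn s (F 0%N) z = F s z.
Proof.
move=> hF; have E s z : halfplane z -> Dn s (F 0%N) z = F s z.
  elim: s z => [//|s IH] z zH; rewrite DnS.
  apply: has_cderiv_D; apply: (has_cderiv_extH (f := F s)) => //; last exact: hF.
  by move=> w wH; rewrite IH.
split=> // s z zH; apply: has_cderiv_derivable.
by apply: (has_cderiv_extH (f := F s)) (hF s z zH) => // w wH; rewrite E.
Qed.

Lemma smoothH_ext f g : (forall w, halfplane w -> f w = g w) -> smoothH f -> smoothH g.
Proof.
move=> fg fs s z zH; apply: (@has_cderiv_derivable _ _ _ (tau * Dn s.+1 f z)).
apply: (has_cderiv_extH (f := Dn s f)) => //; last exact: smoothH_deriv.
by move=> w wH; exact: Dn_extH.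
Qed.

Lemma smoothH_cst (a : CC R) : smoothH (fun=> a) /\
  forall s z, halfplane z -> Dn s (fun=> a) z = if s is 0%N then a else 0.
Proof.
apply: (tower_smoothH (F := fun s (z : CC R) => if s is 0%N then a else 0 : CC R)).
by move=> [|s] z _; rewrite mulr0; exact: has_cderiv_cst.
Qed.

Lemma smoothHZ (a : CC R) f : smoothH f -> smoothH (fun z => a * f z) /\
  forall s z, halfplane z -> Dn s (fun z => a * f z) z = a * Dn s f z.
Proof.
move=> fs; apply: (tower_smoothH (F := fun s z => a * Dn s f z)) => s z zH.
by rewrite mulrCA; apply: has_cderivZ; exact: smoothH_deriv.
Qed.

Lemma modC_qpar z : modC (qpar z) = expR (- (2 * pi * imC z)).
Proof.
rewrite /qpar modC_cexp reCM reCM imCM !reC_ofR !imC_ofR reCi imCi.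
by congr expR; ring.
Qed.

Lemma modC_qpar_lt1 z : halfplane z -> 0 < modC (qpar z) < 1.
Proof.
move=> zH; have z0 : 0 < imC z by [].
rewrite modC_qpar expR_gt0 -[X in _ < X]expR0 ltr_expR.
by rewrite oppr_lt0 !mulr_gt0// pi_gt0.
Qed.

Lemma qpar_neq0 z : qpar z != 0. Proof. exact: cexp_neq0. Qed.

Lemma has_cderiv_qpar z : has_cderiv (@qpar R) z (tau * qpar z).
Proof.
have h := has_cderivZ tau (has_cderiv_id z).
by apply: has_cderiv_eq (has_cderiv_comp h (has_cderiv_cexp _)) _; rewrite mulr1 mulrC.
Qed.

Definition iy (y : R) : CC R := 'i * ofR y.

Lemma imC_iy y : imC (iy y) = y.
Proof. by rewrite imCM reCi imCi reC_ofR mul0r mul1r add0r. Qed.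
Lemma reC_iy y : reC (iy y) = 0.
Proof. by rewrite reCM reCi imCi imC_ofR mul0r mulr0 subrr. Qed.

Lemma qpar_surj_mod (r : R) : 0 < r < 1 -> exists2 y : R, 0 < y & modC (qpar (iy y)) = r.
Proof.
move=> /andP[r0 r1]; have p0 : 0 < 2 * pi :> R by rewrite mulr_gt0// pi_gt0.
exists (- ln r / (2 * pi)); first by rewrite divr_gt0// oppr_gt0 ln_lt0// r0.
rewrite modC_qpar imC_iy mulrC mulfVK ?gt_eqF// opprK lnK//.
Qed.

Definition qexp c f := forall z, halfplane z -> tends (psum c (qpar z)) (f z).

Lemma holo_at_cuspP f : holo_at_cusp f <-> exists c, qexp c f.
Proof.
split=> [[c hc]|[c hc]]; exists c => z zH.
  by apply/cvg_modCP; rewrite -psum_series; exact: hc.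
by rewrite psum_series; apply/cvg_modCP; exact: hc.
Qed.

Lemma tends_term_bounded (u : nat -> CC R) l : tends u l ->
  exists B : R, forall n, modC (u n.+1 - u n) <= B.
Proof.
move=> /tends_bounded[B hB]; exists (B + B) => n.
by rewrite (le_trans (modCB _ _))// lerD.
Qed.

(** The terms of a convergent series are bounded, and |q| takes every value in ]0, 1[ on the
    half-plane. *)
Lemma qexp_subexp c f : qexp c f -> subexp c.
Proof.
move=> hc r r01; have [y y0 yr] := qpar_surj_mod r01.
have /hc/tends_term_bounded[B hB] : halfplane (iy y) by rewrite halfplaneE imC_iy.
exists B => i; have := hB i; rewrite /psum big_ord_recr /= addrAC subrr add0r.
by rewrite modCM modCX yr.
Qed.

Lemma qexpE c f z : qexp c f -> halfplane z -> f z = qs c (qpar z).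
Proof.
move=> hc zH; apply: tends_unique (hc z zH) _; apply: qsP; first exact: qexp_subexp hc.
by case/andP: (modC_qpar_lt1 zH).
Qed.

Lemma qexp_qs c : subexp c -> qexp c (fun z => qs c (qpar z)).
Proof. by move=> hc z /modC_qpar_lt1/andP[_ h]; exact: qsP. Qed.

Lemma qexp_ext c f g : (forall z, halfplane z -> f z = g z) -> qexp c f -> qexp c g.
Proof. by move=> fg h z zH; rewrite -fg//; exact: h. Qed.

Lemma qexpD c d f g : qexp c f -> qexp d g ->
  qexp (fun i => c i + d i) (fun z => f z + g z).
Proof.
move=> hc hd z zH; have := tendsD (hc z zH) (hd z zH); apply: (tends_eq (N := 0)) => n _.
by rewrite /psum -big_split; apply: eq_bigr => i _; rewrite /= mulrDl.
Qed.

Lemma qexpZ (a : CC R) c f : qexp c f -> qexp (fun i => a * c i) (fun z => a * f z).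
Proof.
move=> hc z zH; have := tendsZ a (hc z zH); apply: (tends_eq (N := 0)) => n _.
by rewrite /psum mulr_sumr; apply: eq_bigr => i _; rewrite mulrA.
Qed.

Lemma qexp_cst (a : CC R) : qexp (fun i => if i is 0%N then a else 0) (fun=> a).
Proof.
move=> z zH; have := @tends_cst _ a; apply: (tends_eq (N := 1)) => -[//|n] _.
rewrite /psum big_ord_recl expr0 mulr1 big1 ?addr0// => i _.
by rewrite mul0r.
Qed.

Lemma qexp_sum (I : Type) (r : seq I) (F : I -> CC R -> CC R) (c : I -> nat -> CC R) :
  (forall i, qexp (c i) (F i)) ->
  qexp (fun n => \sum_(i <- r) c i n) (fun z => \sum_(i <- r) F i z).
Proof.
move=> h z zH; have := tends_sum r (fun i => h i z zH); apply: (tends_eq (N := 0)) => n _.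
rewrite /psum exchange_big; apply: eq_bigr => j _; exact: esym (mulr_suml _ _ _ _).
Qed.

(** D is q d/dq, so these are the coefficients of the s-th derivative. *)
Definition natpow s c : nat -> CC R := fun i => i%:R ^+ s * c i.

Lemma subexp_natpow s c : subexp c -> subexp (natpow s c).
Proof.
move=> hc; elim: s => [|s IH].
  by apply: (subexp_le (K := 1)) hc => i; rewrite /natpow expr0 !mul1r.
have := subexp_natM IH; apply: (subexp_le (K := 1)) => i.
by rewrite mul1r /natpow exprS mulrA.
Qed.

Lemma has_cderiv_qs_qpar c z : subexp c -> halfplane z ->
  has_cderiv (fun z => qs c (qpar z)) z (tau * qs (fun i => i%:R * c i) (qpar z)).
Proof.
move=> hc zH; apply: has_cderiv_eq
  (has_cderiv_comp (has_cderiv_qpar z) (has_cderiv_qs hc (modC_qpar_lt1 zH))) _.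
by field; exact: qpar_neq0.
Qed.

Lemma qexp_Dn c f : qexp c f -> smoothH f /\ forall s, qexp (natpow s c) (Dn s f).
Proof.
move=> hc; have sc := qexp_subexp hc.
have [S E] : smoothH (fun z => qs (natpow 0 c) (qpar z)) /\
   forall s z, halfplane z -> Dn s (fun z => qs (natpow 0 c) (qpar z)) z = qs (natpow s c) (qpar z).
  apply: (tower_smoothH (F := fun s z => qs (natpow s c) (qpar z))) => s z zH.
  apply: has_cderiv_eq (has_cderiv_qs_qpar (subexp_natpow s sc) zH) _.
  congr (_ * qs _ _); apply/funext => i; by rewrite /natpow exprS mulrA.
have E0 z : halfplane z -> qs (natpow 0 c) (qpar z) = f z.
  move=> zH; rewrite (qexpE hc zH); congr qs.
  by apply/funext => i; rewrite /natpow expr0 mul1r.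
split; first exact: smoothH_ext E0 S.
move=> s; apply: qexp_ext (qexp_qs (subexp_natpow s sc)) => z zH.
by rewrite -E//; exact: Dn_extH.
Qed.

End HalfPlane.

(** * Roots of unity and Cauchy's estimate *)

Section CauchyEstimate.
Variable R : realType.
Implicit Types (z w q l : CC R) (c : nat -> CC R).

Definition zeta N : CC R := cexp (ofR (2 * pi / N%:R) * 'i).

Lemma zetaX N m : zeta N ^+ m = cexp (ofR (2 * pi / N%:R * m%:R) * 'i).
Proof. rewrite -cexpMn [ofR (_ * m%:R)]ofRM [ofR m%:R]ofR_nat; congr cexp; ring. Qed.

Lemma cexp_2pi_i : cexp (ofR (2 * pi) * 'i) = 1 :> CC R.
Proof.
have e : 2 * pi = pi *+ 2 :> R by rewrite mulr2n; ring.
by rewrite mulrC cexp_i e cos2pi sin2pi ofR0 mulr0 addr0.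
Qed.

Lemma zetaN N : (0 < N)%N -> zeta N ^+ N = 1.
Proof.
move=> N0; rewrite zetaX mulfVK ?cexp_2pi_i//.
by rewrite pnatr_eq0 -lt0n.
Qed.

Lemma modC_zeta N : modC (zeta N) = 1.
Proof.
by rewrite modC_cexp reCM reCi imC_ofR mulr0 mul0r subrr expR0.
Qed.

Lemma zeta_prim N m : (0 < m < N)%N -> zeta N ^+ m != 1.
Proof.
move=> /andP[m0 mN]; have N0 : (0 < N)%N by apply: leq_ltn_trans mN.
(* Half the argument of zeta^m, whose real part is therefore 1 - 2 sin(t)^2, with 0 < t < pi. *)
pose t : R := pi / N%:R * m%:R.
have Np : 0 < N%:R :> R by rewrite ltr0n.
have t0 : 0 < t by rewrite !mulr_gt0 ?invr_gt0 ?pi_gt0 ?ltr0n.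
have tp : t < pi.
  by rewrite /t mulrAC ltr_pdivrMr// ltr_pM2l ?pi_gt0// ltr_nat.
have sp : 0 < sin t by apply: sin_gt0_pi; rewrite t0.
apply/eqP => /(congr1 (@reC R)).
rewrite zetaX mulrC cexp_i.
have -> : 2 * pi / N%:R * m%:R = t + t by rewrite /t; ring.
rewrite reCD reCM reCi imC_ofR reC_ofR mul0r mulr0 subrr addr0 cosD.
have -> : reC (1 : CC R) = 1 by [].
have := cos2Dsin2 t; rewrite !expr2 => h1 h2.
have : 0 < sin t * sin t by rewrite mulr_gt0.
lra.
Qed.

Lemma zeta_sum N m : (0 < N)%N ->
  \sum_(j < N) zeta N ^+ (j * m) = if (N %| m)%N then N%:R else 0.
Proof.
move=> N0; case: ifP => [/dvdnP[k ->]|h].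
  rewrite (eq_bigr (fun=> 1)) ?sumr_const ?card_ord// => j _.
  by rewrite mulnA mulnC exprM zetaN// expr1n.
set x := zeta N ^+ m.
have xN : x ^+ N = 1 by rewrite -exprM mulnC exprM zetaN// expr1n.
have x1 : x != 1.
  have -> : x = zeta N ^+ (m %% N).
    by rewrite /x {1}(divn_eq m N) exprD mulnC exprM zetaN// expr1n mul1r.
  by apply: zeta_prim; rewrite ltn_mod N0 andbT lt0n; move: h; rewrite /dvdn => ->.
have : (x - 1) * \sum_(j < N) x ^+ j = 0 by rewrite -subrX1 xN subrr.
move=> /eqP; rewrite mulf_eq0 subr_eq0 (negbTE x1)/= => /eqP s0; rewrite -[RHS]s0.
by apply: eq_bigr => j _; rewrite /x -exprM mulnC.
Qed.

Lemma geom_small (B th e : R) : 0 <= th < 1 -> 0 < e ->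
  exists N, forall n, (N <= n)%N -> B * th ^+ n < e.
Proof.
move=> /andP[t0 t1] e0.
have B1 : 0 < `|B| + 1 by rewrite ltr_wpDl.
have hc : (GRing.exp th : R ^nat) @ \oo --> (0 : R) by apply: cvg_expr; rewrite ger0_norm.
have /cvgrPdist_lt/(_ (e / (`|B| + 1))) := hc.
rewrite divr_gt0// => /(_ isT)[N _ hN]; exists N => n /hN /=.
rewrite sub0r normrN ger0_norm ?exprn_ge0// ltr_pdivlMr// => h.
rewrite (le_lt_trans _ h)// mulrC ler_wpM2l ?exprn_ge0//.
by rewrite (le_trans (ler_norm _))// lerDl.
Qed.

Lemma qpar_surj q : 0 < modC q < 1 -> exists2 z, halfplane z & qpar z = q.
Proof.
move=> /andP[q0 q1]; have q_neq0 : q != 0 by rewrite -modC_gt0.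
have p0 : 0 < 2 * pi :> R by rewrite mulr_gt0// pi_gt0.
have e : tau R * (clog q / tau R) = clog q by rewrite mulrCA mulfV ?mulr1// tau_neq0.
have hq : qpar (clog q / tau R) = q by rewrite /qpar -/(tau R) e clogK.
exists (clog q / tau R) => //.
have := modC_qpar (clog q / tau R); rewrite hq halfplaneE => hm.
have : expR (- (2 * pi * imC (clog q / tau R))) < expR 0 by rewrite -hm expR0.
by rewrite ltr_expR oppr_lt0 pmulr_rgt0.
Qed.

Lemma cauchy_coef c (M : R) : subexp c ->
  (forall z, halfplane z -> modC (qs c (qpar z)) <= M) ->
  forall i, modC (c i) <= M.
Proof.
move=> hc hM i.
have step (rho : R) : 0 < rho < 1 -> modC (c i) * rho ^+ i <= M.
  move=> r01; have r0 : 0 < rho by case/andP: r01.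
  have [|B [th [B0 t01 hB]]] := qs_tail (rho := rho) hc; first by rewrite ltW //; case/andP: r01.
  apply/ler_addgt0Pr => e e0.
  have [N0 hN0] := geom_small B t01 e0.
  pose N := maxn N0 i.+1.
  have iN : (i < N)%N by rewrite leq_max leqnn orbT.
  have Np : (0 < N)%N by apply: leq_trans iN.
  have tN : B * th ^+ N <= M + e - M by rewrite addrAC subrr add0r ltW// hN0// leq_maxl.
  have Nr : 0 < N%:R :> R by rewrite ltr0n.
  pose q := ofR rho.
  have qm j : modC (q * zeta N ^+ j) = rho.
    by rewrite modCM modCX modC_zeta expr1n mulr1 modC_ofR ger0_norm // ltW.
  have pb j : modC (psum c (q * zeta N ^+ j) N) <= M + e.
    have [|z zH zq] := @qpar_surj (q * zeta N ^+ j); first by rewrite qm.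
    have h1 := hM z zH; rewrite zq in h1.
    have h2 := hB (q * zeta N ^+ j) N; rewrite qm lexx in h2.
    have := modCB (qs c (q * zeta N ^+ j)) (qs c (q * zeta N ^+ j) - psum c (q * zeta N ^+ j) N).
    rewrite opprB addrC subrK; have := h2 isT; lra.
  (* The weight zeta^(j (N - i)) stands for zeta^(- i j); as l and i are below N, only l = i makes l
     + (N - i) divisible by N. *)
  have E : \sum_(j < N) psum c (q * zeta N ^+ j) N * zeta N ^+ (j * (N - i)) = N%:R * (c i * q ^+ i).
    under eq_bigr do rewrite /psum mulr_suml.
    rewrite exchange_big /=.
    have inner (l : 'I_N) : \sum_(j < N) c l * (q * zeta N ^+ j) ^+ l * zeta N ^+ (j * (N - i)) =
       if l == Ordinal iN then N%:R * (c i * q ^+ i) else 0.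
      transitivity (c l * q ^+ l * \sum_(j < N) zeta N ^+ (j * (l + (N - i)))).
        rewrite mulr_sumr; apply: eq_bigr => j _.
        by rewrite exprMn -exprM mulnDr exprD; ring.
      rewrite zeta_sum//.
      have -> : (N %| l + (N - i))%N = (l == Ordinal iN).
        have lN := ltn_ord l; apply/idP/eqP => [/dvdnP[k hk]|->] /=.
          by apply: val_inj => /=; case: k hk => [|[|k]] hk; nia.
        by rewrite subnKC ?dvdnn// ltnW.
      case: eqP => [->/=|_]; last by rewrite mulr0.
      by rewrite mulrC.
    rewrite (eq_bigr _ (fun (l : 'I_N) _ => inner l)) -big_mkcond /= big_pred1_eq //.
  have : modC (N%:R * (c i * q ^+ i)) <= N%:R * (M + e).
    rewrite -E (le_trans (modC_sum _ _ _))//.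
    apply: (@le_trans _ _ (\sum_(j < N) (M + e))).
      by apply: ler_sum => j _; rewrite modCM modCX modC_zeta expr1n mulr1.
    by rewrite sumr_const card_ord mulr_natl.
  rewrite modCM modC_nat ler_pM2l// modCM modCX modC_ofR ger0_norm //.
  by rewrite ltW.
have M0 : 0 <= M.
  have := step (1 / 2); have := modC_ge0 (c i) => c0 h.
  rewrite (le_trans _ (h _)) ?mulr_ge0 ?exprn_ge0//; lra.
apply/ler_addgt0Pr => e e0.
have s0 : 0 <= i%:R * modC (c i) by rewrite mulr_ge0 ?modC_ge0.
have C0 : 0 < i%:R * modC (c i) + 1 + e by lra.
(* With rho = 1 - x, replacing rho^i by 1 costs at most i x |c_i| <= e. *)
have [x [x0 x1 h3]] : exists x, [/\ 0 < x, x < 1 & x * (i%:R * modC (c i)) <= e].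
  exists (e / (i%:R * modC (c i) + 1 + e)); split; first by rewrite divr_gt0.
    by rewrite ltr_pdivrMr// mul1r; lra.
  by rewrite mulrAC ler_pdivrMr// ler_pM2l//; lra.
have bern : 1 - i%:R * x <= (1 - x) ^+ i.
  elim: (i) => [|j IH]; first by rewrite mul0r subr0 expr0.
  have : (1 - x) * (1 - j%:R * x) <= (1 - x) * (1 - x) ^+ j by rewrite ler_wpM2l// subr_ge0 ltW.
  have : 0 <= j%:R * (x * x) by rewrite !mulr_ge0// ltW.
  rewrite exprS mulrSr; nra.
have := step (1 - x); rewrite subr_gt0 x1 /= ltrBlDr ltrDl x0 => /(_ isT) h.
have h2 : modC (c i) * (1 - i%:R * x) <= modC (c i) * (1 - x) ^+ i by rewrite ler_wpM2l ?modC_ge0.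
nra.
Qed.

End CauchyEstimate.

(** * Forms of weight 0 and 2 for the full modular group *)

Section LevelOne.
Variable R : realType.
Implicit Types (z w q l : CC R) (c : nat -> CC R).

Lemma reCV z : reC z^-1 = reC z / modC z ^+ 2.
Proof. by rewrite modC_sqr; case: z. Qed.
Lemma imCV z : imC z^-1 = - imC z / modC z ^+ 2.
Proof. by rewrite modC_sqr; case: z => a b /=; rewrite mulNr. Qed.

Lemma halfplane_neq0 z : halfplane z -> z != 0.
Proof. by apply: contraTneq => ->; rewrite ltxx. Qed.

Lemma halfplane_negV z : halfplane z -> halfplane (- z^-1).
Proof.
move=> zH; have z0 := halfplane_neq0 zH.
by rewrite halfplaneE imCN imCV mulNr opprK divr_gt0// exprn_gt0// modC_gt0.
Qed.

Lemma cexp_2pi_int (m : int) : cexp (tau R * m%:~R) = 1.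
Proof.
have nat_case n : cexp (tau R * n%:R) = 1.
  by rewrite mulrC cexpMn /tau cexp_2pi_i expr1n.
case: m => n; first exact: nat_case.
by rewrite NegzE mulrNz mulrN cexpN nat_case invr1.
Qed.

Lemma qparD z w : qpar (z + w) = qpar z * qpar w.
Proof. by rewrite /qpar mulrDr cexpD. Qed.

Lemma qparDint z (m : int) : qpar (z + m%:~R) = qpar z.
Proof. by rewrite qparD [qpar m%:~R]cexp_2pi_int mulr1. Qed.

Lemma imC_int (m : int) : imC (m%:~R : CC R) = 0.
Proof. by rewrite -[m%:~R](rmorph_int (real_complex R)). Qed.
Lemma reC_int (m : int) : reC (m%:~R : CC R) = m%:~R.
Proof. by rewrite -[in LHS](rmorph_int (real_complex R)). Qed.

(* Translating into |Re z| <= 1/2 and then inverting at least doubles an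
   imaginary part below 1/2. *)
Lemma invariant_rep (G : CC R -> CC R) :
  (forall z (m : int), halfplane z -> G (z + m%:~R) = G z) ->
  (forall z, halfplane z -> G (- z^-1) = G z) ->
  forall z, halfplane z -> exists2 w, 1 / 2 <= imC w & G w = G z.
Proof.
move=> GT GS; have ind n z : halfplane z -> 1 / 2 <= imC z * 2 ^+ n ->
    exists2 w, 1 / 2 <= imC w & G w = G z.
  elim: n z => [|n IH] z zH h.
    by exists z => //; move: h; rewrite expr0 mulr1.
  have [h2|h2] := leP (1 / 2) (imC z); first by exists z.
  pose m := Num.floor (reC z + 1 / 2).
  pose w := z + (- m)%:~R.
  have imw : imC w = imC z by rewrite imCD imC_int addr0.
  have wH : halfplane w by rewrite halfplaneE imw.
  have rew : `|reC w| <= 1 / 2.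
    have := floor_le (reC z + 1 / 2); have := floorD1_gt (reC z + 1 / 2).
    rewrite -/m intrD => h3 h4.
    by rewrite reCD reC_int mulrNz ler_norml; lra.
  have m2 : modC w ^+ 2 <= 1 / 2.
    rewrite modC_sqr imw.
    have : reC w ^+ 2 <= (1 / 2) ^+ 2.
      by rewrite -[reC w ^+ 2]real_normK ?num_real// lerXn2r// nnegrE.
    have : imC z ^+ 2 <= (1 / 2) ^+ 2 by rewrite lerXn2r ?nnegrE// ltW.
    rewrite !expr2; lra.
  have m0 : 0 < modC w ^+ 2 by rewrite exprn_gt0// modC_gt0 halfplane_neq0.
  have [||v hv Gv] := IH (- w^-1); first exact: halfplane_negV.
    rewrite imCN imCV [- imC w / _]mulNr opprK imw; apply: (le_trans h).
    rewrite exprS mulrA ler_wpM2r ?exprn_ge0//.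
    rewrite ler_pdivlMr// -mulrA ler_piMr//; first by rewrite ltW.
    lra.
  by exists v => //; rewrite Gv GS// GT.
move=> z zH; have z0 : 0 < imC z by [].
pose n := Num.bound (imC z)^-1.
apply: (ind n) => //; rewrite -ler_pdivrMl//.
have h : (imC z)^-1 < n%:R.
  by have := archi_boundP (ltW (_ : 0 < (imC z)^-1)); apply; rewrite invr_gt0.
have h2 : n%:R <= 2 ^+ n :> R by rewrite -natrX ler_nat ltnW// ltn_expl.
have : 0 < (imC z)^-1 by rewrite invr_gt0.
lra.
Qed.

(** The crude bounds pi >= 2 and exp t >= 1 + t, at t = 2 pi Im z >= 2, suffice. *)
Lemma qpar_le z : 1 / 2 <= imC z -> modC (qpar z) <= 1 / 3.
Proof.
move=> h; rewrite modC_qpar expRN -[X in _ <= X]invrK lef_pV2 ?posrE ?expR_gt0// ?invr_gt0//.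
rewrite invf_div divr1.
have p2 := pi_ge2 R.
have : 2 <= 2 * pi * imC z by nra.
have := expR_ge1Dx (2 * pi * imC z); lra.
Qed.

(* A bound M on the half-plane bounds the coefficients by M (Cauchy), hence the
   values with |q| <= 1/3 by M (1/3) / (1 - 1/3) = M / 2; by invariance this is
   again a bound on the whole half-plane. *)
Lemma invariant_qexp_eq0 c : subexp c -> c 0%N = 0 ->
  (forall z, halfplane z -> qs c (qpar (- z^-1)) = qs c (qpar z)) ->
  forall i, c i = 0.
Proof.
move=> hc c0 GS.
have rep z : halfplane z -> exists2 w, 1 / 2 <= imC w &
    qs c (qpar w) = qs c (qpar z).
  apply: (invariant_rep (G := fun z => qs c (qpar z))) GS _ => {}z m _.
  by rewrite qparDint.
have [|B [th [B0 t01 hB]]] := qs_tail (rho := 1 / 3) hc; first by lra.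
have bd n z : halfplane z -> modC (qs c (qpar z)) <= B * (1 / 2) ^+ n.
  elim: n z => [|n IH] z /rep[w hw <-].
    have := hB (qpar w) 0%N (qpar_le hw).
    by rewrite /psum big_ord0 subr0 !expr0.
  have co := cauchy_coef hc IH.
  set M := B * (1 / 2) ^+ n in co.
  have M0 : 0 <= M by rewrite mulr_ge0// exprn_ge0.
  have q3 := qpar_le hw.
  have ql : modC (qpar w) < 1 by lra.
  rewrite -[qs _ _]subr0; apply: (tends_le (N := 1) (qsP hc ql)) => -[//|k] _.
  rewrite subr0 /psum big_ord_recl c0 mul0r add0r.
  apply: (le_trans (modC_sum _ _ _)).
  apply: (@le_trans _ _ (\sum_(i < k) M * (1 / 3) ^+ i.+1)).
    apply: ler_sum => i _; rewrite modCM modCX ler_pM ?modC_ge0 ?exprn_ge0 ?modC_ge0//.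
    by rewrite lerXn2r ?nnegrE ?modC_ge0//; lra.
  have t3 : 0 <= (1 / 3 : R) < 1 by lra.
  have := sum_geom_le 1 k M0 t3.
  rewrite big_add1 add1n /= big_mkord.
  move=> h; apply: (le_trans h).
  rewrite expr1 /M exprS; set t := _ ^+ n.
  rewrite [leLHS](_ : _ = B * (1 / 2 * t))//; by field.
move=> i; apply/eqP; rewrite -modC_eq0 eq_le modC_ge0 andbT.
apply/ler_addgt0Pr => e e0; rewrite add0r.
have [|N hN] := @geom_small R B (1 / 2) e _ e0; first by lra.
apply: (le_trans (cauchy_coef hc (bd N) i)).
by rewrite ltW// hN.
Qed.

(** The half-plane is convex, so the real mean value theorem applies to both parts of F along the
    segment from z to w. *)
Lemma deriv0_constH (F : CC R -> CC R) :
  (forall z, halfplane z -> has_cderiv F z 0) ->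
  forall z w, halfplane z -> halfplane w -> F z = F w.
Proof.
move=> F0 z w zH wH.
pose p (t : R) := z + ofR t * (w - z).
have pH t : 0 <= t <= 1 -> halfplane (p t).
  move=> t01; rewrite halfplaneE imCD imCM imC_ofR reC_ofR mul0r addr0 imCD imCN.
  have z0 : 0 < imC z by []. have w0 : 0 < imC w by [].
  nra.
have key (f : CC R -> R) : (forall z w, f (z + w) = f z + f w) ->
    (forall z, `|f z| <= modC z) -> f (F w) = f (F z).
  move=> fD fle.
  have fB x y : f (x - y) = f x - f y.
    by apply/eqP; rewrite eq_sym subr_eq -fD subrK.
  have dt (t : R) : 0 <= t <= 1 -> is_derive t (1 : R) (fun t => f (F (p t))) 0.
    move=> /pH/F0/has_cderivP Fd; apply/is_derive_normP => e e0.
    have C0 : 0 < modC (w - z) + 1 by rewrite ltr_wpDl ?modC_ge0.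
    have [|d d0 hd] := Fd (e / (modC (w - z) + 1)); first by rewrite divr_gt0.
    exists (d / (modC (w - z) + 1)); first by rewrite divr_gt0.
    move=> h; rewrite ltr_pdivlMr// => hh.
    have hm : modC (ofR h * (w - z)) <= `|h| * (modC (w - z) + 1).
      by rewrite modCM modC_ofR ler_wpM2l// lerDl.
    have := hd (ofR h * (w - z)) (le_lt_trans hm hh).
    have -> : p t + ofR h * (w - z) = p (t + h) by rewrite /p ofRD; ring.
    rewrite mul0r !subr0 -fB => h1.
    rewrite mul0r subr0; apply: (le_trans (fle _)); apply: (le_trans h1).
    rewrite mulrAC ler_pdivrMr// -mulrA ler_wpM2l// ltW//.
  have [|||x _] := @MVT_segment R (fun t => f (F (p t))) (fun=> 0) 0 1.
  - exact: ler01.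
  - by move=> x; rewrite in_itv /= => /andP[h1 h2]; apply: dt; rewrite !ltW.
  - apply: derivable_within_continuous => x; rewrite in_itv /= => h.
    by have := dt x h; case.
  have -> : p 1 = w by rewrite /p ofR1; ring.
  have -> : p 0 = z by rewrite /p ofR0; ring.
  rewrite mul0r => /eqP; by rewrite subr_eq0 => /eqP.
apply: CC_eqP; apply/esym; apply: key.
- exact: reCD.
- exact: abs_reC_le.
- exact: imCD.
- exact: abs_imC_le.
Qed.

End LevelOne.

(** * Primitives of forms of weight 2 with an anomaly, at the elliptic points *)

Section QuasiModular.
Variable R : realType.
Implicit Types (z w q l : CC R) (c : nat -> CC R).

(** The triple angle formula and cos pi = -1 give (C + 1) (2 C - 1)^2 = 0, and C is positive. *)
Lemma cos_pi3 : cos (pi / 3) = 1 / 2 :> R.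
Proof.
have p0 := pi_gt0 R.
have c0 : 0 < cos (pi / 3 : R) by apply: cos_gt0_pihalf; lra.
have e : pi = pi / 3 + (pi / 3 + pi / 3) :> R by field.
have h := cospi R; rewrite e cosD !cosD sinD in h.
have := cos2Dsin2 (pi / 3 : R); move: h c0.
set C := cos _; set S := sin _ => h C0 h2.
have : (C + 1) * (2 * C - 1) ^+ 2 = 0.
  have -> : (C + 1) * (2 * C - 1) ^+ 2 = 
    (C * (C * C - S * S) - S * (S * C + C * S)) + 1 + 3 * C * (C ^+ 2 + S ^+ 2 - 1) by ring.
  by rewrite h h2 subrr mulr0; ring.
move/eqP; rewrite mulf_eq0 sqrf_eq0 => /orP[] /eqP hC; clear h h2; clearbody C; lra.
Qed.

Lemma clog_i : clog ('i : CC R) = 'i * ofR (pi / 2).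
Proof.
have -> : clog ('i : CC R) = (ln (modC ('i : CC R)) +i* carg ('i : CC R))%C by [].
rewrite /carg modCi reCi imCi ln1 ler01 mul0r acos0.
by apply: CC_eqP; rewrite ?reC_iy ?imC_iy.
Qed.

(** The elliptic point of order 3, chosen as a primitive sixth root of unity. *)
Definition omega : CC R := cexp ('i * ofR (pi / 3)).

Lemma reC_omega : reC omega = 1 / 2.
Proof. by rewrite reC_cexp reC_iy imC_iy expR0 mul1r cos_pi3. Qed.

Lemma imC_omega_gt0 : 0 < imC omega.
Proof.
rewrite imC_cexp reC_iy imC_iy expR0 mul1r; apply: sin_gt0_pi.
have := pi_gt0 R; lra.
Qed.

Lemma modC_omega : modC omega = 1.
Proof. by rewrite modC_cexp reC_iy expR0. Qed.

Lemma omega_inv : - omega^-1 + 1 = omega.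
Proof.
apply: CC_eqP; rewrite !(reCD, imCD, reCN, imCN, reCV, imCV) modC_omega expr1n divr1.
  by rewrite reC_omega /=; lra.
by rewrite opprK /= addr0.
Qed.

Lemma clog_omega : clog omega = 'i * ofR (pi / 3).
Proof.
have -> : clog omega = (ln (modC omega) +i* carg omega)%C by [].
rewrite /carg modC_omega reC_omega ltW ?imC_omega_gt0// ln1 divr1 -cos_pi3.
rewrite cosK; last by rewrite in_itv /=; have := pi_gt0 R; lra.
by apply: CC_eqP; rewrite ?reC_iy ?imC_iy.
Qed.

(* As 0^-1 = 0, the constant term is dropped. *)
Definition prim c : nat -> CC R := fun i => i%:R^-1 * c i.

Lemma subexp_prim c : subexp c -> subexp (prim c).
Proof.
apply: (subexp_le (K := 1)) => i; rewrite modCM modCV modC_nat.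
rewrite ler_wpM2r ?modC_ge0//; case: i => [|i]; first by rewrite invr0.
by rewrite invf_le1 ?ltr0n// ler1n.
Qed.

Lemma qs_natM_prim c q : subexp c -> modC q < 1 ->
  qs (fun i => i%:R * prim c i) q = qs c q - c 0%N.
Proof.
move=> hc q1; have := qsP (subexp_natM (subexp_prim hc)) q1 => h1.
apply: (tends_unique h1); have := tendsB (qsP hc q1) (tends_cst (c 0%N)).
apply: (tends_eq (N := 1)) => -[//|n] _.
rewrite /psum !big_ord_recl expr0 mul0r mul0r add0r mulr1 addrAC subrr add0r.
by apply: eq_bigr => i _; rewrite /prim mulVKf// pnatr_eq0.
Qed.

Section Quasi.
Variables (c : nat -> CC R) (phi : CC R -> CC R) (lam : CC R).
Hypothesis phic : qexp c phi.
Hypothesis phiS : forall z, halfplane z -> phi (- z^-1) = z ^+ 2 * phi z + lam * z.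

Let Phi z := tau R * c 0%N * z + qs (prim c) (qpar z).

Let Phi_deriv z : halfplane z -> has_cderiv Phi z (tau R * phi z).
Proof.
move=> zH; have sc := qexp_subexp phic.
have h1 := has_cderivZ (tau R * c 0%N) (has_cderiv_id z).
apply: has_cderiv_eq (has_cderivD h1 (has_cderiv_qs_qpar (subexp_prim sc) zH)) _.
rewrite qs_natM_prim//; last by case/andP: (modC_qpar_lt1 zH).
by rewrite -(qexpE phic zH); ring.
Qed.

(** By the weight 2 law the derivative of Phi(-1/z) is tau phi(z) + tau lam / z; the logarithm
    cancels the last term. *)
Let Psi z := Phi (- z^-1) - Phi z - tau R * lam * clog z.

Let Psi_deriv z : halfplane z -> has_cderiv Psi z 0.
Proof.
move=> zH; have z0 := halfplane_neq0 zH.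
have h1 := has_cderivN (has_cderiv_inv z0).
have h2 := has_cderiv_comp h1 (Phi_deriv (halfplane_negV zH)).
have i0 : imC z != 0 by rewrite gt_eqF.
have h3 := has_cderivZ (tau R * lam) (has_cderiv_clog i0).
apply: has_cderiv_eq (has_cderivB (has_cderivB h2 (Phi_deriv zH)) h3) _.
by rewrite phiS//; field.
Qed.

Let Psi_i : Psi 'i = - (tau R * lam * ('i * ofR (pi / 2))).
Proof.
rewrite /Psi clog_i invCi opprK subrr sub0r //.
Qed.

(* Psi has zero derivative; it is compared at i, which is fixed by z |-> -1/z,
   and at omega, which is mapped to its translate omega - 1. *)
Lemma quasi_c0 : c 0%N = tau R * lam / 12.
Proof.
have iH : halfplane ('i : CC R) by rewrite halfplaneE imCi.
have oH : halfplane omega by rewrite halfplaneE imC_omega_gt0.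
have := deriv0_constH Psi_deriv iH oH; rewrite Psi_i /Psi clog_omega.
have q1 : qpar (- omega^-1) = qpar omega.
  by rewrite -[in RHS]omega_inv -(qparDint _ 1).
rewrite /Phi q1 => h.
have t0 := tau_neq0 R.
have o1 : - omega^-1 = omega - 1 by rewrite -[in RHS]omega_inv addrK.
rewrite o1 in h.
(* The q-expansions agree at omega and omega - 1, so only tau c_0 ((omega - 1) - omega) = - tau c_0
   remains; and i (pi/2 - pi/3) = tau / 12. *)
have h2 : tau R * c 0%N = tau R * (lam * ('i * (ofR (pi / 2) - ofR (pi / 3)))).
  apply/eqP; rewrite -subr_eq0; apply/eqP; move/eqP: h; rewrite -subr_eq0 => /eqP <-; ring.
rewrite (mulfI t0 h2) -ofRN -ofRD.
have -> : pi / 2 - pi / 3 = 2 * pi / 12 :> R by field.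
rewrite /tau ofRM ofRV [ofR 12]ofR_nat; ring.
Qed.

(** If lam = 0 then c_0 = 0 as well, so the primitive is a q-expansion without constant term, and it
    is invariant under z -> -1/z because Psi is constant with Psi(i) = 0. *)
Lemma quasi_lam0 : lam = 0 -> forall i, c i = 0.
Proof.
move=> l0; have c0 : c 0%N = 0 by rewrite quasi_c0 l0 mulr0 mul0r.
have iH : halfplane ('i : CC R) by rewrite halfplaneE imCi.
have sc := qexp_subexp phic.
have pz : forall i, prim c i = 0.
  apply: invariant_qexp_eq0; first exact: subexp_prim.
    by rewrite /prim c0 mulr0.
  have PhiE w : Phi w = qs (prim c) (qpar w) by rewrite /Phi c0 mulr0 mul0r add0r.
  move=> z zH; rewrite -!PhiE; apply/eqP; rewrite -subr_eq0; apply/eqP.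
  have -> : Phi (- z^-1) - Phi z = Psi z by rewrite /Psi l0 mulr0 mul0r subr0.
  by rewrite -(deriv0_constH Psi_deriv iH zH) Psi_i l0 mulr0 mul0r oppr0.
move=> [//|i]; have /eqP := pz i.+1; rewrite /prim mulf_eq0 invr_eq0 pnatr_eq0 /=.
by move/eqP.
Qed.

End Quasi.
End QuasiModular.

(** * Hecke operators on quasimodular forms of weight 2 *)

Section Hecke.

Lemma big_multiples (V : Type) (idx : V) (op : Monoid.com_law idx) p m
    (F : nat -> V) : (0 < p)%N ->
  \big[op/idx]_(i < p * m) (if (p %| i)%N then F i else idx) =
  \big[op/idx]_(i < m) F (p * i)%N.
Proof.
case: p => [//|p] _; elim: m => [|m IH]; first by rewrite muln0 !big_ord0.
rewrite mulnS addnC big_split_ord /= IH [RHS]big_ord_recr; congr (op _ _).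
rewrite big_ord_recl /= addn0 dvdn_mulr// big1 ?Monoid.mulm1// => i _.
rewrite /bump /= add1n dvdn_addr ?dvdn_mulr// gtnNdvd//.
by rewrite ltnS ltn_ord.
Qed.

Definition sigma N := (\sum_(d < N.+1 | d %| N) d)%N.

Lemma sigma_widen N B : (0 < N)%N -> (N < B)%N ->
  sigma N = (\sum_(d < B | (d %| N)%N) d)%N.
Proof.
move=> N0 NB; rewrite /sigma (big_ord_widen_cond B (fun d => (d %| N)%N) id)//.
apply: eq_bigl => d; case h: (d %| N)%N => //=.
by rewrite ltnS dvdn_leq.
Qed.

Lemma sigma0 : sigma 0 = 0%N.
Proof. by rewrite /sigma big_mkcond /= big_ord_recl big_ord0. Qed.

Lemma sigma1 : sigma 1 = 1%N.
Proof. by rewrite /sigma !big_mkcond /= !big_ord_recl big_ord0. Qed.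

(** The divisors of p N that do not divide N are the p d with d | N and p d not dividing N. The
    second term supplies the p d that do divide N, d being then a divisor of N / p; together they
    add up to p sigma(N). *)
Lemma sigma_rec p N : prime p -> (0 < N)%N ->
  (sigma (p * N) + (if p %| N then p * sigma (N %/ p) else 0) = p.+1 * sigma N)%N.
Proof.
move=> pp N0; have p0 := prime_gt0 pp.
have pN0 : (0 < p * N)%N by rewrite muln_gt0 p0.
pose B := (p * N.+1)%N.
have B1 : (p * N < B)%N by rewrite ltn_pmul2l.
have B2 : (N < B)%N by rewrite (leq_trans (ltnSn N))// leq_pmull.
rewrite (sigma_widen pN0 B1) (bigID (fun d : 'I_B => d %| N)%N) /=.
have -> : (\sum_(d < B | (d %| p * N) && (d %| N)) d = sigma N)%N.
  rewrite (sigma_widen N0 B2); apply: eq_bigl => d.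
  by rewrite andb_idl// => /dvdn_mull.
have -> : (\sum_(d < B | (d %| p * N) && ~~ (d %| N)) d =
    \sum_(d < N.+1 | (d %| N) && ~~ (p * d %| N)) p * d)%N.
  transitivity (\sum_(i < p * N.+1)
      if (p %| i)%N then (if (i %| p * N) && ~~ (i %| N) then i : nat else 0) else 0)%N.
    rewrite big_mkcond /=; apply: eq_bigr => d _.
    case: ifP => [/andP[h1 h2]|]; last by rewrite if_same.
    case: ifP => // hpd; case/negP: h2.
    by rewrite -(@Gauss_dvdr _ p)// coprime_sym prime_coprime// hpd.
  rewrite (big_multiples _ N.+1 (fun i => if (i %| p * N) && ~~ (i %| N) then i else 0)%N p0).
  rewrite [RHS]big_mkcond /=; apply: eq_bigr => d _.
  by rewrite dvdn_pmul2l.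
have -> : (if p %| N then p * sigma (N %/ p) else 0)%N =
    (\sum_(d < N.+1 | (d %| N) && (p * d %| N)) p * d)%N.
  case: ifP => [/dvdnP[k Nk]|hpN].
    have k0 : (0 < k)%N by move: N0; rewrite Nk muln_gt0 => /andP[].
    have dv d : ((d %| N) && (p * d %| N) = (d %| k))%N.
      by rewrite Nk [(p * d)%N]mulnC dvdn_pmul2r// andb_idl// => h; rewrite dvdn_mulr.
    have -> : (N %/ p = k)%N by rewrite Nk mulnK.
    rewrite (@sigma_widen k N.+1)//; last by rewrite Nk ltnS leq_pmulr.
    by rewrite big_distrr /=; apply: eq_bigl => d; rewrite dv.
  rewrite big_pred0// => d; apply/negP => /andP[_ h]; move/negP: hpN; apply.
  by apply: dvdn_trans h; rewrite dvdn_mulr.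
rewrite -addnA [X in (_ + X)%N]addnC -(bigID (fun d : 'I_N.+1 => p * d %| N)%N (fun d : 'I_N.+1 => d %| N)%N) /=.
by rewrite -big_distrr /= -/(sigma N) mulSn.
Qed.

Variable R : realType.
Implicit Types (z w q l : CC R) (c : nat -> CC R).

Lemma tends_subseq (u : nat -> CC R) l (f : nat -> nat) :
  (forall M, exists N, forall n, (N <= n)%N -> (M <= f n)%N) -> tends u l ->
  tends (fun n => u (f n)) l.
Proof.
by move=> hf ul e /ul[M hM]; have [N hN] := hf M; exists N => n /hN/hM.
Qed.

Lemma psumS c q n : psum c q n.+1 = psum c q n + c n * q ^+ n.
Proof. exact: big_ord_recr. Qed.

Lemma qparMn n z : qpar (n%:R * z) = qpar z ^+ n.
Proof. by rewrite /qpar mulrCA cexpMn. Qed.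

Lemma halfplaneM n z : (0 < n)%N -> halfplane z -> halfplane (n%:R * z).
Proof.
move=> n0 zH; rewrite halfplaneE -ofR_nat imCM reC_ofR imC_ofR mul0r addr0.
by rewrite mulr_gt0// ltr0n.
Qed.

Lemma halfplane_div n z j : (0 < n)%N -> halfplane z -> halfplane ((z + j%:R) / n%:R).
Proof.
move=> n0 zH; rewrite halfplaneE -!ofR_nat -ofRV mulrC imCM reC_ofR imC_ofR mul0r addr0.
by rewrite imCD imC_ofR addr0 mulr_gt0// invr_gt0 ltr0n.
Qed.

Section Coefficients.
Variables (c : nat -> CC R) (phi : CC R -> CC R) (p : nat).
Hypothesis phic : qexp c phi.
Hypothesis p0 : (0 < p)%N.

Lemma qexp_Vp : qexp (fun N => if (p %| N)%N then c (N %/ p)%N else 0)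
  (fun z => phi (p%:R * z)).
Proof.
move=> z zH; have := phic (halfplaneM p0 zH); rewrite qparMn => h.
(* The number of multiples of p below n, that is n / p rounded up. *)
pose f n := (n %/ p + ~~ (p %| n))%N.
have hf : forall M, exists N, forall n, (N <= n)%N -> (M <= f n)%N.
  move=> M; exists (M * p)%N => n hn; rewrite /f (leq_trans _ (leq_addr _ _))//.
  by rewrite leq_divRL.
have := tends_subseq hf h; apply: (tends_eq (N := 0)) => n _.
elim: n => [|n IH]; first by rewrite /f div0n dvdn0 /psum !big_ord0.
have fS : f n.+1 = (n %/ p).+1.
  rewrite /f divnS// /dvdn.
  have := ltn_pmod n.+1 p0; case: (n.+1 %% p == 0)%N => _ /=; lia.
rewrite psumS -IH fS psumS /f; case: ifP => [pn|pn] /=.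
  by rewrite addn0 -exprM mulnC divnK.
by rewrite mul0r addr0 addn1 psumS.
Qed.

(** The translations by j multiply exp(tau z / p) by all p-th roots of unity; the average keeps the
    exponents divisible by p. *)
Lemma qexp_Up : qexp (fun N => c (p * N)%N)
  (fun z => p%:R^-1 * \sum_(j < p) phi ((z + j%:R) / p%:R)).
Proof.
have pR : p%:R != 0 :> CC R by rewrite pnatr_eq0 -lt0n.
move=> z zH; pose x := qpar (z / p%:R).
have xp : x ^+ p = qpar z by rewrite -qparMn mulrCA mulfV ?mulr1.
have qj j : qpar ((z + j%:R) / p%:R) = x * zeta R p ^+ j.
  rewrite mulrDl qparD; congr (_ * _); rewrite zetaX /qpar; congr cexp.
  by rewrite !ofRM ofRV !ofR_nat; ring.
have h : tends (fun n => p%:R^-1 * \sum_(j < p) psum c (x * zeta R p ^+ j) n)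
   (p%:R^-1 * \sum_(j < p) phi ((z + j%:R) / p%:R)).
  apply: tendsZ; apply: tends_sum => j; rewrite -qj.
  exact: phic (halfplane_div _ p0 zH).
have hf : forall M, exists N, forall n, (N <= n)%N -> (M <= p * n)%N.
  by move=> M; exists M => n hn; rewrite (leq_trans hn)// leq_pmull.
have := tends_subseq hf h; apply: (tends_eq (N := 0)) => n _.
rewrite /psum exchange_big /= mulr_sumr.
transitivity (\sum_(i < p * n) (if (p %| i)%N then c i * x ^+ i else 0)).
  apply: eq_bigr => i _.
  rewrite (eq_bigr (fun j : 'I_p => c i * x ^+ i * zeta R p ^+ (j * i))); last first.
    by move=> j _; rewrite exprMn -exprM mulrA.
  rewrite -mulr_sumr zeta_sum//; case: ifP => _; last by rewrite !mulr0.
  by rewrite mulrCA mulVf// mulr1.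
rewrite (big_multiples _ n (fun i => c i * x ^+ i) p0).
by apply: eq_bigr => i _; rewrite exprM xp.
Qed.

End Coefficients.

Section HeckeOperator.
Variables (c : nat -> CC R) (phi : CC R -> CC R) (lam : CC R).
Hypothesis phic : qexp c phi.
Hypothesis phiG : forall (a b c' d : int) z, a * d - b * c' = 1 -> halfplane z ->
  phi ((a%:~R * z + b%:~R) / (c'%:~R * z + d%:~R)) =
  (c'%:~R * z + d%:~R) ^+ 2 * phi z + lam * c'%:~R * (c'%:~R * z + d%:~R).

Lemma quasi_S z : halfplane z -> phi (- z^-1) = z ^+ 2 * phi z + lam * z.
Proof.
move=> zH; have := @phiG 0 (-1) 1 0 z.
rewrite mul0r mulN1r opprK add0r => /(_ erefl zH).
by rewrite mul0r add0r mulrN1z mul1r addr0 mulN1r mulr1.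
Qed.

(** The classical T_p in weight 2, where the factor p^(weight - 1) of the first term is p. *)
Definition hecke p z : CC R :=
  p%:R * phi (p%:R * z) + p%:R^-1 * (\sum_(j < p) phi ((z + j%:R) / p%:R)).

(** The inversion exchanges p z and z / p, and for j <> 0 it sends (z + j) / p to the term with
    index - 1/j modulo p. The anomalies are lam z from each of the two exchanged terms and (p - 1)
    lam z from the others. *)
Lemma hecke_S p z : prime p -> halfplane z ->
  hecke p (- z^-1) = z ^+ 2 * hecke p z + p.+1%:R * lam * z.
Proof.
move=> pp zH; have p0 := prime_gt0 pp.
have pR : p%:R != 0 :> CC R by rewrite pnatr_eq0 -lt0n.
have z0 := halfplane_neq0 zH.
(* The shape [p.+2] gives ['I_p.+2] the ring structure of the integers modulo the prime. *)
case: p pp p0 pR => [//|[//|p]] pp p0 pR.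
set P : CC R := p.+2%:R in pR *.
have h1 : phi (P * - z^-1) = (z / P) ^+ 2 * phi (z / P) + lam * (z / P).
  rewrite -quasi_S; first by congr phi; rewrite invf_div; ring.
  by have := halfplane_div 0 p0 zH; rewrite addr0.
have h2 : phi (- z^-1 / P) = (P * z) ^+ 2 * phi (P * z) + lam * (P * z).
  rewrite -quasi_S; last exact: halfplaneM.
  by congr phi; rewrite invfM; ring.
pose hh (j : 'I_p.+2) : 'I_p.+2 := - j^-1.
have hinj : injective hh by move=> x y /oppr_inj/invr_inj.
have h3 (j : 'I_p.+2) : j != 0 ->
    phi ((- z^-1 + j%:R) / P) = z ^+ 2 * phi ((z + (hh j)%:R) / P) + lam * P * z.
  move=> j0; have ju : j \is a GRing.unit.
    have := @unitZpE p.+2 j isT; rewrite natr_Zp => ->.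
    by rewrite prime_coprime// gtnNdvd// lt0n.
  have jj : (p.+2 %| j * hh j + 1)%N.
    have : j * hh j + 1 = 0 :> 'I_p.+2.
      by rewrite /hh mulrN divrr; [exact: addNr|exact: ju].
    move/(congr1 val); rewrite /= modnDml /dvdn => e.
    by apply/eqP; rewrite -[RHS]e -modnDmr.
  have [b hb] := dvdnP jj.
  (* The matrix with rows (j, - b) and (P, - hh j) maps (z + hh j) / P to (- 1/z + j) / P, and its
     factor of automorphy there is z. *)
  have det : (j : int) * (- (hh j : nat)%:Z) - (- b%:Z) * p.+2%:Z = 1 by lia.
  have wH := halfplane_div (hh j) p0 zH.
  have := phiG det wH; rewrite -/P.
  have -> : p.+2%:Z%:~R = P by [].
  have -> : P * ((z + (hh j)%:R) / P) + (- (hh j : nat)%:Z)%:~R = z.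
    by rewrite mulrCA mulfV// mulr1 mulrNz addrK.
  move=> <-; congr phi.
  have hbC : (j : nat)%:R * (hh j : nat)%:R + 1 = b%:R * P :> CC R.
    by rewrite /P -!natrM natr1 -hb addn1.
  have -> : (- b%:Z)%:~R = - ((j : nat)%:R * (hh j : nat)%:R + 1) / P :> CC R.
    by rewrite hbC mulNr mulfK// mulrNz.
  have -> : (j : int)%:~R = (j : nat)%:R :> CC R by [].
  by clearbody P; field; rewrite ?pR ?z0.
rewrite /hecke -/P h1 (bigD1 0)//= addr0 h2.
rewrite (eq_bigr _ h3) big_split /= -mulr_sumr sumr_const.
have -> : \sum_(j < p.+2 | j != 0) phi ((z + (hh j)%:R) / P) =
   \sum_(j < p.+2 | j != 0) phi ((z + j%:R) / P).
  rewrite [RHS](reindex_inj hinj) /=; apply: eq_bigl => j.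
  by rewrite /hh oppr_eq0 invr_eq0.
have -> : #|(fun j : 'I_p.+2 => j != 0)| = p.+1.
  have := cardC1 (0 : 'I_p.+2); rewrite card_ord /= => E; rewrite -[RHS]E; apply: eq_card => j.
  by rewrite !inE.
rewrite [in RHS](bigD1 0)//= addr0 -[_ *+ p.+1]mulr_natr.
set S := \sum_(j < _ | _) _.
have -> : p.+3%:R = P + 1 :> CC R by rewrite /P natr1.
have -> : p.+1%:R = P - 1 :> CC R by rewrite /P -[p.+2%:R]natr1 addrK.
by clearbody P; field.
Qed.

(* The anomaly of hecke p phi is (p + 1) times that of phi, so that
   hecke p phi - (p + 1) phi is modular of weight 2, hence zero. *)
Lemma hecke_coef p N : prime p ->
  (if (p %| N)%N then p%:R * c (N %/ p)%N else 0) + c (p * N)%N = p.+1%:R * c N.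
Proof.
move=> pp; have p0 := prime_gt0 pp.
have q1 := qexpD (qexpD (qexpZ p%:R (qexp_Vp phic p0)) (qexp_Up phic p0))
  (qexpZ (- p.+1%:R) phic).
have law z : halfplane z ->
   (hecke p (- z^-1) + - p.+1%:R * phi (- z^-1)) =
     z ^+ 2 * (hecke p z + - p.+1%:R * phi z) + 0 * z.
  by move=> zH; rewrite hecke_S// quasi_S//; ring.
have /= := quasi_lam0 q1 law erefl N.
rewrite mulNr => /eqP; rewrite subr_eq0 => /eqP <-; congr (_ + _).
by case: ifP => // _; rewrite mulr0.
Qed.

(** [hecke_coef] and [sigma_rec] are the same recursion: it determines the value at p M from those
    at M and M / p, where p is the least prime factor of N = p M. *)
Lemma coef_sigma N : (0 < N)%N -> c N = (sigma N)%:R * c 1%N.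
Proof.
elim/ltn_ind: N => N IH N0.
have [N1|N1] := leqP N 1.
  have e : N = 1%N by apply/eqP; rewrite eqn_leq N1.
  by rewrite e sigma1 mul1r.
have pp := pdiv_prime N1; set p := pdiv N in pp.
have p1 := prime_gt1 pp; have p0 := prime_gt0 pp.
have [M NM] : exists M, N = (p * M)%N.
  by exists (N %/ p)%N; rewrite mulnC divnK// pdiv_dvd.
have M0 : (0 < M)%N by move: N0; rewrite NM muln_gt0 => /andP[].
have MN : (M < N)%N by rewrite NM ltn_Pmull.
have h := hecke_coef M pp; have s := sigma_rec pp M0.
rewrite NM.
have -> : c (p * M)%N = p.+1%:R * c M - (if (p %| M)%N then p%:R * c (M %/ p)%N else 0).
  by rewrite -h addrAC subrr add0r.
rewrite (IH M)//.
have /(congr1 (fun n => n%:R : CC R)) := s; rewrite natrD [in RHS]natrM => s'.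
rewrite mulrA -s' mulrDl.
case: ifP => pM; last by rewrite mul0r addr0 subr0.
have [Q MQ] : exists Q, M = (p * Q)%N.
  by exists (M %/ p)%N; rewrite mulnC divnK.
have Q0 : (0 < Q)%N by move: M0; rewrite MQ muln_gt0 => /andP[].
rewrite MQ mulKn// (IH Q)//; last by rewrite (ltn_trans _ MN)// MQ ltn_Pmull.
by rewrite natrM mulrA addrK.
Qed.

End HeckeOperator.
End Hecke.

(** * Lambert series of the divisor sum *)

Section Lambert.

Lemma big_dvd (V : Type) (idx : V) (op : Monoid.com_law idx) d M (G : nat -> V) :
  (0 < d)%N ->
  \big[op/idx]_(N < M.+1 | (d %| N)%N) G N = \big[op/idx]_(n < (M %/ d).+1) G (d * n)%N.
Proof.
move=> d0; have le : (M.+1 <= d * (M %/ d).+1)%N.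
  by rewrite mulnC ltn_ceil.
rewrite (big_ord_widen_cond _ (fun N => d %| N)%N G le) -(big_multiples _ _ G d0).
rewrite big_mkcond /=; apply: eq_bigr => i _; case h: (d %| i)%N => //=.
rewrite ifT//; case/dvdnP: h => k ik; have := ltn_ord i; rewrite ik.
rewrite mulnC ltn_pmul2l// ltnS => kM.
by rewrite ltnS mulnC -leq_divRL.
Qed.

(** Both sides sum d q^(d n) over the pairs with d n <= M. Carrying out the sum over n or over d
    first gives the two forms below; the truncation stays explicit so that remainders can be
    bounded. *)
Lemma sum_sigma (K : comNzRingType) (q : K) M :
  \sum_(N < M.+1) (sigma N)%:R * q ^+ N =
  \sum_(d < M.+1) \sum_(n < M.+1 | (0 < n)%N && (d * n <= M)%N) d%:R * q ^+ (d * n).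
Proof.
transitivity (\sum_(N < M.+1 | (0 < N)%N) \sum_(d < M.+1 | (d %| N)%N) d%:R * q ^+ N).
  rewrite [RHS]big_mkcond /=; apply: eq_bigr => N _; case: ifP => N0.
    by rewrite (@sigma_widen N M.+1)// natr_sum mulr_suml.
  have -> : (N : nat) = 0%N by apply/eqP; rewrite -leqn0 leqNgt N0.
  by rewrite sigma0 mul0r.
rewrite (exchange_big_dep xpredT)//=; apply: eq_bigr => d _.
case: (posnP d) => [d0|d0].
  rewrite d0 big1 ?big1// => i _; by rewrite mul0r.
rewrite (eq_bigl (fun N : 'I_M.+1 => (d %| N)%N && (0 < N)%N)); last by move=> N; rewrite andbC.
rewrite big_mkcondr /= (big_dvd _ M (fun N => if (0 < N)%N then d%:R * q ^+ N else 0) d0).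
have le : ((M %/ d).+1 <= M.+1)%N by rewrite ltnS leq_div.
rewrite (big_ord_widen_cond _ xpredT (fun n => if (0 < d * n)%N then d%:R * q ^+ (d * n) else 0) le).
rewrite big_mkcond [RHS]big_mkcond; apply: eq_bigr => n _ /=.
rewrite muln_gt0 d0 ltnS leq_divRL// [(n * d)%N]mulnC /=.
by case: (0 < n)%N; case: (d * n <= M)%N.
Qed.

Lemma sum_sigma_geom (K : comNzRingType) (q : K) M :
  \sum_(N < M.+1) (sigma N)%:R * q ^+ N =
  \sum_(d < M) d.+1%:R * \sum_(n < (M %/ d.+1)) (q ^+ d.+1) ^+ n.+1.
Proof.
rewrite sum_sigma big_ord_recl big1 ?add0r; last by move=> i _; rewrite mul0r.
apply: eq_bigr => d _; rewrite lift0 mulr_sumr.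
have le : ((M %/ d.+1) <= M)%N by rewrite leq_div.
rewrite (big_ord_widen_cond _ xpredT (fun n => d.+1%:R * (q ^+ d.+1) ^+ n.+1) le).
rewrite big_mkcond big_ord_recl /= add0r [RHS]big_mkcond /=; apply: eq_bigr => n _.
by rewrite /bump /= add1n exprM leq_divRL// [(_ * d.+1)%N]mulnC.
Qed.

Lemma sum_sigma_deriv (K : comNzRingType) (q : K) M :
  \sum_(N < M.+1) (sigma N)%:R * q ^+ N =
  \sum_(d < M) \sum_(n < (M %/ d.+1).+1) n%:R * (q ^+ d.+1) ^+ n.
Proof.
rewrite sum_sigma (exchange_big_dep (fun n : 'I_M.+1 => 0 < n)%N)/=; last by move=> d n _ /andP[].
rewrite big_mkcond big_ord_recl /= add0r; apply: eq_bigr => d _; rewrite /bump /= add1n.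
have le : ((M %/ d.+1).+1 <= M.+1)%N by rewrite ltnS leq_div.
rewrite (big_ord_widen_cond _ xpredT (fun n => n%:R * (q ^+ d.+1) ^+ n) le).
apply: eq_big => n; first by rewrite /= ltnS leq_divRL.
by move=> _; rewrite -exprM mulnC.
Qed.

End Lambert.

(** * Real Lambert series as x tends to 1 *)

Section LambertBounds.
Variable R : realType.
Implicit Types (x u : R).

Lemma sum_natM_geom u m : u != 1 ->
  \sum_(n < m.+1) n%:R * u ^+ n =
  u / (1 - u) ^+ 2 - u ^+ m.+1 * (m.+1%:R - m%:R * u) / (1 - u) ^+ 2.
Proof.
move=> u1; have h : 1 - u != 0 by rewrite subr_eq0 eq_sym.
elim: m => [|m IH].
  by rewrite big_ord_recr big_ord0 /= mul0r add0r expr1 mulr1n mul0r subr0 mulr1 subrr.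
rewrite big_ord_recr /= IH -[m.+2%:R]natr1 -[m.+1%:R]natr1 !exprS.
by field.
Qed.

(** The sum of sigma(N) x^N, grouped by the cofactor n of the divisor d, with the sum of d x^(d n)
    over all d in closed form. *)
Definition lambert2 x M := \sum_(d < M) x ^+ d.+1 / (1 - x ^+ d.+1) ^+ 2.

Lemma exprS_le_base x n : 0 < x < 1 -> x ^+ n.+1 <= x.
Proof.
move=> /andP[x0 x1]; rewrite exprS ler_piMr ?(ltW x0)//.
by rewrite exprn_ile1 // ltW.
Qed.

Lemma sum_sigma_lambert2 x M : 0 < x < 1 ->
  0 <= lambert2 x M - \sum_(N < M.+1) (sigma N)%:R * x ^+ N
    <= M%:R * (M.+1%:R * x ^+ M.+1) / (1 - x) ^+ 2.
Proof.
move=> x01; have [x0 x1] := andP x01.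
rewrite sum_sigma_deriv /lambert2 -sumrB.
have t (d : 'I_M) : 0 <= x ^+ d.+1 / (1 - x ^+ d.+1) ^+ 2 -
     \sum_(n < (M %/ d.+1).+1) n%:R * (x ^+ d.+1) ^+ n <=
    M.+1%:R * x ^+ M.+1 / (1 - x) ^+ 2.
  set u := x ^+ d.+1; have ux : u <= x := exprS_le_base d x01.
  have u0 : 0 < u by rewrite exprn_gt0.
  have u1 : u != 1 by rewrite lt_eqF// (le_lt_trans ux).
  set m := (M %/ d.+1)%N.
  rewrite sum_natM_geom// opprB addrC subrK.
  have ux2 : (1 - x) ^+ 2 <= (1 - u) ^+ 2.
    by rewrite lerXn2r ?nnegrE ?subr_ge0 ?(ltW x1) ?lerB// ltW// (le_lt_trans ux).
  have xp : 0 < (1 - x) ^+ 2 by rewrite exprn_gt0// subr_gt0.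
  have up : 0 < (1 - u) ^+ 2 := lt_le_trans xp ux2.
  have mu : 0 <= m.+1%:R - m%:R * u.
    rewrite subr_ge0 (@le_trans _ _ m%:R)// ?ler_nat// ler_piMr//.
    by rewrite ltW// (le_lt_trans ux).
  have um0 : 0 <= u ^+ m.+1 by rewrite exprn_ge0// ltW.
  have iu : 0 <= ((1 - u) ^+ 2)^-1 by rewrite invr_ge0 ltW.
  have nu : 0 <= u ^+ m.+1 * (m.+1%:R - m%:R * u) by rewrite mulr_ge0.
  rewrite (divr_ge0 nu (ltW up)) /=.
  apply: ler_pM => //; last by rewrite lef_pV2.
  rewrite mulrC; apply: ler_pM => //.
    apply: (@le_trans _ _ m.+1%:R); first by rewrite gerBl mulr_ge0// ltW.
    by rewrite ler_nat ltnS leq_div.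
  rewrite /u -exprM ler_wiXn2l ?(ltW x0) ?(ltW x1)//.
  by rewrite mulnC ltn_ceil.
apply/andP; split; first by apply: sumr_ge0 => d _; case/andP: (t d).
apply: (@le_trans _ _ (\sum_(d < M) M.+1%:R * x ^+ M.+1 / (1 - x) ^+ 2)).
  by apply: ler_sum => d _; case/andP: (t d).
by rewrite sumr_const card_ord -[_ *+ M]mulr_natl mulrA.
Qed.

(** u / (1 - u)^2 - 4 u^2 / (1 - u^2)^2 = u / (1 + u)^2: the double pole at u = 1, which would
    dominate as x -> 1, cancels. *)
Lemma lambert2_diff x M : 0 < x < 1 ->
  lambert2 x M - 4 * lambert2 (x ^+ 2) M = \sum_(d < M) x ^+ d.+1 / (1 + x ^+ d.+1) ^+ 2.
Proof.
move=> x01; have [x0 x1] := andP x01.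
rewrite /lambert2 mulr_sumr -sumrB; apply: eq_bigr => d _.
rewrite -exprM mulnC exprM; set u := x ^+ d.+1.
have ux : u <= x := exprS_le_base d x01.
have u0 : 0 < u by rewrite exprn_gt0.
have h1 : 1 - u != 0 by rewrite gt_eqF// subr_gt0 (le_lt_trans ux).
have h2 : 1 + u != 0 by rewrite gt_eqF// addr_gt0.
have -> : 1 - u ^+ 2 = (1 - u) * (1 + u) by ring.
by field; rewrite h1 h2.
Qed.

(* Both bounds telescope: (1 - x) x^d / ((1 + x^d) (1 + x^(d+1))) is the
   difference of consecutive values of 1 / (1 + x^d). *)
Lemma cosh_sum_bounds x M : 0 < x < 1 ->
  x * (1 / 2 - x ^+ M) <= (1 - x) * \sum_(d < M) x ^+ d.+1 / (1 + x ^+ d.+1) ^+ 2 <= 1 / 2.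
Proof.
move=> x01; have [x0 x1] := andP x01.
pose t n := (1 + x ^+ n)^-1.
have p n : 0 < x ^+ n by rewrite exprn_gt0.
have q n : 0 < 1 + x ^+ n by rewrite addr_gt0.
have mono n : x ^+ n.+1 <= x ^+ n by rewrite exprS ler_piMl ?(ltW x1) ?(ltW (p n)).
have dt n : t n.+1 - t n = (1 - x) * x ^+ n / ((1 + x ^+ n) * (1 + x ^+ n.+1)).
  by rewrite /t; have := q n; have := q n.+1; rewrite exprS => a b; field; rewrite !gt_eqF.
have tel F n : \sum_(d < n) (F d.+1 - F d) = F n - F 0%N :> R.
  elim: n => [|n IH]; first by rewrite big_ord0 subrr.
  by rewrite big_ord_recr /= IH addrC addrA subrK.
rewrite mulr_sumr; apply/andP; split.
  apply: (@le_trans _ _ (\sum_(d < M) x * (t d.+1 - t d))).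
    rewrite -mulr_sumr tel ler_pM2l// /t expr0.
    have -> : (1 + 1)^-1 = 1 / 2 :> R by field.
    have : 1 - x ^+ M <= (1 + x ^+ M)^-1.
      by rewrite -[leRHS]mul1r ler_pdivlMr//; have := p M; nra.
    lra.
  apply: ler_sum => d _; rewrite dt !mulrA [x * _]mulrC -!mulrA ler_pM2l ?subr_gt0//.
  rewrite mulrA -exprS ler_pM2l// lef_pV2 ?posrE ?mulr_gt0 ?exprn_gt0//.
  by rewrite expr2 ler_pM2r// lerD2l mono.
apply: (@le_trans _ _ (\sum_(d < M) (t d.+2 - t d.+1))).
  apply: ler_sum => d _; rewrite dt -mulrA ler_pM2l ?subr_gt0// ler_pM2l//.
  rewrite lef_pV2 ?posrE ?mulr_gt0 ?exprn_gt0//.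
  by rewrite expr2 ler_pM2l// lerD2l mono.
rewrite (tel (fun d => t d.+1)) /t expr1.
have : (1 + x ^+ M.+1)^-1 <= 1 by rewrite invf_le1// lerDl ltW.
have : 1 / 2 <= (1 + x)^-1 by rewrite mul1r lef_pV2 ?posrE//; lra.
lra.
Qed.

End LambertBounds.

(** * Behaviour along the imaginary axis near 0, and the coefficient c_1 *)

Section Asymptotics.
Variable R : realType.
Implicit Types (z w q l : CC R) (c : nat -> CC R) (x y : R).

Lemma subexp_sqr : subexp (fun i => i%:R * (i%:R * (1 : CC R))).
Proof.
apply: subexp_natM; apply: subexp_natM => r /andP[r0 r1]; exists 1 => i.
by rewrite modC1 mul1r exprn_ile1 // ltW.
Qed.

Lemma sqr_geom_small x e : 0 < x < 1 -> 0 < e -> exists N, forall n, (N <= n)%N ->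
  n%:R * (n.+1%:R * x ^+ n.+1) < e.
Proof.
move=> x01 e0.
have [|B [th [B0 t01 hB]]] := subexp_geom (rho := x) subexp_sqr.
  by case/andP: x01 => /ltW -> ->.
have [N hN] := geom_small B t01 e0; exists N => n Nn.
apply: le_lt_trans (hN n.+1 (leqW Nn)); apply: le_trans (hB n.+1).
rewrite mulr1 modCM modC_nat -mulrA ler_wpM2r ?ler_nat//.
by rewrite mulr_ge0// exprn_ge0// ltW//; case/andP: x01.
Qed.

(** By [cosh_sum_bounds] the main term lies between x / 2 and 1 / 2 up to x^(M+1), whence the error
    (1 - x) / 2. The truncation errors are kept below e / 9 each, with weight 4 for the series in
    x^2. *)
Lemma sum_sigma_diff_bounds x e : 0 < x < 1 -> 0 < e -> exists N, forall M, (N <= M)%N ->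
  `|(1 - x) * (\sum_(i < M.+1) (sigma i)%:R * x ^+ i
     - 4 * \sum_(i < M.+1) (sigma i)%:R * (x ^+ 2) ^+ i) - 1 / 2| <= (1 - x) / 2 + e.
Proof.
move=> x01 e0; have [x0 x1] := andP x01.
have x201 : 0 < x ^+ 2 < 1 by rewrite exprn_gt0// exprn_ilt1 // ltW.
have y0 : 0 < (1 - x) ^+ 2 by rewrite exprn_gt0 // subr_gt0.
have z0 : 0 < (1 - x ^+ 2) ^+ 2 by rewrite exprn_gt0 // subr_gt0; case/andP: x201.
have [N1 h1] := sqr_geom_small x01 (mulr_gt0 (divr_gt0 e0 (ltr0Sn _ 8)) y0).
have [N2 h2] := sqr_geom_small x201 (mulr_gt0 (divr_gt0 e0 (ltr0Sn _ 8)) z0).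
have [|N3 h3] := @geom_small R 1 x (e / 9) _ (divr_gt0 e0 (ltr0Sn _ 8)).
  by rewrite ltW.
exists (maxn N1 (maxn N2 N3)) => M; rewrite !geq_max => /and3P[/h1 a1 /h2 a2 /h3 a3].
have := sum_sigma_lambert2 M x01; have := sum_sigma_lambert2 M x201.
have := cosh_sum_bounds M x01; have := lambert2_diff M x01.
set S2 := \sum_(N < M.+1) _ * (x ^+ 2) ^+ _; set S1 := \sum_(N < M.+1) _; set A := \sum_(d < M) _.
set L1 := lambert2 x M; set L2 := lambert2 (x ^+ 2) M.
move=> LA /andP[b1 b2] /andP[d1 d2] /andP[f1 f2].
move: d2; rewrite ler_pdivlMr// => d2; move: f2; rewrite ler_pdivlMr// => f2.
have d2' : L2 - S2 < e / 9 by rewrite -(ltr_pM2r z0); exact: le_lt_trans d2 a2.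
have f2' : L1 - S1 < e / 9 by rewrite -(ltr_pM2r y0); exact: le_lt_trans f2 a1.
rewrite mul1r in a3.
have xa : x * x ^+ M <= e / 9.
  by rewrite (le_trans _ (ltW a3))// ler_piMl ?exprn_ge0 // ltW.
have E : S1 - 4 * S2 = A - (L1 - S1) + 4 * (L2 - S2) by rewrite -LA; ring.
rewrite E; have w1 : (1 - x) * (L1 - S1) <= e / 9.
  by rewrite (le_trans _ (ltW f2'))// ler_piMl// gerBl ltW.
have w2 : (1 - x) * (L2 - S2) <= e / 9.
  by rewrite (le_trans _ (ltW d2'))// ler_piMl// gerBl ltW.
have w3 : 0 <= (1 - x) * (L1 - S1) by rewrite mulr_ge0// subr_ge0 ltW.
have w4 : 0 <= (1 - x) * (L2 - S2) by rewrite mulr_ge0// subr_ge0 ltW.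
have -> : (1 - x) * (A - (L1 - S1) + 4 * (L2 - S2)) - 1 / 2 =
  (1 - x) * A - 1 / 2 - (1 - x) * (L1 - S1) + 4 * ((1 - x) * (L2 - S2)) by ring.
move: b1 b2; rewrite mulrBr; set B := (1 - x) * A.
move: w1 w2 w3 w4; set W1 := _ * (L1 - S1); set W2 := _ * (L2 - S2).
move: xa; set X := x * _ ^+ _ => *; rewrite ler_norml; lra.
Qed.

(** Decay at the cusp: every term after c_0 contains a factor q. *)
Lemma qs_head_bound c rho : subexp c -> 0 < rho < 1 -> exists K : R, 0 <= K /\
  forall q, modC q <= rho -> modC (qs c q - c 0%N) <= K * modC q.
Proof.
move=> hc /andP[r0 r1]; have r01 : 0 <= rho < 1 by rewrite ltW.
have [B [th [B0 t01 hB]]] := subexp_geom hc r01.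
have t10 : 0 < 1 - th by case/andP: t01 => _ ?; rewrite subr_gt0.
exists (B * th / (1 - th) / rho); split.
  by rewrite !mulr_ge0 ?invr_ge0 ?(ltW r0) ?(ltW t10)//; case/andP: t01.
move=> q qr; have q1 : modC q < 1 by rewrite (le_lt_trans qr).
apply: (tends_le (N := 1) (qsP hc q1)) => -[//|n] _.
rewrite /psum big_ord_recl expr0 mulr1 addrAC subrr add0r.
apply: (le_trans (modC_sum _ _ _)).
apply: (@le_trans _ _ (\sum_(i < n) (modC q / rho) * (B * th ^+ i.+1))).
  apply: ler_sum => i _; rewrite mulrAC ler_pdivlMr// modCM modCX.
  rewrite lift0 exprS mulrCA -mulrA ler_wpM2l ?modC_ge0//.
  rewrite (le_trans _ (hB i.+1))// exprS -mulrA ler_wpM2l ?modC_ge0// mulrC ler_wpM2l ?(ltW r0)//.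
  by rewrite lerXn2r ?nnegrE ?modC_ge0// ltW.
rewrite -mulr_sumr; have := sum_geom_le 1 n B0 t01.
rewrite big_add1 add1n /= big_mkord expr1 => h.
have m0 : 0 <= modC q / rho by rewrite divr_ge0 ?modC_ge0// ltW.
apply: (le_trans (ler_wpM2l m0 h)).
by rewrite [leLHS](_ : _ = B * th / (1 - th) / rho * modC q)//; ring.
Qed.

Section C1.
Variables (c : nat -> CC R) (phi : CC R -> CC R) (lam : CC R).
Hypothesis phic : qexp c phi.
Hypothesis phiS : forall z, halfplane z -> phi (- z^-1) = z ^+ 2 * phi z + lam * z.
Hypothesis csigma : forall N, (0 < N)%N -> c N = (sigma N)%:R * c 1%N.

Let iyH y : 0 < y -> halfplane (iy y).
Proof. by rewrite halfplaneE imC_iy. Qed.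

Let qpar_iy y : qpar (iy y) = ofR (expR (- (2 * pi * y))).
Proof.
rewrite -cexp_ofR /qpar; congr cexp.
rewrite /iy mulrA -[_ * 'i * 'i]mulrA -expr2 sqrCi mulrN1 mulNr -ofRM.
by rewrite -ofRN.
Qed.

Let psum_sigma x M : psum c (ofR x) M.+1 =
  c 0%N + c 1%N * ofR (\sum_(i < M.+1) (sigma i)%:R * x ^+ i).
Proof.
rewrite /psum !big_ord_recl /= expr0 mulr1 sigma0 mul0r add0r; congr (_ + _).
rewrite (big_morph _ (@ofRD R) (@ofR0 R)) mulr_sumr; apply: eq_bigr => i _.
rewrite csigma ?lift0// ofRM ofRX ofR_nat; ring.
Qed.

(** The weight 4 = 2^2 makes the terms of order y^-2 of phi(iy) and phi(2iy) cancel as y -> 0. *)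
Let Delta y := phi (iy y) - 4 * phi (iy (2 * y)).

(** The constant terms c_0 - 4 c_0 are compensated by 3 c_0, which leaves c_1 times the difference
    of the two divisor series at x and x^2. *)
Let Delta_lambert y x : 0 < y -> x = expR (- (2 * pi * y)) ->
  modC (ofR (1 - x) * (Delta y + 3 * c 0%N) - c 1%N / 2) <= modC (c 1%N) * ((1 - x) / 2).
Proof.
move=> y0 xE; have p0 := pi_gt0 R.
have y20 : 0 < 2 * y by rewrite mulr_gt0.
have x01 : 0 < x < 1.
  by rewrite xE expR_gt0 -[X in _ < X]expR0 ltr_expR oppr_lt0 !mulr_gt0.
have t1 := phic (iyH y0); have t2 := phic (iyH y20).
have x2 : expR (- (2 * pi * (2 * y))) = x ^+ 2 :> R.
  by rewrite xE expr2 -expRD; congr expR; ring.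
rewrite qpar_iy -xE in t1; rewrite qpar_iy x2 in t2.
have T := tendsB (tendsZ (ofR (1 - x)) (tendsD (tendsB t1 (tendsZ 4 t2))
  (tends_cst (3 * c 0%N)))) (tends_cst (c 1%N / 2)).
apply/ler_addgt0Pr => e e0.
have C0 : 0 < modC (c 1%N) + 1 by rewrite ltr_wpDl ?modC_ge0.
have [N hN] := sum_sigma_diff_bounds x01 (divr_gt0 e0 C0).
rewrite -[X in modC X]subr0.
apply: (tends_le (N := N.+1) T) => -[//|M] NM; rewrite subr0 !psum_sigma.
have := hN M NM; set S1 := \sum_(i < M.+1) _; set S2 := \sum_(i < M.+1) _ => h.
have -> : ofR (1 - x) * (c 0%N + c 1%N * ofR S1 - 4 * (c 0%N + c 1%N * ofR S2) + 3 * c 0%N) -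
   c 1%N / 2 = c 1%N * ofR ((1 - x) * (S1 - 4 * S2) - 1 / 2).
  rewrite [ofR (_ - 1 / 2)]ofRD [ofR (- (1 / 2))]ofRN [ofR (1 / 2)]ofRM [ofR 2^-1]ofRV.
  rewrite [ofR 2]ofR_nat [ofR 1]ofR1 [ofR (_ * (S1 - _))]ofRM.
  by rewrite [ofR (S1 - _)]ofRD [ofR (- (4 * _))]ofRN [ofR (4 * _)]ofRM [ofR 4]ofR_nat; ring.
rewrite modCM modC_ofR (le_trans (ler_wpM2l (modC_ge0 _) h))// mulrDr lerD2l.
rewrite mulrA ler_pdivrMr// mulrC ler_wpM2l ?(ltW e0)// lerDl //.
Qed.

Let Delta_modular y : 0 < y -> ofR y * Delta y =
   - ('i * lam) - (phi (iy y^-1) - phi (iy (2 * y)^-1)) / ofR y.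
Proof.
move=> y0; have y20 : 0 < 2 * y by rewrite mulr_gt0.
have inv u : - (iy u)^-1 = iy u^-1 :> CC R.
  by rewrite /iy invfM invCi mulNr opprK ofRV.
have h1 := phiS (iyH y0); have h2 := phiS (iyH y20); rewrite !inv in h1 h2.
rewrite h1 h2 /Delta /iy.
have yn0 : ofR y != 0 by rewrite ofR_eq0 gt_eqF.
rewrite [ofR (2 * y)]ofRM [ofR 2]ofR_nat !exprMn sqrCi.
by field.
Qed.

(* As y -> 0+, y Delta(y) tends to - i lam by the transformation law, while
   (1 - x) (Delta(y) + 3 c_0) tends to c_1 / 2 by the Lambert series, where
   x = exp(- 2 pi y). *)
Lemma quasi_c1 : c 1%N = - (2 * (tau R * lam)).
Proof.
have p0 := pi_gt0 R.
have sc := qexp_subexp phic.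
have [|K [K0 hK]] := qs_head_bound (rho := 1 / 3) sc; first by lra.
have small y : 0 < y < 1 / 2 ->
    modC (phi (iy y^-1) - phi (iy (2 * y)^-1)) <= 2 * K * (y * y).
  move=> /andP[y0 y2].
  have bd Y : 1 / 2 <= Y -> modC (phi (iy Y) - c 0%N) <= K * expR (- (2 * pi * Y)).
    move=> hY; have YH : halfplane (iy Y) by rewrite halfplaneE imC_iy; lra.
    rewrite (qexpE phic YH) -[Y in X in _ <= X]imC_iy -modC_qpar; apply: hK.
    by apply: qpar_le; rewrite imC_iy.
  have inv2 : 1 <= (2 * y)^-1 by rewrite invf_ge1 ?mulr_gt0//; lra.
  have inv1 : (2 * y)^-1 <= y^-1.
    by rewrite lef_pV2 ?posrE ?mulr_gt0//; lra.
  (* exp(- 2 pi Y) is the square of exp(- pi Y), and exp(pi Y) >= pi Y >= 2 Y >= 1 / y. *)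
  have expb Y : (2 * y)^-1 <= Y -> expR (- (2 * pi * Y)) <= y * y.
    move=> hY; rewrite expRN -[leRHS]invrK lef_pV2 ?posrE ?expR_gt0 ?invr_gt0 ?mulr_gt0//.
    have -> : 2 * pi * Y = pi * Y + pi * Y by ring.
    rewrite expRD invfM.
    have pY : y^-1 <= expR (pi * Y).
      have h1 : y^-1 <= pi * Y.
        rewrite (@le_trans _ _ (2 * (2 * y)^-1))//.
          by rewrite invfM mulrA mulfV ?mul1r.
        by apply: ler_pM => //; [rewrite invr_ge0 mulr_ge0 // ltW|exact: pi_ge2].
      by have := expR_ge1Dx (pi * Y); lra.
    by apply: ler_pM => //; rewrite invr_ge0 ltW.
  have -> : phi (iy y^-1) - phi (iy (2 * y)^-1) =
     (phi (iy y^-1) - c 0%N) - (phi (iy (2 * y)^-1) - c 0%N) by ring.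
  rewrite (le_trans (modCB _ _))//.
  have -> : 2 * K * (y * y) = K * (y * y) + K * (y * y) by ring.
  apply: lerD.
    apply: (le_trans (bd _ _)); first by lra.
    by rewrite ler_wpM2l// expb.
  apply: (le_trans (bd _ _)); first by lra.
  by rewrite ler_wpM2l// expb.
(* The four summands are the constants in the estimates [e1] to [e4]. *)
pose C := modC (c 1%N) * pi + 3 * modC (c 0%N) * (2 * pi) + 2 * K * (2 * pi)
   + modC lam * (4 * pi * pi).
have C0 : 0 <= C.
  by rewrite !addr_ge0// !mulr_ge0 ?modC_ge0// ltW.
have key y : 0 < y < 1 / 2 -> modC (c 1%N / 2 + tau R * lam) <= C * y.
  move=> y02; have /andP[y0 y2] := y02.
  pose x : R := expR (- (2 * pi * y)); have hl := Delta_lambert y0 (erefl x).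
  have t0 : 0 < 2 * pi * y by rewrite !mulr_gt0.
  have x1 : 1 - x <= 2 * pi * y by have := expR_ge1Dx (- (2 * pi * y)); rewrite -/x; lra.
  have x0 : 0 <= 1 - x by rewrite subr_ge0 -expR0 ler_expR oppr_le0 ltW.
  (* With t = 2 pi y: x = exp(- t) <= 1 / (1 + t) <= 1 - t + t^2. *)
  have x2 : 2 * pi * y - (2 * pi * y) ^+ 2 <= 1 - x.
    have : x <= (1 + 2 * pi * y)^-1.
      by rewrite /x expRN lef_pV2 ?posrE ?expR_gt0 ?expR_ge1Dx// addr_gt0.
    have : (1 + 2 * pi * y)^-1 <= 1 - 2 * pi * y + (2 * pi * y) ^+ 2.
      move: t0; set t := 2 * pi * y => t0.
      rewrite -[leLHS]mul1r ler_pdivrMr ?addr_gt0// -subr_ge0.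
      have -> : (1 - t + t ^+ 2) * (1 + t) - 1 = t ^+ 3 by ring.
      by rewrite exprn_ge0 // ltW.
    lra.
  have yn0 : ofR y != 0 by rewrite ofR_eq0 gt_eqF.
  (* This quotient stands in for 2 pi, from which it differs by at most 4 pi^2 y; it links the
     factor 1 - x of the Lambert side to the factor y of the modular side. *)
  set s := (1 - x) / y; have sy : 1 - x = s * y by rewrite /s mulfVK// gt_eqF.
  have s1 : s <= 2 * pi by rewrite /s ler_pdivrMr.
  have s0 : 0 <= s by rewrite divr_ge0// ltW.
  have s2 : `|s - 2 * pi| <= 4 * pi * pi * y.
    rewrite ler_norml; apply/andP; split; last first.
      have : 0 <= 4 * pi * pi * y by rewrite !mulr_ge0// ltW.
      by lra.
    rewrite -(ler_pM2r y0) mulrBl -sy.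
    by move: x2; rewrite expr2; lra.
  have -> : c 1%N / 2 + tau R * lam =
     - (ofR (1 - x) * (Delta y + 3 * c 0%N) - c 1%N / 2) + ofR (1 - x) * (3 * c 0%N)
     - ofR s * ((phi (iy y^-1) - phi (iy (2 * y)^-1)) / ofR y) - 'i * lam * ofR (s - 2 * pi).
    have := Delta_modular y0; rewrite sy [ofR (s * y)]ofRM => hD.
    have -> : ofR s * ofR y * (Delta y + 3 * c 0%N) =
      ofR s * (ofR y * Delta y) + ofR s * ofR y * (3 * c 0%N) by ring.
    by rewrite hD /tau ofRD ofRN; ring.
  have e1 : modC (- (ofR (1 - x) * (Delta y + 3 * c 0%N) - c 1%N / 2)) <=
      modC (c 1%N) * pi * y.
    rewrite modCN (le_trans hl)// -mulrA ler_wpM2l ?modC_ge0//; lra.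
  have e2 : modC (ofR (1 - x) * (3 * c 0%N)) <= 3 * modC (c 0%N) * (2 * pi) * y.
    rewrite !modCM modC_ofR modC_nat (ger0_norm x0) mulrC -[leRHS]mulrA.
    by rewrite ler_wpM2l // mulr_ge0 ?modC_ge0.
  have e3 : modC (ofR s * ((phi (iy y^-1) - phi (iy (2 * y)^-1)) / ofR y)) <=
      2 * K * (2 * pi) * y.
    rewrite !modCM modCV !modC_ofR (ger0_norm s0) (ger0_norm (ltW y0)) mulrA ler_pdivrMr//.
    have -> : 2 * K * (2 * pi) * y * y = 2 * pi * (2 * K * (y * y)) by ring.
    by apply: ler_pM => //; [exact: modC_ge0|exact: small].
  have e4 : modC ('i * lam * ofR (s - 2 * pi)) <= modC lam * (4 * pi * pi) * y.
    by rewrite !modCM modCi mul1r modC_ofR -mulrA ler_wpM2l ?modC_ge0.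
  rewrite /C [leRHS]mulrDl [X in _ <= X + _]mulrDl [X in _ <= X + _ + _]mulrDl.
  apply: le_trans (modCB _ _) (lerD _ e4).
  apply: le_trans (modCB _ _) (lerD _ e3).
  exact: le_trans (modCD _ _) (lerD e1 e2).
have z : modC (c 1%N / 2 + tau R * lam) = 0.
  apply/eqP; rewrite eq_le modC_ge0 andbT; apply/ler_addgt0Pr => e e0; rewrite add0r.
  have C1 : 0 < C + 1 by rewrite ltr_wpDl.
  have m : 0 < Num.min (1 / 3) (e / (C + 1)) by rewrite lt_min !divr_gt0.
  apply: (le_trans (key (Num.min (1 / 3) (e / (C + 1))) _)).
    by rewrite m /= gt_min; apply/orP; left; lra.
  apply: (@le_trans _ _ (C * (e / (C + 1)))).
    by rewrite ler_wpM2l// ge_min lexx orbT.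
  by rewrite mulrA ler_pdivrMr// mulrC ler_wpM2l ?(ltW e0)// lerDl.
move/eqP: z; rewrite modC_eq0 addr_eq0 => /eqP h.
by rewrite -[c 1%N](divfK (_ : 2 != 0 :> CC R)) ?pnatr_eq0// h; ring.
Qed.

End C1.
End Asymptotics.

(** * Identification with the Eisenstein series of weight 2 *)

Section E2Series.
Variable R : realType.
Implicit Types (z w q l : CC R).

Lemma sigma_le N : (sigma N <= N * N)%N.
Proof.
rewrite /sigma big_mkcond big_ord_recl /= if_same add0n.
have -> : (N * N = \sum_(i < N) N)%N by rewrite sum_nat_const card_ord.
apply: leq_sum => i _; case: ifP => // _; exact: ltn_ord.
Qed.

Lemma subexp_sigma : subexp (fun N => (sigma N)%:R : CC R).
Proof.
apply: (subexp_le (K := 1)) (@subexp_sqr R) => i.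
by rewrite mul1r mulr1 -natrM !modC_nat ler_nat sigma_le.
Qed.

Definition lambert1 q M : CC R := \sum_(d < M) d.+1%:R * q ^+ d.+1 / (1 - q ^+ d.+1).

(** The partial sums of the Lambert series and of the power series differ by M geometric tails, each
    at most (M + 1) r^(M+1) / (1 - r). *)
Lemma tends_lambert1 q : modC q < 1 -> tends (lambert1 q) (qs (fun N => (sigma N)%:R) q).
Proof.
move=> q1; have [->|q_neq0] := eqVneq q 0.
  have -> : qs (fun N => (sigma N)%:R : CC R) 0 = 0.
    apply: (tends_unique (qsP subexp_sigma _)); first by rewrite modC0.
    have := @tends_cst R 0; apply: (tends_eq (N := 0)) => n _.
    rewrite /psum; case: n => [|n]; first by rewrite big_ord0.
    rewrite big_ord_recl big1 ?addr0; last by move=> i _; rewrite lift0 expr0n mulr0.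
    by rewrite /= sigma0 mul0r.
  have := @tends_cst R 0; apply: (tends_eq (N := 0)) => n _.
  by rewrite /lambert1 big1// => i _; rewrite expr0n /= mulr0 mul0r.
have q0 : 0 < modC q by rewrite modC_gt0.
set r := modC q in q0 q1; have r01 : 0 < r < 1 by rewrite q0.
have r1 : 0 < 1 - r by rewrite subr_gt0.
have T := tends_sub (fun n => leqnSn n) (qsP subexp_sigma q1).
move=> e e0; have e2 : 0 < e / 2 by rewrite divr_gt0.
have [N1 h1] := T _ e2.
have [N2 h2] := sqr_geom_small r01 (mulr_gt0 e2 r1).
exists (maxn N1 N2) => M; rewrite geq_max => /andP[/h1 a1 /h2 a2].
rewrite -(subrK (psum (fun N => (sigma N)%:R) q M.+1) (lambert1 q M)) -addrA.
apply: (le_lt_trans (modCD _ _)); rewrite [e]splitr ler_ltD//.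
rewrite /psum sum_sigma_geom /lambert1 -sumrB.
apply: (le_trans (modC_sum _ _ _)).
apply: (@le_trans _ _ (\sum_(d < M) M.+1%:R * r ^+ M.+1 / (1 - r))).
  apply: ler_sum => d _; set u := q ^+ d.+1; set m := (M %/ d.+1)%N.
  have ur : modC u <= r by rewrite /u modCX; exact: exprS_le_base d r01.
  have u1 : 1 - u != 0.
    by rewrite subr_eq0; apply: contraTneq ur => <-; rewrite modC1 -ltNge.
  have u1r : 1 - r <= modC (1 - u).
    have := modCD (1 - u) u; rewrite subrK modC1; lra.
  have g : \sum_(n < m) u ^+ n.+1 = (u - u ^+ m.+1) / (1 - u).
    elim: (m) => [|j IH]; first by rewrite big_ord0 expr1 subrr mul0r.
    by rewrite big_ord_recr /= IH [u ^+ j.+2]exprS; field.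
  have -> : d.+1%:R * u / (1 - u) - d.+1%:R * \sum_(n < m) u ^+ n.+1 =
     d.+1%:R * u ^+ m.+1 / (1 - u) by rewrite g; field.
  rewrite modCM modCV modCM modC_nat modCX; apply: ler_pM.
  - by rewrite mulr_ge0 ?exprn_ge0 ?modC_ge0.
  - by rewrite invr_ge0 modC_ge0.
  - apply: ler_pM => //; first by rewrite exprn_ge0 ?modC_ge0.
      by rewrite ler_nat; apply: leqW; exact: ltn_ord.
    rewrite /u modCX -exprM -/r ler_wiXn2l ?(ltW q0) ?(ltW q1)//.
    by rewrite mulnC ltn_ceil.
  - by rewrite lef_pV2 ?posrE// (lt_le_trans r1 u1r).
rewrite sumr_const card_ord -[_ *+ M]mulr_natl mulrA ler_pdivrMr//.
exact: ltW.
Qed.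

Lemma E2E z : halfplane z -> E2 z = 1 - 24 * qs (fun N => (sigma N)%:R) (qpar z).
Proof.
move=> zH; rewrite /E2; congr (1 - _ * _); apply: tends_lim.
have -> : series (fun i : nat => i.+1%:R * qpar z ^+ i.+1 / (1 - qpar z ^+ i.+1)) = lambert1 (qpar z).
  by apply/funext => n; rewrite /series /lambert1 /= big_mkord.
by apply: tends_lambert1; case/andP: (modC_qpar_lt1 zH).
Qed.

(** Constant terms agree, c_1 = - 2 tau lam is - 24 times tau lam / 12, and all further coefficients
    are sigma(N) c_1. *)
Lemma quasi_E2 (c : nat -> CC R) (phi : CC R -> CC R) (lam : CC R) : qexp c phi ->
  (forall (a b c' d : int) z, a * d - b * c' = 1 -> halfplane z ->
    phi ((a%:~R * z + b%:~R) / (c'%:~R * z + d%:~R)) =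
    (c'%:~R * z + d%:~R) ^+ 2 * phi z + lam * c'%:~R * (c'%:~R * z + d%:~R)) ->
  forall z, halfplane z -> phi z = tau R * lam / 12 * E2 z.
Proof.
move=> phic phiG z zH.
have phiS := quasi_S phiG.
have cs := coef_sigma phic phiG.
have c0 := quasi_c0 phic phiS; have c1 := quasi_c1 phic phiS cs.
have q1 : modC (qpar z) < 1 by case/andP: (modC_qpar_lt1 zH).
apply: (tends_unique (phic z zH)).
have := tendsD (tends_cst (c 0%N)) (tendsZ (c 1%N) (qsP subexp_sigma q1)).
have -> : c 0%N + c 1%N * qs (fun N => (sigma N)%:R) (qpar z) = tau R * lam / 12 * E2 z.
  by rewrite (E2E zH) c0 c1; field.
apply: (tends_eq (N := 1)) => -[//|M] _.
rewrite /psum !big_ord_recl /= !expr0 !mulr1 sigma0 add0r; congr (_ + _).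
rewrite mulr_sumr; apply: eq_bigr => i _.
by rewrite [in RHS]cs ?lift0//; ring.
Qed.

End E2Series.

(** * The slash action and modular operators *)

Section Slash.
Variable R : realType.
Implicit Types (z w l x : CC R) (f : CC R -> CC R).

Definition has_D f z l := has_cderiv f z (tau R * l).

Lemma has_D_eq f z l m : has_D f z l -> l = m -> has_D f z m.
Proof. by move=> ? <-. Qed.

Lemma has_DM f g z l m : has_D f z l -> has_D g z m ->
  has_D (fun w => f w * g w) z (l * g z + f z * m).
Proof. by move=> h1 h2; apply: has_cderiv_eq (has_cderivM h1 h2) _; ring. Qed.

Lemma has_DZ a f z l : has_D f z l -> has_D (fun w => a * f w) z (a * l).
Proof. by move=> h; apply: has_cderiv_eq (has_cderivZ a h) _; ring. Qed.

Lemma has_DX m f z l : has_D f z l ->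
  has_D (fun w => f w ^+ m) z (m%:R * f z ^+ m.-1 * l).
Proof. by move=> h; apply: has_cderiv_eq (has_cderivX m h) _; ring. Qed.

Lemma has_D_sum (I : Type) (r : seq I) (F : I -> CC R -> CC R) (G : I -> CC R) z :
  (forall i, has_D (F i) z (G i)) ->
  has_D (fun w => \sum_(i <- r) F i w) z (\sum_(i <- r) G i).
Proof.
by move=> h; apply: has_cderiv_eq (has_cderiv_sum r h) _; rewrite mulr_sumr.
Qed.

Definition cpoch x s := \prod_(j < s) (x + j%:R).

Lemma cpochS x s : cpoch x s.+1 = cpoch x s * (x + s%:R).
Proof. exact: big_ord_recr. Qed.

Lemma cpochSl x s : cpoch x s.+1 = x * cpoch (x + 1) s.
Proof.
rewrite /cpoch big_ord_recl addr0; congr (_ * _); apply: eq_bigr => i _.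
by rewrite lift0 -addrA nat1r.
Qed.

Lemma ofR_poch (x : R) s : ofR (poch x s) = cpoch (ofR x) s.
Proof.
rewrite /poch /cpoch (big_morph _ (@ofRM R) (@ofR1 R)); apply: eq_bigr => i _.
by rewrite ofRD ofR_nat.
Qed.

Lemma det_mx22 (g : 'M[int]_2) : \det g = g 0 0 * g 1 1 - g 0 1 * g 1 0.
Proof.
rewrite (expand_det_row _ 0) !big_ord_recl big_ord0 addr0 /cofactor /= !det_mx11 !mxE /=.
rewrite /bump /= !add0n expr0 mul1r expr1 mulN1r mulrN.
by do ?[congr (_ - _) | congr (_ * _) | congr (g _ _)]; apply: val_inj.
Qed.

Section Gamma.
Variable g : 'M[int]_2.
Hypothesis gSL : SL2Z g.

Let gdet : (g 0 0)%:~R * (g 1 1)%:~R - (g 0 1)%:~R * (g 1 0)%:~R = 1 :> CC R.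
Proof.
by rewrite -!rmorphM -rmorphB -det_mx22 (gSL : \det g = 1) rmorph1.
Qed.

Lemma imC_autj z : imC (autj g z) = (g 1 0)%:~R * imC z.
Proof. by rewrite imCD imCM reC_int !imC_int mul0r !addr0. Qed.

Lemma autj_c0 z : g 1 0 = 0 -> autj g z = (g 1 1)%:~R.
Proof. by move=> c0; rewrite /autj c0 mul0r add0r. Qed.

Lemma autj_neq0 z : halfplane z -> autj g z != 0.
Proof.
move=> zH; have [c0|c0] := eqVneq (g 1 0) 0.
  rewrite autj_c0//; apply/eqP => d0; move: gdet; rewrite c0 d0 !mulr0 subrr => /esym/eqP.
  by rewrite oner_eq0.
have : imC (autj g z) != 0 by rewrite imC_autj mulf_neq0 ?intr_eq0// gt_eqF.
by apply: contraNneq => ->.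
Qed.

Lemma moebius_halfplane z : halfplane z -> halfplane (moebius g z).
Proof.
move=> zH; have J0 := autj_neq0 zH.
have m0 : 0 < modC (autj g z) ^+ 2 by rewrite exprn_gt0// modC_gt0.
rewrite halfplaneE /moebius imCM imCV reCV imC_autj.
have -> : imC ((g 0 0)%:~R * z + (g 0 1)%:~R) = (g 0 0)%:~R * imC z.
  by rewrite imCD imCM reC_int !imC_int mul0r !addr0.
have re a b : reC (a%:~R * z + b%:~R) = a%:~R * reC z + b%:~R.
  by rewrite reCD reCM !reC_int imC_int mul0r subr0.
rewrite re [reC (autj g z)]re.
have det : (g 0 0)%:~R * (g 1 1)%:~R - (g 0 1)%:~R * (g 1 0)%:~R = 1 :> R.
  by rewrite -!rmorphM -rmorphB -det_mx22 (gSL : \det g = 1) rmorph1.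
have -> : ((g 0 0)%:~R * reC z + (g 0 1)%:~R) * (- ((g 1 0)%:~R * imC z) / modC (autj g z) ^+ 2) +
   (g 0 0)%:~R * imC z * (((g 1 0)%:~R * reC z + (g 1 1)%:~R) / modC (autj g z) ^+ 2) =
   imC z * ((g 0 0)%:~R * (g 1 1)%:~R - (g 0 1)%:~R * (g 1 0)%:~R) / modC (autj g z) ^+ 2 by ring.
by rewrite det mulr1 divr_gt0.
Qed.

Lemma has_cderiv_affine (a b : CC R) z : has_cderiv (fun w => a * w + b) z a.
Proof.
apply: has_cderiv_eq (has_cderivD (has_cderivZ a (has_cderiv_id z)) (has_cderiv_cst b z)) _.
by rewrite mulr1 addr0.
Qed.

Lemma has_cderiv_moebius z : halfplane z -> has_cderiv (moebius g) z ((autj g z)^-1 ^+ 2).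
Proof.
move=> zH; have J0 := autj_neq0 zH.
have h := has_cderivM (has_cderiv_affine (g 0 0)%:~R (g 0 1)%:~R z)
  (has_cderivV J0 (has_cderiv_affine _ _ z)).
apply: has_cderiv_eq h _; move: J0 gdet; rewrite /autj.
set a := (g 0 0)%:~R; set b := (g 0 1)%:~R; set c := (g 1 0)%:~R; set d := (g 1 1)%:~R.
move=> J0 det; transitivity ((a * d - b * c) * (c * z + d)^-1 ^+ 2); last by rewrite det mul1r.
by field.
Qed.

(** The logarithmic D-derivative of 1 / J. Since D X = X^2, no functions other than powers of X and
    J appear when slashed functions are differentiated repeatedly. *)
Definition Xg z : CC R := - (g 1 0)%:~R / (tau R * autj g z).

Lemma has_D_Xg z : halfplane z -> has_D Xg z (Xg z ^+ 2).
Proof.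
move=> zH; have J0 := autj_neq0 zH; have t0 := tau_neq0 R.
have h := has_cderivZ (- (g 1 0)%:~R / tau R) (has_cderivV J0 (has_cderiv_affine _ _ z)).
apply: has_D_eq (_ : has_D Xg z (tau R ^- 2 * (g 1 0)%:~R ^+ 2 * (autj g z)^-1 ^+ 2)) _.
  apply: has_cderiv_ext (_ : _ =1 _) (has_cderiv_eq h _).
    by move=> w; rewrite /Xg [(tau R * _)^-1]invfM [RHS]mulrA.
  by field; rewrite ?J0 ?t0.
by rewrite /Xg; field; rewrite ?J0 ?t0.
Qed.

Lemma has_D_autjV z : halfplane z -> has_D (fun w => (autj g w)^-1) z (Xg z * (autj g z)^-1).
Proof.
move=> zH; have J0 := autj_neq0 zH; have t0 := tau_neq0 R.
apply: has_cderiv_eq (has_cderivV J0 (has_cderiv_affine _ _ z)) _.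
by rewrite /Xg; field; rewrite ?J0 ?t0.
Qed.

Lemma has_D_autjVX m z : halfplane z ->
  has_D (fun w => (autj g w)^-1 ^+ m) z (m%:R * Xg z * (autj g z)^-1 ^+ m).
Proof.
move=> zH; apply: has_D_eq (has_DX m (has_D_autjV zH)) _.
case: m => [|m]; first by rewrite !mul0r.
by rewrite /= exprS; ring.
Qed.

Lemma has_D_XgX m z : halfplane z ->
  has_D (fun w => Xg w ^+ m) z (m%:R * Xg z ^+ m.+1).
Proof.
move=> zH; apply: has_D_eq (has_DX m (has_D_Xg zH)) _.
case: m => [|m]; first by rewrite !mul0r.
by rewrite /= !exprS; ring.
Qed.

Lemma has_D_cpow (k : R) z : halfplane z ->
  has_D (fun w => cpow (autj g w) (- k)) z (ofR k * Xg z * cpow (autj g z) (- k)).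
Proof.
move=> zH; have J0 := autj_neq0 zH; have t0 := tau_neq0 R.
(* For c = 0 the factor J is constant, possibly on the cut of [cpow]; otherwise J lies off the real
   axis, where [cpow] is differentiable. *)
have [c0|c0] := eqVneq (g 1 0) 0.
  have -> : ofR k * Xg z * cpow (autj g z) (- k) = 0.
    by rewrite /Xg c0 oppr0 !(mul0r, mulr0).
  rewrite /has_D mulr0; apply: has_cderiv_ext (has_cderiv_cst (cpow (g 1 1)%:~R (- k)) z).
  by move=> w; rewrite autj_c0.
have i0 : imC (autj g z) != 0 by rewrite imC_autj mulf_neq0 ?intr_eq0// gt_eqF.
apply: has_cderiv_eq (has_cderiv_comp (has_cderiv_affine _ _ z) (has_cderiv_cpow (- k) i0)) _.
by rewrite ofRN /Xg -/(autj g z); field; rewrite ?J0 ?t0.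
Qed.

Lemma has_D_comp_moebius f z l : halfplane z -> has_D f (moebius g z) l ->
  has_D (fun w => f (moebius g w)) z ((autj g z)^-1 ^+ 2 * l).
Proof.
move=> zH h; apply: has_cderiv_eq (has_cderiv_comp (has_cderiv_moebius zH) h) _.
by ring.
Qed.

(** Pascal's rule with Pochhammer weights, resting on (j + 1) C(r, j + 1) = (r - j) C(r, j). It
    drives the induction on the order both for [bol] and, with signs, for [dsum]. *)
Lemma slash_coef (x : CC R) r j : (j <= r)%N ->
  'C(r, j.+1)%:R * cpoch (x + j.+1%:R) (r - j.+1) * (x + (r + j.+1)%:R) +
  'C(r, j)%:R * cpoch (x + j%:R) (r - j) =
  'C(r.+1, j.+1)%:R * cpoch (x + j.+1%:R) (r - j).
Proof.
rewrite leq_eqVlt => /orP[/eqP ->|jr].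
  by rewrite !binn bin_small// subnn /cpoch !big_ord0 !mul0r add0r.
have [q rq] : exists q, r = (j.+1 + q)%N by exists (r - j.+1)%N; rewrite subnKC.
have e1 : (r - j.+1 = q)%N by rewrite rq addKn.
have e2 : (r - j = q.+1)%N by rewrite rq addSnnS addKn.
rewrite e1 e2 binS [('C(r, j.+1) + _)%:R]natrD cpochSl cpochS.
have -> : x + j%:R + 1 = x + j.+1%:R by rewrite -addrA natr1.
have := mul_bin_left r j; rewrite e2 => /(congr1 (fun m => m%:R : CC R)).
rewrite !natrM => h.
set a := 'C(r, j.+1)%:R in h *; set b := 'C(r, j)%:R in h *.
set p := cpoch _ q.
have -> : (r + j.+1)%:R = j.+1%:R + q%:R + j.+1%:R :> CC R by rewrite rq !natrD.
apply/eqP; rewrite -subr_eq0; apply/eqP.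
transitivity (p * (j.+1%:R * a - q.+1%:R * b)); last by rewrite h subrr mulr0.
by rewrite -[q.+1%:R]natr1 -[j.+1%:R]natr1; ring.
Qed.

Section Bol.
Variables (k : R) (P : nat -> CC R -> CC R).
Hypothesis PD : forall i w, halfplane w -> has_D (P i) w (P i.+1 w).

Definition bolterm r j z : CC R := 'C(r, j)%:R * cpoch (ofR k + j%:R) (r - j) *
   (Xg z ^+ (r - j) * ((autj g z)^-1 ^+ (2 * j) * P j (moebius g z))).

(* The r-th derivative of the weight k slash image by g of a function whose i-th
   derivative is P i. *)
Definition bol r z : CC R := cpow (autj g z) (- k) * \sum_(j < r.+1) bolterm r j z.

Lemma has_D_bol r z : halfplane z -> has_D (bol r) z (bol r.+1 z).
Proof.
move=> zH; have gH := moebius_halfplane zH.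
have h (j : 'I_r.+1) : has_D (bolterm r j) z
   ('C(r, j)%:R * cpoch (ofR k + j%:R) (r - j) *
    (((r - j) + 2 * j)%:R * Xg z ^+ (r - j).+1 * ((autj g z)^-1 ^+ (2 * j) * P j (moebius g z))
    + Xg z ^+ (r - j) * ((autj g z)^-1 ^+ (2 * j.+1) * P j.+1 (moebius g z)))).
  apply: has_DZ.
  apply: has_D_eq (has_DM (has_D_XgX (r - j) zH)
    (has_DM (has_D_autjVX (2 * j) zH) (has_D_comp_moebius zH (PD j gH)))) _.
  by rewrite natrD mulnSr exprD exprS; ring.
apply: has_D_eq (has_DM (has_D_cpow k zH) (has_D_sum _ h)) _.
rewrite /bol; set W := cpow (autj g z) (- k); set S := (X in _ * X + _).
set S' := (X in _ + _ * X); transitivity (W * (ofR k * Xg z * S + S')); first by ring.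
congr (_ * _); rewrite /S /S' {S S'}.
rewrite mulr_sumr -big_split /=.
(* [A] collects the derivatives of the powers of X and J, the automorphy factor included, and [B]
   those of [P j]; B j has the same monomial as A (j + 1). *)
pose A j := 'C(r, j)%:R * cpoch (ofR k + j%:R) (r - j) * (ofR k + (r + j)%:R) *
   (Xg z ^+ (r.+1 - j) * ((autj g z)^-1 ^+ (2 * j) * P j (moebius g z))).
pose B j := 'C(r, j)%:R * cpoch (ofR k + j%:R) (r - j) *
   (Xg z ^+ (r - j) * ((autj g z)^-1 ^+ (2 * j.+1) * P j.+1 (moebius g z))).
transitivity (\sum_(j < r.+1) (A j + B j)).
  apply: eq_bigr => j _; have jr : (j <= r)%N by rewrite -ltnS.
  have rj : (r + j)%N = (r - j + 2 * j)%N by lia.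
  by rewrite /A /B /bolterm subSn// rj exprS; ring.
rewrite big_split /=.
have -> : \sum_(j < r.+1) A j = \sum_(j < r.+2) A j.
  have A0 : A r.+1 = 0 by rewrite /A bin_small// !mul0r.
  by rewrite [RHS]big_ord_recr /= A0 addr0.
rewrite big_ord_recl [RHS]big_ord_recl -addrA -big_split /=; congr (_ + _).
  rewrite /A /bolterm !bin0 !subn0 addn0 !addr0 cpochS; ring.
apply: eq_bigr => j _; have jr : (j <= r)%N by rewrite -ltnS.
rewrite /bump /= add1n /A /B /bolterm subSS -mulrDl -(slash_coef (ofR k) jr).
by ring.
Qed.

Lemma Dn_slash r z : halfplane z -> Dn r (slash k (P 0%N) g) z = bol r z.
Proof.
move=> zH; rewrite -(tower_smoothH has_D_bol).2//; apply: Dn_extH => // w wH.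
rewrite /slash /bol big_ord_recl big_ord0 addr0 /bolterm bin0 subnn /cpoch big_ord0.
by rewrite muln0 !expr0 !mul1r.
Qed.

End Bol.
End Gamma.
End Slash.

(** * Reordering of triangular sums *)

Section Sums.
Variable V : nmodType.

Lemma sum_ord_shift n j (F : nat -> V) : (j <= n)%N ->
  \sum_(r < n.+1) (if (j <= r)%N then F r else 0) = \sum_(s < (n - j).+1) F (j + s)%N.
Proof.
move=> jn; have -> : n.+1 = (j + (n - j).+1)%N by rewrite addnS subnKC.
rewrite big_split_ord /= big1 ?add0r; last first.
  by move=> i _; rewrite leqNgt ltn_ord.
by apply: eq_bigr => i _; rewrite leq_addr.
Qed.

Lemma sum_triangle N (F : nat -> nat -> V) :
  \sum_(s < N.+1) \sum_(u < (N - s).+1) F s u =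
  \sum_(e < N.+1) \sum_(s < e.+1) F s (e - s)%N.
Proof.
transitivity (\sum_(s < N.+1) \sum_(e < N.+1) (if (s <= e)%N then F s (e - s)%N else 0)).
  apply: eq_bigr => s _; rewrite (sum_ord_shift (fun e => F s (e - s)%N)); last by rewrite -ltnS.
  by apply: eq_bigr => u _; rewrite addKn.
rewrite exchange_big; apply: eq_bigr => e _ /=.
have le : (e.+1 <= N.+1)%N by exact: ltn_ord.
by rewrite (big_ord_widen _ (fun s => F s (e - s)%N) le) [RHS]big_mkcond.
Qed.

Lemma sum_triangle2 e (G : nat -> nat -> V) :
  \sum_(s < e.+1) \sum_(v < s.+1) G s v =
  \sum_(v < e.+1) \sum_(q < (e - v).+1) G (v + q)%N v.
Proof.
transitivity (\sum_(s < e.+1) \sum_(v < e.+1) (if (v <= s)%N then G s v else 0)).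
  apply: eq_bigr => s _; have le : (s.+1 <= e.+1)%N by exact: ltn_ord.
  by rewrite (big_ord_widen _ (fun v => G s v) le) [LHS]big_mkcond.
rewrite exchange_big; apply: eq_bigr => v _ /=.
by rewrite (sum_ord_shift (fun s => G s v))// -ltnS.
Qed.

End Sums.

(** * Transformation laws of the coefficients and of their derivatives *)

Section Law.
Variable R : realType.
Implicit Types (z w l x : CC R) (f : CC R -> CC R).

Section TestPolynomial.
Variables (j : nat) (w0 : CC R).

(** The i-th D-derivative of (w - w0)^j. At w0 only the one of order i = j survives, which isolates
    a single coefficient of the operator. *)
Definition testpol i w : CC R := (j ^_ i)%:R / tau R ^+ i * (w - w0) ^+ (j - i).

Lemma has_D_testpol i w : has_D (testpol i) w (testpol i.+1 w).
Proof.
have t0 := tau_neq0 R.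
have h0 : has_cderiv (fun w => w - w0) w 1.
  apply: has_cderiv_eq (has_cderivB (has_cderiv_id w) (has_cderiv_cst w0 w)) _.
  by rewrite subr0.
apply: has_cderiv_eq (has_cderivZ _ (has_cderivX (j - i) h0)) _.
rewrite /testpol ffactnSr natrM exprS -subnS.
by field; rewrite t0 expf_neq0.
Qed.

Lemma testpolE i : testpol i w0 = if i == j then j`!%:R / tau R ^+ j else 0.
Proof.
rewrite /testpol subrr; case: ltngtP => [ij|ij|->].
- by rewrite expr0n subn_eq0 leqNgt ij mulr0.
- by rewrite ffact_small// mul0r mul0r.
- by rewrite subnn expr0 mulr1 ffactnn.
Qed.

End TestPolynomial.

Variables (k : R) (n : nat) (a : nat -> CC R -> CC R).
Hypothesis aM : MLDO k (k + (2 * n)%:R) n a.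

Lemma MLDO_qexp r : (r <= n)%N -> exists c, qexp c (a r).
Proof. by case: aM => _ h _ /h/holo_at_cuspP. Qed.

Lemma MLDO_smooth r : (r <= n)%N -> smoothH (a r).
Proof. by move=> /MLDO_qexp[c /qexp_Dn[]]. Qed.

Section LawGamma.
Variable g : 'M[int]_2.
Hypothesis gSL : SL2Z g.

Definition lawcoef r u : CC R := 'C(r + u, u)%:R * cpoch (ofR k + r%:R) u.

(** With the test function centred at gz, the slashed side of the equivariance reduces to a_j(gz),
    and on the other side each derivative of order r >= j keeps only the term j of Bol's formula
    [bol]. *)
Lemma MLDO_law j z : (j <= n)%N -> halfplane z ->
  a j (moebius g z) = autj g z ^+ (2 * (n - j)) *
   \sum_(s < (n - j).+1) lawcoef j s * (Xg g z ^+ s * a (j + s)%N z).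
Proof.
move=> jn zH; have J0 := autj_neq0 gSL zH; have t0 := tau_neq0 R.
have wH := moebius_halfplane gSL zH; set w0 := moebius g z in wH *.
pose P := testpol j w0.
have PD i w (_ : halfplane w) : has_D (P i) w (P i.+1 w) by exact: has_D_testpol.
have Ph : holo_on_H (P 0%N) by move=> w wwH; exact: has_cderiv_derivable (PD 0%N w wwH).
have [_ _ /(_ _ Ph _ gSL _ zH)] := aM.
rewrite [RHS]/slash -/w0 /diffop.
have Dw r : Dn r (P 0%N) w0 = if r == j then j`!%:R / tau R ^+ j else 0.
  by rewrite (tower_smoothH PD).2//; exact: testpolE.
set C := j`!%:R / tau R ^+ j in Dw.
have C0 : C != 0 by rewrite mulf_neq0 ?invr_eq0 ?expf_neq0// pnatr_eq0 -lt0n fact_gt0.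
have jn1 : (j < n.+1)%N by [].
have -> : \sum_(r < n.+1) a r w0 * Dn r (P 0%N) w0 = a j w0 * C.
  rewrite (bigD1 (Ordinal jn1))//= Dw eqxx big1 ?addr0// => i ij.
  by rewrite Dw -[(i : nat) == j]/(i == Ordinal jn1) (negbTE ij) mulr0.
have -> : \sum_(r < n.+1) a r z * Dn r (slash k (P 0%N) g) z =
   cpow (autj g z) (- k) * (autj g z)^-1 ^+ (2 * j) * C * \sum_(s < (n - j).+1) lawcoef j s * (Xg g z ^+ s * a (j + s)%N z).
  pose G r := 'C(r, r - j)%:R * cpoch (ofR k + j%:R) (r - j) * (Xg g z ^+ (r - j) * a r z).
  have -> : \sum_(s < (n - j).+1) lawcoef j s * (Xg g z ^+ s * a (j + s)%N z) =
      \sum_(r < n.+1) (if (j <= r)%N then G r else 0).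
    by rewrite sum_ord_shift//; apply: eq_bigr => s _; rewrite /G addKn.
  rewrite /G {G}.
  rewrite mulr_sumr; apply: eq_bigr => r _; rewrite (Dn_slash gSL k PD r zH) /bol.
  have B i : bolterm g k P r i z = 'C(r, i)%:R * cpoch (ofR k + i%:R) (r - i) *
     (Xg g z ^+ (r - i) * ((autj g z)^-1 ^+ (2 * i) * (if i == j then C else 0))).
    by rewrite /bolterm /P testpolE.
  rewrite (eq_bigr _ (fun (i : 'I_r.+1) _ => B i)).
  case: leqP => jr; last first.
    rewrite big1 ?mulr0// => i _; rewrite ifF ?mulr0//.
    by apply/negbTE; rewrite neq_ltn (leq_trans (ltn_ord i)).
  have jr1 : (j < r.+1)%N by [].
  rewrite (bigD1 (Ordinal jr1))//= eqxx big1 ?addr0; last first.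
    move=> i ij; rewrite -[(i : nat) == j]/(i == Ordinal jr1) (negbTE ij).
    by rewrite !mulr0.
  by rewrite bin_sub//; ring.
(* Both sides carry the same value of J^(- k), whatever the branch, and it can be cancelled. *)
have -> : cpow (autj g z) (- (k + (2 * n)%:R)) = cpow (autj g z) (- k) * (autj g z ^+ (2 * n))^-1.
  by rewrite opprD cpowD [cpow _ (- _%:R)]cpowN cpow_nat.
have W0 := cpow_neq0 (autj g z) (- k).
set S := \sum_(s < _) _ => h.
have e : (2 * n = 2 * j + 2 * (n - j))%N by rewrite -mulnDr subnKC.
have h2 : (cpow (autj g z) (- k) * C) * ((autj g z)^-1 ^+ (2 * j) * S) =
  (cpow (autj g z) (- k) * C) * ((autj g z ^+ (2 * n))^-1 * a j w0).
  by transitivity (cpow (autj g z) (- k) * (autj g z)^-1 ^+ (2 * j) * C * S); [ring|rewrite h; ring].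
have h3 := mulfI (mulf_neq0 W0 C0) h2.
rewrite e exprD in h3; have -> : a j w0 = autj g z ^+ (2 * j) * autj g z ^+ (2 * (n - j)) *
   ((autj g z ^+ (2 * j) * autj g z ^+ (2 * (n - j)))^-1 * a j w0).
  by rewrite mulrA mulfV ?mul1r// mulf_neq0 // expf_neq0.
rewrite -h3 exprVn; field.
by rewrite expf_neq0.
Qed.

Lemma has_D_autjX m z : halfplane z ->
  has_D (fun w => autj g w ^+ m) z (- (m%:R * Xg g z * autj g z ^+ m)).
Proof.
move=> zH; have J0 := autj_neq0 gSL zH; have t0 := tau_neq0 R.
apply: has_cderiv_eq (has_cderivX m (has_cderiv_affine _ _ z)) _.
rewrite /Xg -/(autj g z); case: m => [|m]; first by rewrite !mul0r oppr0 mulr0.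
by rewrite /= exprS; field; rewrite ?J0 ?t0.
Qed.

Section DLaw.
Variables (b : CC R -> CC R) (x : CC R) (u : nat).
Hypothesis bs : smoothH b.

Definition dterm s v z : CC R := 'C(s, v)%:R * (-1) ^+ (s - v) * cpoch (x + v%:R) (s - v) *
  (Xg g z ^+ (u + (s - v)) * Dn v b z).

(** If F(gz) = J^(x + u) X^u b(z), then (D^s F)(gz) = J^(x + u + 2s) times [dsum s]: the derivative
    with respect to gz is J^2 D. *)
Definition dsum s z : CC R := \sum_(v < s.+1) dterm s v z.

Lemma has_D_dsum s z : halfplane z ->
  has_D (dsum s) z (dsum s.+1 z + (x + u%:R + (2 * s)%:R) * Xg g z * dsum s z).
Proof.
move=> zH.
have h (v : 'I_s.+1) : has_D (dterm s v) z
   ('C(s, v)%:R * (-1) ^+ (s - v) * cpoch (x + v%:R) (s - v) *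
    ((u + (s - v))%:R * Xg g z ^+ (u + (s - v)).+1 * Dn v b z
    + Xg g z ^+ (u + (s - v)) * Dn v.+1 b z)).
  apply: has_DZ; exact: has_DM (has_D_XgX gSL _ zH) (smoothH_deriv _ bs zH).
apply: has_D_eq (has_D_sum _ h) _.
rewrite [dsum s z]/dsum mulr_sumr.
apply/eqP; rewrite -subr_eq -sumrB; apply/eqP.
pose A v := - ('C(s, v)%:R * (-1) ^+ (s - v) * cpoch (x + v%:R) (s - v) * (x + (s + v)%:R)) *
   (Xg g z ^+ (u + (s.+1 - v)) * Dn v b z).
pose B v := 'C(s, v)%:R * (-1) ^+ (s - v) * cpoch (x + v%:R) (s - v) *
   (Xg g z ^+ (u + (s - v)) * Dn v.+1 b z).
transitivity (\sum_(v < s.+1) (A v + B v)).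
  apply: eq_bigr => v _; have vs : (v <= s)%N by rewrite -ltnS.
  have e : (2 * s = (s - v) + (s + v))%N by lia.
  rewrite /A /B /dterm subSn// !addnS exprS e [((s - v) + (s + v))%:R]natrD.
  by rewrite [(u + (s - v))%:R]natrD; ring.
rewrite big_split /=.
have -> : \sum_(v < s.+1) A v = \sum_(v < s.+2) A v.
  have A0 : A s.+1 = 0 by rewrite /A bin_small// !mul0r oppr0 mul0r.
  by rewrite [RHS]big_ord_recr /= A0 addr0.
rewrite /dsum big_ord_recl [RHS]big_ord_recl -addrA -big_split /=; congr (_ + _).
  rewrite /A /dterm !bin0 !subn0 addn0 !addr0 cpochS exprS; ring.
apply: eq_bigr => v _; have vs : (v <= s)%N by rewrite -ltnS.
rewrite /bump /= add1n /A /B /dterm subSS -mulrDl; congr (_ * _).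
transitivity ((-1) ^+ (s - v) * ('C(s, v.+1)%:R * cpoch (x + v.+1%:R) (s - v.+1) * (x + (s + v.+1)%:R) +
  'C(s, v)%:R * cpoch (x + v%:R) (s - v))); last by rewrite slash_coef//; ring.
move: vs; rewrite leq_eqVlt => /orP[/eqP ->|vs].
  by rewrite bin_small// !mul0r oppr0 !add0r; ring.
have -> : (s - v = (s - v.+1).+1)%N by lia.
by rewrite [(-1) ^+ _.+1]exprS; ring.
Qed.

End DLaw.

Definition wt r : CC R := (2 * (n - r))%:R.

(** Induction on s, differentiating the law in z. The derivative - m X J^m of the power of J, with m
    = 2 (n - r) + 2 s, cancels the last term of [has_D_dsum], because x + u = 2 (n - r) for every
    u. *)
Lemma Dn_law r s z : (r <= n)%N -> halfplane z ->
  Dn s (a r) (moebius g z) = autj g z ^+ (2 * (n - r) + 2 * s) *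
   \sum_(u < (n - r).+1) lawcoef r u * dsum (a (r + u)%N) (wt r - u%:R) u s z.
Proof.
move=> rn; elim: s z => [|s IH] z zH.
  rewrite [LHS](MLDO_law rn zH) muln0 addn0; congr (_ * _); apply: eq_bigr => u _.
  rewrite /dsum big_ord_recl big_ord0 addr0 /dterm bin0 subnn /cpoch big_ord0.
  by rewrite addn0 expr0 !mul1r.
have wH := moebius_halfplane gSL zH; have J0 := autj_neq0 gSL zH.
have rs : smoothH (a r) := MLDO_smooth rn.
have d1 : has_D (fun w => Dn s (a r) (moebius g w)) z ((autj g z)^-1 ^+ 2 * Dn s.+1 (a r) (moebius g z)).
  apply: (@has_D_comp_moebius _ g gSL (Dn s (a r)) _ _ zH).
  by rewrite /has_D; apply: smoothH_deriv.
have un (u : 'I_(n - r).+1) : (r + u <= n)%N.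
  by have := ltn_ord u; lia.
have hd (u : 'I_(n - r).+1) := has_DZ (lawcoef r u)
  (has_D_dsum (wt r - u%:R) u (MLDO_smooth (un u)) s zH).
have d2 := has_DM (has_D_autjX (2 * (n - r) + 2 * s) zH) (has_D_sum _ hd).
have d3 := has_cderiv_extH (fun w wwH => esym (IH w wwH)) zH (d2 (index_enum _)).
have := mulfI (tau_neq0 R) (has_cderiv_unique d1 d3).
set S := \sum_(u < _) _; set S' := \sum_(u < (n - r).+1) (_ * (_ + _)) => e.
have -> : Dn s.+1 (a r) (moebius g z) = autj g z ^+ 2 * ((autj g z)^-1 ^+ 2 * Dn s.+1 (a r) (moebius g z)).
  by rewrite exprVn mulrA mulfV ?mul1r// expf_neq0.
rewrite e.
have -> : S' = \sum_(u < (n - r).+1) lawcoef r u * dsum (a (r + u)%N) (wt r - u%:R) u s.+1 z +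
    (2 * (n - r) + 2 * s)%:R * Xg g z * S.
  rewrite /S' /S mulr_sumr -big_split /=; apply: eq_bigr => u _.
  by rewrite natrD -/(wt r); ring.
have -> : (2 * (n - r) + 2 * s.+1 = 2 + (2 * (n - r) + 2 * s))%N by lia.
rewrite [autj g z ^+ (2 + _)]exprD; set p := autj g z ^+ (_ + _).
set m := (_ + _)%:R; set T := \sum_(u < _) _ * dsum _ _ _ s.+1 z; ring.
Qed.

End LawGamma.
End Law.

(** * Modularity of the forms h_m *)

Section Combinatorics.
Variable F : numFieldType.
Implicit Types x y : F.

Definition ffx x d := \prod_(i < d) (x - i%:R).

Lemma ffxS x d : ffx x d.+1 = ffx x d * (x - d%:R).
Proof. exact: big_ord_recr. Qed.

Lemma ffxSl x d : ffx x d.+1 = x * ffx (x - 1) d.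
Proof.
rewrite /ffx big_ord_recl subr0; congr (_ * _); apply: eq_bigr => i _.
by rewrite lift0 -addrA -opprD nat1r.
Qed.

Lemma ffxD x d e : ffx x (d + e) = ffx x d * ffx (x - d%:R) e.
Proof.
elim: e => [|e IH]; first by rewrite addn0 /ffx big_ord0 mulr1.
by rewrite addnS !ffxS IH natrD; ring.
Qed.

Lemma ffx_neq0 x d : (forall i, (i < d)%N -> x != i%:R) -> ffx x d != 0.
Proof.
by move=> h; rewrite prodf_seq_neq0; apply/allP => i _ /=; rewrite subr_eq0 h.
Qed.

Lemma ffx_diff x d : ffx x d.+1 - ffx (x - 1) d.+1 = d.+1%:R * ffx (x - 1) d.
Proof. by rewrite ffxSl ffxS -natr1; ring. Qed.

(** A g-th finite difference of a polynomial of degree d < g. [rec] carries out one difference and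
    [ffx_diff] lowers the degree by one. *)
Lemma sum_altbin_ffx g x d : (d < g)%N ->
  \sum_(q < g.+1) (-1) ^+ q * 'C(g, q)%:R * ffx (x - q%:R) d = 0.
Proof.
have rec h (G : nat -> F) : \sum_(q < h.+2) (-1) ^+ q * 'C(h.+1, q)%:R * G q =
    \sum_(q < h.+1) (-1) ^+ q * 'C(h, q)%:R * (G q - G q.+1).
  under [RHS]eq_bigr do rewrite mulrBr; rewrite sumrB.
  have -> : \sum_(q < h.+1) (-1) ^+ q * 'C(h, q)%:R * G q =
     \sum_(q < h.+2) (-1) ^+ q * 'C(h, q)%:R * G q.
    by rewrite [RHS]big_ord_recr /= bin_small// mulr0 mul0r addr0.
  rewrite [LHS]big_ord_recl [X in _ = X - _]big_ord_recl !bin0 -addrA; congr (_ + _).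
  rewrite -sumrB; apply: eq_bigr => q _.
  by rewrite lift0 binS natrD exprS; ring.
elim: g x d => [//|g IH] x d dg; rewrite (rec g (fun q => ffx (x - q%:R) d)).
case: d dg => [|d] dg.
  by rewrite big1// => q _; rewrite /ffx !big_ord0 subrr mulr0.
transitivity (d.+1%:R * \sum_(q < g.+1) (-1) ^+ q * 'C(g, q)%:R * ffx (x - 1 - q%:R) d);
  last by rewrite IH// mulr0.
rewrite mulr_sumr; apply: eq_bigr => q _.
have -> : x - q.+1%:R = x - q%:R - 1 by rewrite -natr1; ring.
by rewrite ffx_diff [x - 1 - _]addrAC; ring.
Qed.

Lemma natr_bin a b : 'C(a + b, b)%:R = (a + b)`!%:R / (a`!%:R * b`!%:R) :> F.
Proof.
have h c : c`!%:R != 0 :> F by rewrite pnatr_eq0 -lt0n fact_gt0.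
apply: (mulIf (mulf_neq0 (h a) (h b))); rewrite divfK ?mulf_neq0//.
by rewrite -!natrM -(bin_fact (leq_addl a b)) addnK; congr (_%:R); ring.
Qed.

End Combinatorics.

(** Both sides are the multinomial coefficient of (m, v, q, u). *)
Lemma bin_mul4 m v q u :
  ('C(m + (v + q), v + q) * 'C(m + (v + q) + u, u) * 'C(v + q, v) =
   'C(m + (v + (q + u)), v + (q + u)) * 'C(v + (q + u), v) * 'C(q + u, q))%N.
Proof.
have h c : c`!%:R != 0 :> rat by rewrite pnatr_eq0 -lt0n fact_gt0.
apply/eqP; rewrite -(eqr_nat rat) !natrM; apply/eqP.
have b2 i j : 'C(i + j, i)%:R = (i + j)`!%:R / (i`!%:R * j`!%:R) :> rat.
  by rewrite addnC natr_bin addnC [_`!%:R * i`!%:R]mulrC.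
rewrite !natr_bin !b2 !addnA; field.
by rewrite !h.
Qed.

Section HModular.
Variable R : realType.
Implicit Types (z w l x : CC R) (f : CC R -> CC R).

Lemma cpoch_ffx x s : cpoch x s = ffx (x + s%:R - 1) s.
Proof.
rewrite /cpoch /ffx (reindex_inj rev_ord_inj) /=; apply: eq_bigr => i _.
rewrite /= natrB ?ltn_ord// -natr1; ring.
Qed.

Lemma cpochD x s t : cpoch x (s + t) = cpoch x s * cpoch (x + s%:R) t.
Proof.
elim: t => [|t IH]; first by rewrite addn0 /cpoch big_ord0 mulr1.
by rewrite addnS !cpochS IH natrD; ring.
Qed.

Variables (k : R) (n : nat).

Definition hbeta m s : CC R := 'C(m + s, s)%:R *
  (cpoch (ofR k + m%:R) s / cpoch ((2 * (n - m))%:R - s%:R - 1) s).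

Lemma hcoef_beta (a : nat -> CC R -> CC R) m z : (m <= n)%N ->
  hcoef k (2 * n)%:R n a m z = \sum_(s < (n - m).+1) hbeta m s * Dn s (a (m + s)%N) z.
Proof.
move=> mn; apply: eq_bigr => s _; congr (_ * _).
rewrite ofRM ofR_nat ofRM ofRV !ofR_poch; congr (_ * (cpoch _ _ / cpoch _ _)).
  by rewrite ofRD ofR_nat.
rewrite !ofRD !ofRN ofRM !ofR_nat ofR1 mulnBr natrB ?leq_mul2l//.
by rewrite [(2 * m)%:R]natrM.
Qed.

(** The coefficient of X^(e - v) D^v(a_(m+e)) in h_m(gz), apart from J^(2 (n - m)). For v < e put g
    + 1 = e - v: the Pochhammer symbols combine into a falling factorial of degree g in q, which the
    difference of order g + 1 annihilates. *)
Lemma hcoef_cancel m e v : (m + 2 <= n)%N -> (v <= e)%N -> (e <= n - m)%N ->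
  \sum_(q < (e - v).+1) hbeta m (v + q)%N * lawcoef k (m + (v + q)) (e - (v + q)) *
     ('C(v + q, v)%:R * (-1) ^+ (v + q - v) *
      cpoch (wt R n (m + (v + q)) - (e - (v + q))%:R + v%:R) (v + q - v)) =
  if v == e then hbeta m e else 0.
Proof.
move=> mn ve en; case: eqP => [->|/eqP ve'].
  rewrite subnn big_ord_recl big_ord0 addr0 /= addn0 subnn binn /lawcoef bin0.
  by rewrite /cpoch !big_ord0 expr0 !mulr1.
set N := (n - m)%N in en; have N2 : (2 <= N)%N by rewrite /N; lia.
pose W : CC R := (2 * N)%:R.
have [g eg] : exists g, e = (v + g.+1)%N.
  by exists (e - v).-1; move: ve ve'; lia.
have eE : (e - v = g.+1)%N by rewrite eg addKn.
(* Here m <= n - 2 is used: W - 2 = 2 N - 2 exceeds N - 1 only if N >= 2, and for N = 1 the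
   denominator would vanish. *)
have nz d : (d <= N)%N -> ffx (W - 2) d != 0.
  move=> dN; apply: ffx_neq0 => i id.
  have -> : W - 2 = (2 * N - 2)%:R :> CC R by rewrite natrB//; lia.
  rewrite eqr_nat; lia.
have D0 : ffx (W - 2) e.-1 != 0 by apply: nz; lia.
rewrite eE.
transitivity (\sum_(q < g.+2) ('C(m + e, e) * 'C(e, v))%:R * cpoch (ofR k + m%:R) e / ffx (W - 2) e.-1 *
    ((-1) ^+ q * 'C(g.+1, q)%:R * ffx (W - 2 - v%:R - q%:R) g)).
  apply: eq_bigr => q0 _; have qg : (q0 <= g.+1)%N by rewrite -ltnS.
  move: (nat_of_ord q0) qg => q qg.
  have [u gu] : exists u, g.+1 = (q + u)%N by exists (g.+1 - q)%N; rewrite subnKC.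
  have e1 : e = (v + (q + u))%N by rewrite eg gu.
  have e2 : (e - (v + q) = u)%N by rewrite e1; lia.
  rewrite e2 [(v + q - v)%N]addKn /hbeta /lawcoef -/N -/W.
  have Dq : ffx (W - 2) (v + q) != 0 by apply: nz; lia.
  have -> : cpoch (W - (v + q)%:R - 1) (v + q) = ffx (W - 2) (v + q).
    by rewrite cpoch_ffx; congr ffx; ring.
  have -> : cpoch (wt R n (m + (v + q)) - u%:R + v%:R) q = ffx (W - 2 - e.-1%:R) q.
    rewrite cpoch_ffx; congr ffx.
    have -> : wt R n (m + (v + q)) = W - 2 * (v + q)%:R.
      by rewrite /wt /W -natrM -natrB; [congr (_%:R); rewrite /N; lia|lia].
    have -> : e.-1%:R = (v + q + u)%:R - 1 :> CC R.
      have -> : (v + q + u = e.-1.+1)%N by lia.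
      by rewrite -natr1 addrK.
    by rewrite !natrD; ring.
  (* Two splittings of one falling factorial of length e - 1 + q = v + q + g. *)
  have sp : ffx (W - 2) e.-1 * ffx (W - 2 - e.-1%:R) q =
     ffx (W - 2) (v + q) * ffx (W - 2 - v%:R - q%:R) g.
    rewrite -ffxD -addrA -opprD -natrD -ffxD; congr ffx; lia.
  have -> : ffx (W - 2 - e.-1%:R) q = ffx (W - 2) (v + q) * ffx (W - 2 - v%:R - q%:R) g / ffx (W - 2) e.-1.
    by rewrite -sp mulrAC mulfV ?mul1r.
  have -> : cpoch (ofR k + m%:R) e = cpoch (ofR k + m%:R) (v + q) * cpoch (ofR k + (m + (v + q))%:R) u.
    by rewrite [(m + _)%:R]natrD addrA -cpochD e1 addnA.
  have b := bin_mul4 m v q u.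
  rewrite -e1 -gu in b.
  have {b} := congr1 (fun t => t%:R : CC R) b; rewrite !natrM => b.
  set A := 'C(m + (v + q), v + q)%:R in b *; set B := 'C(m + (v + q) + u, u)%:R in b *.
  set C := 'C(v + q, v)%:R in b *.
  set P1 := cpoch _ (v + q); set P2 := cpoch _ u; set S := (-1) ^+ q.
  set Y := ffx _ g; set Q := ffx _ (v + q) in Dq *; set D := ffx _ e.-1 in D0 *.
  transitivity (A * B * C * (P1 * P2 * S * Y / D)); first by field; rewrite ?Dq ?D0.
  by rewrite b; ring.
by rewrite -mulr_sumr sum_altbin_ffx ?mulr0.
Qed.

Variable a : nat -> CC R -> CC R.
Hypothesis aM : MLDO k (k + (2 * n)%:R) n a.

Let h := hcoef k (2 * n)%:R n a.

Lemma hcoef_qexp m : (m <= n)%N -> exists c, qexp c (h m).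
Proof.
move=> mn; have hs (s : 'I_(n - m).+1) : exists c,
    qexp c (fun z => hbeta m s * Dn s (a (m + s)%N) z).
  have sn : (m + s <= n)%N by have := ltn_ord s; lia.
  have [c cq] := MLDO_qexp aM sn.
  by exists (fun i => hbeta m s * natpow s c i); apply: qexpZ; exact: (qexp_Dn cq).2.
have [c cq] := choice hs.
exists (fun i => \sum_(s < (n - m).+1) c s i).
apply: qexp_ext (qexp_sum _ cq) => z _; exact/esym/hcoef_beta.
Qed.

Lemma hcoef_law m g z : (m + 2 <= n)%N -> SL2Z g -> halfplane z ->
  h m (moebius g z) = autj g z ^+ (2 * (n - m)) * h m z.
Proof.
move=> mn gSL zH; have m_le : (m <= n)%N by lia.
have wH := moebius_halfplane gSL zH.
rewrite /h !hcoef_beta//.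
pose G s u v := hbeta m s * lawcoef k (m + s) u *
   ('C(s, v)%:R * (-1) ^+ (s - v) * cpoch (wt R n (m + s) - u%:R + v%:R) (s - v)) *
   (Xg g z ^+ (u + (s - v)) * Dn v (a (m + s + u)%N) z).
transitivity (autj g z ^+ (2 * (n - m)) *
   \sum_(s < (n - m).+1) \sum_(u < (n - m - s).+1) \sum_(v < s.+1) G s u v).
  rewrite mulr_sumr; apply: eq_bigr => s _.
  have sn : (m + s <= n)%N by have := ltn_ord s; lia.
  rewrite (Dn_law aM gSL s sn zH).
  have -> : (2 * (n - (m + s)) + 2 * s = 2 * (n - m))%N by lia.
  rewrite subnDA mulrCA; congr (_ * _); rewrite mulr_sumr; apply: eq_bigr => u _.
  rewrite /dsum !mulr_sumr; apply: eq_bigr => v _.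
  by rewrite /dterm /G; ring.
congr (_ * _).
(* Terms are collected by the index m + e of the coefficient, e = s + u, and then by the order v of
   its derivative; q = s - v remains as summation index. *)
rewrite (sum_triangle (n - m) (fun s u => \sum_(v < s.+1) G s u v)).
apply: eq_bigr => e _; have en : (e <= n - m)%N by rewrite -ltnS.
rewrite (sum_triangle2 e (fun s v => G s (e - s)%N v)).
have inner (v : 'I_e.+1) : \sum_(q < (e - v).+1) G (v + q)%N (e - (v + q))%N v =
   (if v == ord_max then hbeta m e else 0) * (Xg g z ^+ (e - v) * Dn v (a (m + e)%N) z).
  have ve : (v <= e)%N by rewrite -ltnS.
  rewrite -[v == ord_max]/((v : nat) == e) -(hcoef_cancel mn ve en) mulr_suml.
  apply: eq_bigr => q _; have qe : (q <= e - v)%N by rewrite -ltnS.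
  rewrite /G; congr (_ * (_ ^+ _ * Dn _ (a _) _)); lia.
rewrite (eq_bigr _ (fun v _ => inner v)) (bigD1 ord_max)//= eqxx subnn expr0 mul1r.
by rewrite big1 ?addr0// => v /negbTE ->; rewrite mul0r.
Qed.

Lemma hcoef_modular m : (m + 2 <= n)%N ->
  modular_form ((2 * n)%:R - (2 * m)%:R) (h m).
Proof.
move=> mn; have m_le : (m <= n)%N by lia.
have [c cq] := hcoef_qexp m_le.
split.
- by move=> z zH; exact: (qexp_Dn cq).1 0%N z zH.
- move=> g gSL z zH; have J0 := autj_neq0 gSL zH.
  rewrite /slash hcoef_law// -natrB ?leq_mul2l// -mulnBr cpowN cpow_nat//.
  by rewrite mulrA mulVf ?mul1r// expf_neq0.
- by apply/holo_at_cuspP; exists c.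
Qed.

End HModular.

(** * Inversion *)

Section Inversion.
Variable R : realType.
Implicit Types (z w l x : CC R) (f : CC R -> CC R).

Let fact_neq0 c : c`!%:R != 0 :> CC R.
Proof. by rewrite pnatr_eq0 -lt0n fact_gt0. Qed.

Lemma ffx_nat N d : ffx (N%:R : CC R) d = (N ^_ d)%:R.
Proof.
elim: d => [|d IH]; first by rewrite /ffx big_ord0.
rewrite ffxS IH ffactnSr natrM; have [dN|Nd] := leqP d N; first by rewrite natrB.
by rewrite ffact_small// !mul0r.
Qed.

(* With p_i = (A - i - t - 1)! / (A - i)!, the summand is the difference at i
   of (-1)^(i - 1) C(t - 1, i - 1) (A - i - t)! / (A - i)!. *)
Lemma sum_altbin_fact A t : (2 * t.+1 < A)%N ->
  \sum_(i < t.+2) (-1) ^+ i * 'C(t.+1, i)%:R * (A - 2 * i)%:R *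
     ((A - i - t.+2)`!%:R / (A - i)`!%:R) = 0 :> CC R.
Proof.
move=> At; pose T i : CC R := (-1) ^+ i * 'C(t.+1, i)%:R * (A - 2 * i)%:R *
     ((A - i - t.+2)`!%:R / (A - i)`!%:R).
pose G j : CC R := if j is j'.+1 then (-1) ^+ j' * 'C(t, j')%:R *
     ((A - j' - t.+2)`!%:R / (A - j'.+1)`!%:R) else 0.
suff H j : (j <= t.+2)%N -> \sum_(i < j) T i = G j.
  by rewrite (H t.+2)// /G bin_small// mulr0 mul0r.
elim: j => [|j IH] jt; first by rewrite big_ord0.
rewrite big_ord_recr /= IH; last exact: ltnW.
have Aj : (A - j = (A - j.+1).+1)%N by lia.
case: j IH jt Aj => [|j] IH jt Aj.
  rewrite /G /T !expr0 !bin0 muln0 subn0 add0r !mul1r.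
  rewrite !subn0 in Aj; have fA : (A`! = A * (A - 1)`!)%N by rewrite {1}Aj factS -Aj.
  have A0 : A%:R != 0 :> CC R by rewrite pnatr_eq0; lia.
  by rewrite fA natrM; field; rewrite A0 fact_neq0.
rewrite /G /T.
have e1 : (A - j - t.+2 = (A - j.+1 - t.+2).+1)%N by lia.
have f1 : (A - j - t.+2)`!%:R = (A - j - t.+2)%:R * (A - j.+1 - t.+2)`!%:R :> CC R.
  by rewrite e1 factS natrM.
have f2 : (A - j.+1)`!%:R = (A - j.+1)%:R * (A - j.+2)`!%:R :> CC R.
  by rewrite Aj factS natrM.
rewrite f1 f2 binS natrD exprS.
set p := (A - j.+1 - t.+2)`!%:R; set q := (A - j.+2)`!%:R.
have q0 : q != 0 by exact: fact_neq0.
have e2 : (A - j - t.+2)%:R = A%:R - j%:R - t%:R - 2 :> CC R.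
  by rewrite !natrB; [rewrite -!natr1; ring|lia..].
have e3 : (A - j.+1)%:R = A%:R - j%:R - 1 :> CC R.
  by rewrite natrB; [rewrite -natr1; ring|lia].
have e4 : (A - 2 * j.+1)%:R = A%:R - 2 * j%:R - 2 :> CC R.
  by rewrite natrB; [rewrite natrM -natr1; ring|lia].
have n0 : (A - j.+1)%:R != 0 :> CC R by rewrite pnatr_eq0; lia.
have := mul_bin_left t j => /(congr1 (fun m => m%:R : CC R)).
have jt2 : (j <= t)%N by lia.
rewrite !natrM natrB// -natr1 e2 e4 -[A%:R](subrK 1).
have -> : A%:R - 1 = (A - j.+1)%:R + j%:R :> CC R by rewrite e3; ring.
move: n0; clearbody p; set B := (A - j.+1)%:R.
set a := 'C(t, j.+1)%:R; set b := 'C(t, j)%:R => B0 h.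
apply/eqP; rewrite -subr_eq0; apply/eqP.
transitivity ((-1) ^+ j * p / (B * q) * ((j%:R + 1) * a - (t%:R - j%:R) * b)); last first.
  by rewrite h subrr mulr0.
by field; rewrite B0 q0.
Qed.

Variables (k : R) (n : nat).

(** For l = K - 2m the first binomial of the bracket has the natural number 2n - m - 1 as upper
    entry; only the one involving k stays generalised. *)
Definition RC_coef m i : CC R := (-1) ^+ i * 'C(2 * n - m - 1, m - i)%:R *
  (cpoch (ofR k + (m - i)%:R) i / i`!%:R).

Lemma ofR_gbin (x : R) i : ofR (gbin x i) = ffx (ofR x) i / i`!%:R.
Proof.
rewrite ofRM ofRV ofR_nat (big_morph _ (@ofRM R) (@ofR1 R)); congr (_ / _).
by apply: eq_bigr => j _; rewrite ofRD ofRN ofR_nat.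
Qed.

Lemma RC_coef_gbin m i (l : R) : (i <= m)%N -> (m < n)%N -> l = (2 * n)%:R - 2 * m%:R ->
  ofR ((-1) ^+ i * gbin (m%:R + l - 1) (m - i) * gbin (m%:R + k - 1) i) = RC_coef m i.
Proof.
move=> im mn ->; rewrite ofRM ofRM !ofR_gbin ofRX ofRN ofR1 /RC_coef; congr (_ * _ * (_ / _)).
  have -> : m%:R + ((2 * n)%:R - 2 * m%:R) - 1 = (2 * n - m - 1)%:R :> R.
    by rewrite !natrB; [ring|lia|lia].
  by rewrite ofR_nat ffx_nat -bin_ffact natrM mulfK.
rewrite cpoch_ffx !ofRD ofRN ofR1 ofR_nat; congr ffx.
by rewrite natrB//; ring.
Qed.

(** The coefficient of D^t(a_(r+t)) D^r f in the sum of brackets. Once the factors independent of i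
    are taken out, what is left for t > 0 is the telescoping sum [sum_altbin_fact]. *)
Lemma RC_coef_hbeta_sum r t : (r + t < n)%N ->
  \sum_(i < t.+1) 'C(2 * n - (r + i) - 1, r + i)%:R^-1 * RC_coef (r + i) i * hbeta k n (r + i) (t - i) =
  if t == 0%N then 1 else 0.
Proof.
move=> rtn; pose A := (2 * n - 2 * r - 1)%N.
have At : (2 * t < A)%N by rewrite /A; lia.
transitivity (\sum_(i < t.+1) (r + t)`!%:R * cpoch (ofR k + r%:R) t / (r`!%:R * t`!%:R) *
   ((-1) ^+ i * 'C(t, i)%:R * (A - 2 * i)%:R * ((A - i - t.+1)`!%:R / (A - i)`!%:R))).
  apply: eq_bigr => i0 _; have it : (i0 <= t)%N by rewrite -ltnS.
  move: (nat_of_ord i0) it => i it.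
  have [s ts] : exists s, t = (i + s)%N by exists (t - i)%N; rewrite subnKC.
  have ts' : (t - i = s)%N by rewrite ts addKn.
  rewrite /RC_coef /hbeta ts'.
  have e1 : (2 * n - (r + i) - 1 = (A - 2 * i) + (r + i))%N by rewrite /A; lia.
  have e2 : (2 * n - (r + i) - 1 = (A - i) + r)%N by rewrite /A; lia.
  have -> : 'C(2 * n - (r + i) - 1, r + i)%:R = ((A - i) + r)`!%:R / ((A - 2 * i)`!%:R * (r + i)`!%:R) :> CC R.
    by rewrite e1 natr_bin -e1 e2.
  have -> : (r + i - i = r)%N by rewrite addnK.
  rewrite e2 !natr_bin.
  have -> : cpoch ((2 * (n - (r + i)))%:R - s%:R - 1) s = ((A - 2 * i).-1)`!%:R / (A - i - t.+1)`!%:R :> CC R.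
    have -> : (2 * (n - (r + i)))%:R - s%:R - 1 = ((A - 2 * i).-1)%:R - s%:R + 1 :> CC R.
      have -> : (2 * (n - (r + i)) = (A - 2 * i).-1.+2)%N by rewrite /A; lia.
      by rewrite -!natr1; ring.
    have -> : (A - i - t.+1 = (A - 2 * i).-1 - s)%N by lia.
    rewrite cpoch_ffx.
    have -> : ((A - 2 * i).-1)%:R - s%:R + 1 + s%:R - 1 = ((A - 2 * i).-1)%:R :> CC R by ring.
    have sA : (s <= (A - 2 * i).-1)%N by lia.
    by rewrite ffx_nat -(ffact_fact sA) natrM mulfK.
  have eA : (A - 2 * i = (A - 2 * i).-1.+1)%N by lia.
  have -> : (A - 2 * i)`!%:R = (A - 2 * i)%:R * ((A - 2 * i).-1)`!%:R :> CC R.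
    by rewrite {1}eA factS -eA natrM.
  have -> : cpoch (ofR k + r%:R) t = cpoch (ofR k + r%:R) i * cpoch (ofR k + (r + i)%:R) s.
    by rewrite natrD addrA -cpochD ts.
  have -> : 'C(t, i)%:R = t`!%:R / (i`!%:R * s`!%:R) :> CC R.
    by rewrite ts -bin_sub ?leq_addr// addKn natr_bin.
  have -> : (r + i + s = r + t)%N by rewrite ts addnA.
  have A0 : (A - 2 * i)%:R != 0 :> CC R by rewrite pnatr_eq0; lia.
  have f1 := fact_neq0 (A - i + r); have f2 := fact_neq0 (A - 2 * i).-1.
  have f3 := fact_neq0 (r + i); have f4 := fact_neq0 (A - i); have f5 := fact_neq0 r.
  have f6 := fact_neq0 i; have f7 := fact_neq0 s; have f8 := fact_neq0 t.
  have f9 := fact_neq0 (A - i - t.+1).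
  move: f1 f2 f3 f4 f5 f6 f7 f8 f9 A0.
  set F1 := (_ + r)`!%:R; set F2 := (_.-1)`!%:R; set F3 := (r + i)`!%:R; set F4 := (A - i)`!%:R.
  set F5 := r`!%:R; set F6 := i`!%:R; set F7 := s`!%:R; set F8 := t`!%:R; set F9 := (_ - t.+1)`!%:R.
  set A' := (A - 2 * i)%:R => f1 f2 f3 f4 f5 f6 f7 f8 f9 A0.
  by field; rewrite f1 f2 f3 f4 f5 f6 f7 f8 f9 A0.
rewrite -mulr_sumr; case: t rtn At => [|t] rtn At /=; last first.
  by rewrite sum_altbin_fact ?mulr0.
rewrite big_ord_recl big_ord0 addr0 /= muln0 !subn0 addn0 /cpoch big_ord0 expr0 bin0 fact0 !mulr1 !mul1r.
have fA : (A`! = A * (A - 1)`!)%N.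
  have eA : (A = (A - 1).+1)%N by lia.
  by rewrite {1}eA factS -eA.
have A0 : A%:R != 0 :> CC R by rewrite pnatr_eq0; lia.
by rewrite mulfV// mul1r fA natrM; field; rewrite A0 fact_neq0.
Qed.

End Inversion.

(** * The subleading coefficient, and the decomposition of the operator *)

Section Main.
Variable R : realType.
Variables (k : R) (n : nat) (a : nat -> CC R -> CC R).
Hypothesis n1 : (1 <= n)%N.
Hypothesis aM : MLDO k (k + (2 * n)%:R) n a.
Hypothesis an1 : monic_diffop n a.

(** For j = n - 1 the law of the coefficients has only two terms, and a_n = 1 turns the second one
    into an anomaly with lam = - n (k + n - 1) / tau. *)
Lemma subleading_E2 z : halfplane z ->
  a n.-1 z = - ofR (n%:R * (k + n%:R - 1) / 12) * E2 z.
Proof.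
move=> zH; have nn : (n.-1 <= n)%N by lia.
have [c cq] := MLDO_qexp aM nn.
have t0 := tau_neq0 R.
pose lam : CC R := - (n%:R * (ofR k + n.-1%:R)) / tau R.
have law (x y c' d : int) (w : CC R) : x * d - y * c' = 1 -> halfplane w ->
    a n.-1 ((x%:~R * w + y%:~R) / (c'%:~R * w + d%:~R)) =
    (c'%:~R * w + d%:~R) ^+ 2 * a n.-1 w + lam * c'%:~R * (c'%:~R * w + d%:~R).
  move=> det wH; pose g : 'M[int]_2 := \matrix_(i < 2, j < 2)
    if i == 0 then (if j == 0 then x else y) else (if j == 0 then c' else d).
  have gSL : SL2Z g by rewrite /SL2Z det_mx22 !mxE.
  have := MLDO_law aM gSL nn wH; rewrite /moebius /autj !mxE /= => ->.
  have -> : (n - n.-1 = 1)%N by lia.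
  rewrite !big_ord_recl big_ord0 /= /lawcoef /Xg /autj !mxE /= !addn0 bin0 /cpoch big_ord0 big_ord_recl big_ord0.
  have -> : (n.-1 + bump 0 0 = n)%N by rewrite /bump /=; lia.
  rewrite an1// /bump /= addn0 bin1 expr1 expr0 addr0 muln1 /lam.
  have J0 := autj_neq0 gSL wH; rewrite /autj !mxE /= in J0.
  by field; rewrite ?J0 ?t0.
rewrite (quasi_E2 cq law zH); congr (_ * _).
rewrite /lam !ofRM ofRV !ofRD ofRN ofR1 !ofR_nat.
have -> : n.-1%:R = n%:R - 1 :> CC R by rewrite -[in RHS](prednK n1) -natr1 addrK.
by field.
Qed.

Lemma smoothH_E2 : smoothH (@E2 R).
Proof.
have h := qexpD (qexp_cst 1) (qexpZ (-24) (qexp_qs (@subexp_sigma R))).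
apply: (qexp_Dn (qexp_ext _ h)).1 => z zH.
by rewrite (E2E zH) mulNr.
Qed.

Lemma Dn_an s z : (0 < s)%N -> halfplane z -> Dn s (a n) z = 0.
Proof.
move=> s0 zH; rewrite (@Dn_extH R (a n) (fun=> 1))//.
by rewrite (smoothH_cst 1).2//; case: s s0.
Qed.

(* The term s = n - m of hcoef, which contains a_n = 1, has derivative zero; the
   truncated sum also makes sense for m = n - 1, where it gives a_(n-1). *)
Definition hcoef_jet m i z : CC R := \sum_(s < (n - m)) hbeta k n m s * Dn (s + i) (a (m + s)%N) z.

Lemma Dn_hcoef m i z : (m + 2 <= n)%N -> halfplane z ->
  Dn i (hcoef k (2 * n)%:R n a m) z = hcoef_jet m i z.
Proof.
move=> mn zH; have m_le : (m <= n)%N by lia.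
pose F i z := \sum_(s < (n - m).+1) hbeta k n m s * Dn (s + i) (a (m + s)%N) z.
have FD j w : halfplane w -> has_cderiv (F j) w (tau R * F j.+1 w).
  move=> wH; rewrite mulr_sumr; apply: has_cderiv_sum => s.
  have sn : (m + s <= n)%N by have := ltn_ord s; lia.
  rewrite mulrCA addnS; apply: has_cderivZ.
  by apply: smoothH_deriv => //; exact: MLDO_smooth aM _ sn.
transitivity (F i z).
  rewrite -(tower_smoothH FD).2//; apply: Dn_extH => // w wH.
  by rewrite hcoef_beta//; apply: eq_bigr => s _; rewrite addn0.
rewrite /F big_ord_recr /= subnKC// Dn_an ?mulr0 ?addr0//; lia.
Qed.

(** A formal identity in the derivatives of f and of the a_j. It is sorted by the order r = m - i of
    the derivative of f and then by t = s + i, so that [RC_coef_hbeta_sum] leaves t = 0 alone. *)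
Lemma RC_inversion (f : CC R -> CC R) z :
  \sum_(m < n) 'C(2 * n - m - 1, m)%:R^-1 *
      (\sum_(i < m.+1) RC_coef k n m i * hcoef_jet m i z * Dn (m - i) f z) =
  \sum_(r < n) a r z * Dn r f z.
Proof.
rewrite /hcoef_jet; case: n n1 => [//|n'] _.
pose G m i s := 'C(2 * n'.+1 - m - 1, m)%:R^-1 * RC_coef k n'.+1 m i * hbeta k n'.+1 m s *
   (Dn (s + i) (a (m + s)%N) z * Dn (m - i) f z).
transitivity (\sum_(m < n'.+1) \sum_(r < m.+1) \sum_(s < (n' - m).+1) G m (m - r)%N s).
  apply: eq_bigr => m _; have mn : (m <= n')%N by rewrite -ltnS.
  rewrite mulr_sumr (reindex_inj rev_ord_inj); apply: eq_bigr => r _ /=.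
  rewrite subSS mulr_sumr mulr_suml mulr_sumr subSn//; apply: eq_bigr => s _.
  by rewrite /G; ring.
rewrite (sum_triangle2 n' (fun m r => \sum_(s < (n' - m).+1) G m (m - r)%N s)).
apply: eq_bigr => r _; have rn : (r <= n')%N by rewrite -ltnS.
transitivity (\sum_(i < (n' - r).+1) \sum_(s < (n' - r - i).+1) G (r + i)%N i s).
  by apply: eq_bigr => i _; rewrite addKn subnDA.
rewrite (sum_triangle (n' - r) (fun i s => G (r + i)%N i s)).
transitivity (\sum_(t < (n' - r).+1) (if t == ord0 then 1 else 0) *
    (Dn t (a (r + t)%N) z * Dn r f z)).
  apply: eq_bigr => t _; have rt : (r + t < n'.+1)%N by have := ltn_ord t; lia.
  rewrite -[t == ord0]/((t : nat) == 0%N) -(RC_coef_hbeta_sum k rt) mulr_suml.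
  apply: eq_bigr => i _; have it : (i <= t)%N by rewrite -ltnS.
  by rewrite /G addnK -addnA subnK// subnKC.
rewrite (bigD1 ord0)//= mul1r addn0 big1 ?addr0// => t /negbTE ->.
by rewrite mul0r.
Qed.

End Main.

Theorem theorem7 (R : realType) (k : R) (n : nat) (a : nat -> CC R -> CC R)
    (K := (2 * n)%:R : R) (h := hcoef k K n a) :
  (1 <= n)%N ->
  MLDO k (k + K) n a ->
  monic_diffop n a ->
  (forall m : nat, (m + 2 <= n)%N ->
     modular_form ((2 * n)%:R - (2 * m)%:R) (h m)) /\
  (forall f : CC R -> CC R, holo_on_H f -> forall z : CC R, halfplane z ->
     diffop n a f z =
       KK k n f z
       + \sum_(m < n.-1)
           ('C(2 * n - m - 1, m)%:R)^-1 * RC m (K - 2 * m%:R) k (h m) f z).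
Proof.
move=> n1 aM an1; split; first by move=> m mn; apply: hcoef_modular.
move=> f _ z zH.
have RCE m (l : R) g : (m < n)%N -> l = K - 2 * m%:R ->
    RC m l k g f z = \sum_(i < m.+1) RC_coef k n m i * Dn i g z * Dn (m - i) f z.
  move=> mn lE; apply: eq_bigr => i _; rewrite (RC_coef_gbin k _ mn lE)//.
  by rewrite -ltnS.
rewrite /diffop big_ord_recr /= an1// mul1r -(RC_inversion k a n1) /KK.
rewrite addrC -addrA; congr (_ + _).
have nP := prednK n1.
have nlt : (n.-1 < n)%N by rewrite nP.
have recr (T : nat -> CC R) : \sum_(m < n) T m = \sum_(m < n.-1) T m + T n.-1.
  by case: (n) n1 => [//|n'] _; exact: big_ord_recr.
rewrite (recr (fun m => 'C(2 * n - m - 1, m)%:R^-1 *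
   \sum_(i < m.+1) RC_coef k n m i * hcoef_jet k n a m i z * Dn (m - i) f z)) addrC.
congr (_ + _).
  apply: eq_bigr => m _; have mn : (m + 2 <= n)%N by have := ltn_ord m; lia.
  congr (_ * _); rewrite RCE//; last by lia.
  by apply: eq_bigr => i _; rewrite (Dn_hcoef n1 aM an1).
rewrite RCE//; last first.
  by rewrite /K natrM -[in n%:R]nP -natr1; ring.
(* In the remaining term m = n - 1 the weight K - 2m is 2, that of E2, and the inverse binomial 1 /
   n cancels the n of the subleading coefficient, leaving the constant (k + n - 1) / 12 of [KK]. *)
have -> : 'C(2 * n - n.-1 - 1, n.-1)%:R = n%:R :> CC R.
  have -> : (2 * n - n.-1 - 1 = n)%N by lia.
  by rewrite -bin_sub ?leq_pred//; congr (_%:R); rewrite (_ : n - n.-1 = 1)%N ?bin1//; lia.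
rewrite -mulNr !mulr_sumr; apply: eq_bigr => i _.
have -> : hcoef_jet k n a n.-1 i z = - ofR (n%:R * (k + n%:R - 1) / 12) * Dn i (@E2 R) z.
  rewrite /hcoef_jet (_ : n - n.-1 = 1)%N; last by lia.
  rewrite big_ord_recl big_ord0 addr0 /= /hbeta /cpoch !big_ord0 !addn0 bin0 divr1 !mul1r add0n.
  rewrite -(smoothHZ _ (@smoothH_E2 R)).2//; apply: Dn_extH => // w wH.
  by rewrite (subleading_E2 n1 aM an1 wH).
have nR : n%:R != 0 :> CC R by rewrite pnatr_eq0; lia.
rewrite !ofRM ofRV !ofR_nat; by field.
Qed.
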